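(* There exists $n_0$ such that, for all $n\ge n_0$, $$m(n)=\begin{cases}3^{n/3}+12n & \text{if } n\equiv 0 \pmod 3,\\ 4\cdot 3^{(n-4)/3}+12n+51 & \text{if } n\equiv 1 \pmod 3,\\ 2\cdot 3^{(n-2)/3}+12n-36 & \text{if } n\equiv 2 \pmod 3.\end{cases}$$
   Context: All graphs are finite and simple. $m(n)$ denotes the maximum number of induced cycles (of any length $\ge 3$) that can be contained in a graph on $n$ vertices. *)

(* Defs.v *)
From mathcomp Require Import all_boot.

Set Implicit Arguments.
Unset Strict Implicit.
Unset Printing Implicit Defensive.

Definition simple_graph (T : finType) (e : rel T) : bool :=
  [forall x, ~~ e x x] && [forall x, forall y, e x y == e y x].

(* Adjacency in the cycle C_k on {0, ..., k-1}; for k < 3 this is not a cycle. *)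
Definition cycle_adj (k : nat) : rel 'I_k :=
  fun i j => (j == ordS i) || (i == ordS j).

(* S carries an induced cycle when the subgraph induced on S is isomorphic to
   C_#|S| with #|S| >= 3. An induced cycle is determined by its vertex set. *)
Definition induced_cycle (T : finType) (e : rel T) (S : {set T}) : bool :=
  (3 <= #|S|) &&
  [exists f : {ffun 'I_#|S| -> T},
    [&& injectiveb f,
        f @: [set: 'I_#|S|] == S &
        [forall i, forall j, e (f i) (f j) == cycle_adj i j]]].

Definition num_induced_cycles (T : finType) (e : rel T) : nat :=
  #|[set S : {set T} | induced_cycle e S]|.

(* Binary relations on 'I_n are encoded as {ffun 'I_n * 'I_n -> bool} so that
   the maximum ranges over a finite type. *)
Definition max_induced_cycles (n : nat) : nat :=
  \max_(g : {ffun 'I_n * 'I_n -> bool} | simple_graph (fun x y => g (x, y)))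
     num_induced_cycles (fun x y => g (x, y)).

Lemma num_induced_cycles_le_max (T : finType) (e : rel T) :
  symmetric e -> irreflexive e ->
  num_induced_cycles e <= max_induced_cycles #|T|.
Proof.
move=> esym eirr.
pose g := [ffun p : 'I_#|T| * 'I_#|T| => e (enum_val p.1) (enum_val p.2)].
have gE x y : g (x, y) = e (enum_val x) (enum_val y) by rewrite ffunE.
have gP : simple_graph (fun x y => g (x, y)).
  apply/andP; split; first by apply/forallP=> x; rewrite gE eirr.
  by apply/forallP=> x; apply/forallP=> y; rewrite !gE esym.
suff le_g : num_induced_cycles e <= num_induced_cycles (fun x y => g (x, y)).
  by rewrite /max_induced_cycles (bigD1 g) //= leq_max le_g.
have rinj : injective (@enum_rank T) := @enum_rank_inj T.
have iinj : injective (fun S : {set T} => enum_rank @: S) by exact: imset_inj.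
rewrite /num_induced_cycles -(card_imset _ iinj); apply: subset_leq_card.
apply/subsetP=> _ /imsetP[S + ->]; rewrite !inE => /andP[S3 /existsP[f]].
move=> /and3P[/injectiveP finj /eqP fS /forallP fe].
rewrite /induced_cycle card_imset // S3 /=; apply/existsP.
exists [ffun i => enum_rank (f i)]; apply/and3P; split.
- by apply/injectiveP=> i j; rewrite !ffunE => /rinj /finj.
- apply/eqP; have <- := congr1 (fun A : {set T} => enum_rank @: A) fS.
  by rewrite -imset_comp; apply: eq_imset => i; rewrite ffunE.
- apply/forallP=> i; apply/forallP=> j; rewrite ffunE /= !ffunE !enum_rankK.
  by move/forallP: (fe i); apply.
Qed.

(* Main.v *)
Require Import Defs.
From mathcomp Require Import all_boot.
From mathcomp Require Import all_order all_algebra zify ring lra.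

(* Upper bound. An induced cycle is counted by growing it as an induced path:
   at every step all d candidate successors of the current vertex are used up and
   the path continues in one of them, so the count obeys the Moon-Moser recursion
   max_d d * g (n - d). A weighted form of this recursion shows that in a graph
   with about 3^(n/3) induced cycles some path branches into exactly three
   vertices, with the same continuation for each of them, at all but a small
   fraction of its steps. A vertex of degree at least D lies on few cycles, so D
   may be taken constant, and then some stretch of such a path is a segment:
   eight consecutive triples, completely joined in order, whose inner triples
   have no other neighbours. Cutting the segment out yields a recursion for the
   maximum m(n), which puts m(n) asymptotically within a factor 1.2 of the
   Moon-Moser number. Using this again, the remaining paths must attain the
   Moon-Moser bound almost exactly, which happens only if the rest of the graph
   is itself a sequence of completely joined layers with 2, 3 or 4 vertices. So
   an extremal graph is a cyclic braid of such layers, in which an induced cycle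
   either meets every layer once or has two vertices in some layer and stays
   close to it; the latter are counted layer by layer and give the linear term.

   Lower bound. The cyclic braid of independent triples, with one layer of
   size 4 or 2 when 3 does not divide n. *)

Set Implicit Arguments.
Unset Strict Implicit.
Unset Printing Implicit Defensive.

(** Starting the path count costs a polynomial factor: a cycle is found from a vertex and its two
    cycle neighbours, so the recursion alone bounds the cycles only by about [n ^ 3] Moon-Moser
    numbers. A segment removes this factor: a long cycle through it starts in one of [3 ^ 4] ways,
    and [81 * mm3 (n - 12) = mm3 n] is exactly the main term. While looking for a segment the factor
    [n ^ 3] must be tolerated. It is beaten by a weight slightly above 1 on every imperfect step:
    paths whose defect exceeds a small multiple of [n] are then too few to matter. Such weights
    cannot be put on [mm3] itself, where degrees 2 and 4 can be as good as 3; hence the second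
    potential [pot]. Threefold branching alone does not give complete joins, because the three
    candidates may continue differently; the targets control how often this happens. *)

(** * The Moon-Moser recursion *)

(* Three times the largest product of positive integers with sum n >= 2. The
   factor 3 keeps the recursion integral at n = 1. *)
Definition mm3 (n : nat) : nat := 3 ^ (n %/ 3) * nth 0 [:: 3; 4; 6] (n %% 3).

(* A supersolution of the recursion of mm3, of the same order, for which every
   branching degree other than 3 loses a factor 97/100. *)
Definition pot (n : nat) : nat := 3 ^ (n %/ 3) * nth 0 [:: 25; 36; 52] (n %% 3).

Lemma mm3D3 n : mm3 (n + 3) = 3 * mm3 n.
Proof. by rewrite /mm3 divnDr // modnDr addn1 expnS mulnA. Qed.

Lemma potD3 n : pot (n + 3) = 3 * pot n.
Proof. by rewrite /pot divnDr // modnDr addn1 expnS mulnA. Qed.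

Lemma ind3 (P : nat -> Prop) :
  P 0 -> P 1 -> P 2 -> (forall n, P n -> P (n + 3)) -> forall n, P n.
Proof.
move=> P0 P1 P2 PS n; have [m] := ubnP n; elim: m n => // m IH [|[|[|n]]] // lt_n.
by rewrite -addn3; apply: PS; apply: IH; lia.
Qed.

Lemma mm3_gt0 n : 0 < mm3 n.
Proof. by elim/ind3: n => // n; rewrite mm3D3; lia. Qed.

Lemma pot_gt0 n : 0 < pot n.
Proof. by elim/ind3: n => // n; rewrite potD3; lia. Qed.

Lemma mm3S n : 4 * mm3 n <= 3 * mm3 n.+1 /\ 2 * mm3 n.+1 <= 3 * mm3 n.
Proof. by elim/ind3: n => // n; rewrite -addSn !mm3D3; lia. Qed.

Lemma potS n : 4 * pot n <= 3 * pot n.+1.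
Proof. by elim/ind3: n => // n; rewrite -addSn !potD3; lia. Qed.

Lemma mm3_mono m n : m <= n -> mm3 m <= mm3 n.
Proof.
move/subnKC=> <-; elim: (n - m) => [|d IH]; rewrite ?addn0 // addnS.
by apply: leq_trans IH _; have [] := mm3S (m + d); lia.
Qed.

Lemma pot_mono m n : m <= n -> pot m <= pot n.
Proof.
move/subnKC=> <-; elim: (n - m) => [|d IH]; rewrite ?addn0 // addnS.
by apply: leq_trans IH _; have := potS (m + d); lia.
Qed.

Lemma pot_le_mm3 n : pot n <= 9 * mm3 n.
Proof. by elim/ind3: n => // n; rewrite potD3 mm3D3; lia. Qed.

(** The integers in [pot] approximate [25 * 3 ^ (n / 3)], so the quotient of the two sides is
    governed by [d / 3 ^ (d / 3)]. Away from 3 this is largest at [d = 2], about 0.962, which leaves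
    room for 97/100. *)
Lemma pot_branch d n : d != 3 -> 100 * (d * pot n) <= 97 * pot (n + d).
Proof.
have base e : e < 7 -> e != 3 -> 100 * (e * pot n) <= 97 * pot (n + e).
  case: e => [|[|[|[|[|[|[|//]]]]]]] // _ _; elim/ind3: n => // n;
    by rewrite (addnAC n 3) !potD3; lia.
have [k] := ubnP d; elim: k d => // k IH d lt_d d3.
have [lt7|ge7] := ltnP d 7; first exact: base.
(* For [d >= 7] three units of the degree are traded for a factor 3 of the potential, as
   [d <= 3 * (d - 3)]. *)
have := IH (d - 3) ltac:(lia) ltac:(lia).
have -> : n + d = n + (d - 3) + 3 by lia.
rewrite potD3; nia.
Qed.

Lemma pot_branch_le d n : d * pot n <= pot (n + d).
Proof.
have [->|d3] := eqVneq d 3; first by rewrite potD3.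
by have := pot_branch n d3; lia.
Qed.

Definition mm_opt d n :=
  [|| d == 3, (d == 2) && ((n + d) %% 3 != 0) | (d == 4) && ((n + d) %% 3 == 1)].

(** Besides 3, the degrees 2 and 4 are tight for suitable residues. The gap 8/9 of all other cases
    is attained, for instance by 4 * 2 against 3 * 3. *)
Lemma mm3_branch d n :
  if mm_opt d n then d * mm3 n = mm3 (n + d) else 9 * (d * mm3 n) <= 8 * mm3 (n + d).
Proof.
have base e : e < 7 ->
  if mm_opt e n then e * mm3 n = mm3 (n + e) else 9 * (e * mm3 n) <= 8 * mm3 (n + e).
  have mo m : mm_opt e (m + 3) = mm_opt e m by rewrite /mm_opt -addnA [3 + e]addnC addnA modnDr.
  case: e mo => [|[|[|[|[|[|[|//]]]]]]] mo _; elim/ind3: n => [|||n IH] //;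
    by move: IH; rewrite mo ?(addnAC n 3) !mm3D3; case: mm_opt; lia.
have [k] := ubnP d; elim: k d => // k IH d lt_d.
have [lt7|ge7] := ltnP d 7; first exact: base.
have -> : mm_opt d n = false by rewrite /mm_opt; lia.
have := IH (d - 3) ltac:(lia).
have -> : n + d = n + (d - 3) + 3 by lia.
rewrite mm3D3; case: mm_opt; nia.
Qed.

Lemma mm3_branch_le d n : d * mm3 n <= mm3 (n + d).
Proof. by have := mm3_branch d n; case: mm_opt; lia. Qed.

(** * Induced paths and cycles *)

Section Paths.
Variables (T : finType) (e : rel T).
Hypotheses (e_sym : symmetric e) (e_irr : irreflexive e).
Implicit Types (U C : {set T}) (s t w x y : T) (p : seq T).

Definition nbh (x : T) : {set T} := [set y | e x y].

Lemma in_nbh x y : (y \in nbh x) = e x y. Proof. by rewrite inE. Qed.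

(* Induced paths, without their first vertex s, that run from s through U and
   stop at the first neighbour of t; n is fuel. *)
Fixpoint ipaths (t : T) (n : nat) (U : {set T}) (s : T) : seq (seq T) :=
  if e s t then [:: [::]] else
  if n is m.+1 then
    flatten [seq [seq w :: p | p <- ipaths t m (U :\: nbh s) w]
            | w <- enum (nbh s :&: U)]
  else [::].

Lemma big_ipathsS (R : Type) (idx : R) (op : Monoid.law idx) t n U s
    (F : seq T -> R) : e s t = false ->
  \big[op/idx]_(p <- ipaths t n.+1 U s) F p =
  \big[op/idx]_(w <- enum (nbh s :&: U))
     \big[op/idx]_(p <- ipaths t n (U :\: nbh s) w) F (w :: p).
Proof.
by move=> est; rewrite /= est big_flatten big_map; apply: eq_bigr => w _; rewrite big_map.
Qed.

Lemma size_ipathsS t n U s : e s t = false ->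
  size (ipaths t n.+1 U s) =
  \sum_(w in nbh s :&: U) size (ipaths t n (U :\: nbh s) w).
Proof.
move=> est; rewrite -sum1_size big_ipathsS // big_enum /=.
by apply: eq_bigr => w _; rewrite sum1_size.
Qed.

Lemma ipaths_end t n U s : e s t -> ipaths t n U s = [:: [::]].
Proof. by case: n => [|n] /= ->. Qed.

Lemma mem_ipathsS t n U s w p : e s t = false -> w \in nbh s -> w \in U ->
  p \in ipaths t n (U :\: nbh s) w -> w :: p \in ipaths t n.+1 U s.
Proof.
move=> est ws wU pin /=; rewrite est; apply/flattenP.
exists [seq w :: p0 | p0 <- ipaths t n (U :\: nbh s) w]; last exact: map_f.
by apply/mapP; exists w => //; rewrite mem_enum in_setI ws wU.
Qed.

Lemma ipaths_consP t n U s w p : w :: p \in ipaths t n U s ->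
  exists m, [/\ n = m.+1, e s t = false, w \in nbh s :&: U
             & p \in ipaths t m (U :\: nbh s) w].
Proof.
case: n => [|n] /=; case: ifP => //= est /flattenP[l /mapP[w' + ->]].
by rewrite mem_enum => w'A /mapP[p' p'in [-> ->]]; exists n.
Qed.

Lemma ipaths_nilP t n U s : [::] \in ipaths t n U s -> e s t.
Proof.
case: n => [|n] /=; case: ifP => // est /flattenP[l /mapP[w' _ ->]].
by case/mapP.
Qed.

(* A cyclic enumeration of C, read as a function on {0, ..., k-1}. *)
Definition cycle_enum (C : {set T}) (k : nat) (g : nat -> T) : Prop :=
  [/\ 3 <= k, (forall x, x \in C <-> exists2 i, i < k & x = g i),
      (forall i j, i < k -> j < k -> g i = g j -> i = j)
    & (forall i j, i < j -> j < k ->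
         e (g i) (g j) = (j == i.+1) || ((i == 0) && (j == k.-1)))].

Lemma induced_cycle_enum C : induced_cycle e C -> exists k g, cycle_enum C k g.
Proof.
case/andP=> C3 /existsP[f /and3P[/injectiveP finj /eqP fC /forallP fe]].
have k0 : 0 < #|C| by lia.
pose o (i : nat) : 'I_#|C| := insubd (Ordinal k0) i.
have oE i : i < #|C| -> val (o i) = i by move=> lt_i; rewrite /o val_insubd lt_i.
have oK (i : 'I_#|C|) : o (val i) = i by apply: val_inj; rewrite oE ?ltn_ord.
exists #|C|, (fun i => f (o i)); split=> //.
- move=> x; rewrite -[in X in X <-> _]fC; split=> [/imsetP[i _ ->]|[i lti ->]].
    by exists (val i); rewrite ?oK ?ltn_ord.
  by apply/imsetP; exists (o i); rewrite ?inE.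
- by move=> i j lti ltj /finj /(congr1 val); rewrite !oE.
move=> i j ltij ltj; have lti : i < #|C| by lia.
move/forallP: (fe (o i)) => /(_ (o j)) /eqP ->.
rewrite /cycle_adj -!val_eqE /= !oE //.
have [->|ne] := eqVneq j #|C|.-1; last first.
  by rewrite !modn_small; lia.
have -> : (#|C|.-1.+1) = #|C| by lia.
by rewrite modnn modn_small; lia.
Qed.

Lemma enum_induced_cycle C k g : cycle_enum C k g -> induced_cycle e C.
Proof.
case=> k3 CE ginj ge.
have cC : #|C| = k.
  have -> : C = [set g (val i) | i : 'I_k].
    apply/setP=> x; apply/idP/imsetP=> [/CE[i lti ->]|[i _ ->]].
      by exists (Ordinal lti).
    by apply/CE; exists (val i); rewrite ?ltn_ord.
  rewrite card_imset ?card_ord // => i j /ginj E.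
  by apply: val_inj; apply: E; rewrite ?ltn_ord.
rewrite /induced_cycle cC k3 /=; apply/existsP; rewrite -cC.
have gk i j : i < j -> j < #|C| -> e (g i) (g j) =
   (j == i.+1) || ((i == 0) && (j == #|C|.-1)) by rewrite cC; exact: ge.
have gi i j : i < #|C| -> j < #|C| -> g i = g j -> i = j by rewrite cC; exact: ginj.
exists [ffun i : 'I_#|C| => g (val i)]; apply/and3P; split.
- apply/injectiveP=> i j; rewrite !ffunE => /gi E.
  by apply: val_inj; apply: E; rewrite ltn_ord.
- apply/eqP/setP=> x; apply/imsetP/idP=> [[i _ ->]|/CE[i lti ->]].
    by rewrite ffunE; apply/CE; exists (val i); rewrite -?cC ?ltn_ord.
  rewrite -cC in lti.
  by exists (Ordinal lti); rewrite ?inE ?ffunE.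
apply/forallP=> i; apply/forallP=> j; rewrite !ffunE /cycle_adj -!val_eqE /=.
have ltiC := ltn_ord i; have ltjC := ltn_ord j.
have key (a b : nat) : a < b -> b < #|C| ->
   (b == a.+1) || ((a == 0) && (b == #|C|.-1)) =
   (b == a.+1 %% #|C|) || (a == b.+1 %% #|C|).
  move=> ab bC; rewrite (modn_small (_ : a.+1 < _)); last by lia.
  have [->|ne] := eqVneq b #|C|.-1; last by rewrite modn_small; lia.
  have -> : (#|C|.-1.+1) = #|C| by lia.
  by rewrite modnn andbT.
apply/eqP; have [lt_ij|lt_ji|eq_ij] := ltngtP (val i) (val j).
- by rewrite gk // key //; lia.
- by rewrite e_sym gk // key 1?orbC //; lia.
have key2 (b : nat) : b < #|C| -> (b == b.+1 %% #|C|) = false.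
  move=> bC; have [->|ne] := eqVneq b #|C|.-1; last by rewrite modn_small; lia.
  have -> : (#|C|.-1.+1) = #|C| by lia.
  by rewrite modnn; lia.
by rewrite eq_ij e_irr !key2.
Qed.

Lemma cycle_enum_rot C k g a : cycle_enum C k g ->
  cycle_enum C k (fun i => g ((i + a) %% k)).
Proof.
case=> k3 CE ginj ge.
elim: a => [|a [_ CE' gi' ge']].
  split=> //.
  - move=> x; rewrite CE; split=> -[i lti ->]; exists i => //;
      by rewrite addn0 modn_small.
  - by move=> i j lti ltj; rewrite !addn0 !modn_small //; apply: ginj.
  - by move=> i j ltij ltj; rewrite !addn0 !modn_small //; [apply: ge|lia].
pose g' i := g ((i + a) %% k).
have gS i : g ((i + a.+1) %% k) = g' (if i == k.-1 then 0 else i.+1) \/ k <= i.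
  have [->|ne] := eqVneq i k.-1; last first.
    by have [ltik|?] := ltnP i k; [left|right]; rewrite // addnS -addSn.
  left; rewrite /g' add0n; congr g.
  have -> : k.-1 + a.+1 = k + a by lia.
  by rewrite modnDl.
have gE i : i < k -> g ((i + a.+1) %% k) = g' (if i == k.-1 then 0 else i.+1).
  by move=> lti; case: (gS i) => //; lia.
split=> //.
- move=> x; rewrite CE'; split=> -[i lti ->].
    have [i0|i0] := eqVneq i 0.
      by exists k.-1; [lia|rewrite gE ?eqxx ?i0 //; lia].
    exists i.-1; [lia|rewrite gE; [|lia]].
    have -> : (i.-1 == k.-1) = false by lia.
    by rewrite prednK // lt0n.
  by exists (if i == k.-1 then 0 else i.+1); rewrite ?gE //; case: eqP; lia.
- by move=> i j lti ltj; rewrite !gE // => /gi'; case: eqP; case: eqP; lia.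
move=> i j ltij ltj; rewrite !gE //; last lia.
have ne : (i == k.-1) = false by lia.
rewrite ne; case: (eqVneq j k.-1) => [ej|nj].
  by rewrite e_sym ge'; lia.
by rewrite ge'; lia.
Qed.

Lemma cycle_enum_rev C k g : cycle_enum C k g ->
  cycle_enum C k (fun i => g (if i == 0 then 0 else k - i)).
Proof.
case=> k3 CE ginj ge; split=> //.
- move=> x; rewrite CE; split=> -[i lti ->].
    exists (if i == 0 then 0 else k - i); first by case: eqP; lia.
    by congr g; case: (eqVneq i 0) => [->|ne] //; case: eqP; lia.
  by exists (if i == 0 then 0 else k - i) => //; case: eqP; lia.
- by move=> i j lti ltj /ginj; case: eqP; case: eqP; lia.
move=> i j ltij ltj; have -> : (j == 0) = false by lia.
case: (eqVneq i 0) => [i0|i0]; first by rewrite ge; lia.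
by rewrite e_sym ge; lia.
Qed.

Lemma cycle_enum_start C x y : induced_cycle e C -> x \in C -> y \in C -> e x y ->
  exists k g, [/\ cycle_enum C k g, g 0 = x & g 1 = y].
Proof.
move=> /induced_cycle_enum[k [g0 cg0]] xC yC exy.
have [k3 CE _ _] := cg0; have /CE[a lta xa] := xC.
pose g i := g0 ((i + a) %% k); have cg : cycle_enum C k g := cycle_enum_rot _ cg0.
have gx : g 0 = x by rewrite /g add0n modn_small.
have [_ CE' _ ge] := cg; have /CE'[b ltb yb] := yC.
case: (posnP b) => [b0|b0]; first by move: exy; rewrite yb b0 gx e_irr.
move: exy; rewrite -gx yb ge // => /orP[/eqP b1|/andP[_ /eqP bk]].
  by exists k, g; rewrite gx b1.
exists k, (fun i => g (if i == 0 then 0 else k - i)); split=> //=.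
- exact: cycle_enum_rev.
- by rewrite bk; congr g; lia.
Qed.

Lemma cycle_nbrs C x : induced_cycle e C -> x \in C ->
  exists y z, [/\ y != z, y \in C, z \in C & forall w, w \in C -> e x w = (w == y) || (w == z)].
Proof.
move=> /induced_cycle_enum[k [g0 cg0]] xC.
have [k3 CE _ _] := cg0; have /CE[a lta xa] := xC.
pose g i := g0 ((i + a) %% k).
have [_ CE' gi ge] : cycle_enum C k g := cycle_enum_rot _ cg0.
have gx : g 0 = x by rewrite /g add0n modn_small.
have gC i : i < k -> g i \in C.
  by move=> lti; apply/CE'; exists i.
exists (g 1), (g k.-1); split; [| |apply: gC; lia|]; try by apply: gC; lia.
  by apply/eqP=> /gi; lia.
move=> w /CE'[b ltb ->].
have gE i j : i < k -> j < k -> (g i == g j) = (i == j).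
  by move=> lti ltj; apply/eqP/eqP=> [/gi->|->].
rewrite !gE //; try lia.
case: (posnP b) => [->|b0]; first by rewrite gx e_irr; lia.
by rewrite -gx ge.
Qed.

Lemma cycle_connected C (S : {set T}) x : induced_cycle e C -> x \in C -> x \in S ->
  (forall y z, y \in C -> y \in S -> z \in C -> e y z -> z \in S) -> C \subset S.
Proof.
move=> /induced_cycle_enum[k [g0 cg0]] xC xS Scl.
have [k3 CE _ _] := cg0; have /CE[a lta xa] := xC.
pose g i := g0 ((i + a) %% k).
have [_ CE' gi ge] : cycle_enum C k g := cycle_enum_rot _ cg0.
have gx : g 0 = x by rewrite /g add0n modn_small.
have gC i : i < k -> g i \in C.
  by move=> lti; apply/CE'; exists i.
have gS i : i < k -> g i \in S.
  elim: i => [|i IH] lti; first by rewrite gx.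
  by apply: (Scl (g i)); rewrite ?gC ?IH ?ge ?eqxx //; lia.
by apply/subsetP=> y /CE'[b ltb ->]; apply: gS.
Qed.

(** Among the later vertices of an induced cycle only the next one is adjacent to [g j], so
    discarding all neighbours of [g j] loses nothing of the rest of the path. *)
Lemma mem_ipaths_cycle C k g m j n (U : {set T}) : cycle_enum C k g ->
  1 < j -> j + m.+1 = k -> m <= n ->
  (forall i, j < i -> i < k -> g i \in U) ->
  [seq g i | i <- iota j.+1 m] \in ipaths (g 0) n U (g j).
Proof.
case=> k3 _ _ ge; elim: m n j U => [|m IH] n j U j1 jk mn gU.
  by rewrite ipaths_end ?inE // e_sym ge; lia.
case: n mn => // n mn; rewrite [iota _ _]/= [map _ _]/=; apply: mem_ipathsS.
- by rewrite e_sym ge; lia.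
- by rewrite in_nbh ge; lia.
- by apply: gU; lia.
apply: IH; [lia|lia|lia|] => i lti ltk; rewrite !inE gU; [|lia|lia].
by rewrite ge; lia.
Qed.

End Paths.

(** * Counting cycles through prescribed vertices by induced paths *)

Lemma card_le_cover_sum (T I : finType) (A : eqType) (P : pred I) (L : I -> seq A)
    (f : I -> A -> T) (X : {set T}) :
  (forall x, x \in X -> exists i, P i /\ exists2 a, a \in L i & x = f i a) ->
  #|X| <= \sum_(i | P i) size (L i).
Proof.
move=> cov; pose s := flatten [seq [seq f i a | a <- L i] | i <- enum P].
have -> : \sum_(i | P i) size (L i) = size s.
  rewrite size_flatten /shape -map_comp sumnE big_map big_enum_cond /=.
  by apply: eq_big => i; rewrite ?andbT ?size_map.
rewrite cardE; apply: uniq_leq_size; first exact: enum_uniq.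
move=> x; rewrite mem_enum => /cov[i [Pi [a aL ->]]].
apply/flattenP; exists [seq f i a | a <- L i]; last exact: map_f.
by apply/mapP; exists i; rewrite ?mem_enum.
Qed.

Section Cycles.
Variables (T : finType) (e : rel T).
Hypotheses (e_sym : symmetric e) (e_irr : irreflexive e).
Implicit Types (U C W : {set T}) (s t w x y z : T) (p : seq T).
Local Notation nbh := (nbh e).
Local Notation ipaths := (ipaths e).

Lemma cycle_card_enum C k g : cycle_enum e C k g -> k <= #|T|.
Proof.
case=> _ _ gi _; rewrite -(card_ord k) -(card_imset (f := fun i : 'I_k => g i)) ?max_card //.
by move=> i j /gi E; apply: val_inj; apply: E; rewrite ltn_ord.
Qed.

(** With [q.1] and [q.2] the two cycle neighbours of [z], the rest of the cycle is an induced path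
    from [q.2] that avoids the neighbours of [z] and ends as soon as it sees [q.1]. *)
Lemma card_cycles_through z :
  #|[set C | induced_cycle e C & z \in C]| <=
  \sum_(q : T * T | e z q.1 && e z q.2)
     size (ipaths q.1 #|T| (~: (z |: nbh z)) q.2).
Proof.
apply: (card_le_cover_sum (f := fun (q : T * T) p => [set x in [:: q.1, z, q.2 & p]])).
move=> C; rewrite inE => /andP[Ccyc zC].
have [x [x' [_ xC _ exz]]] := cycle_nbrs e_sym e_irr Ccyc zC.
have ezx : e z x by rewrite exz ?eqxx.
have [k [g [cg gx gz]]] : exists k g, [/\ cycle_enum e C k g, g 0 = x & g 1 = z].
  by apply: cycle_enum_start => //; rewrite e_sym.
have [k3 CE gi ge] := cg.
exists (g 0, g 2); split=> /=; first by rewrite gx ezx -gz ge ?eqxx //; lia.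
exists [seq g i | i <- iota 3 (k - 3)].
  have kT := cycle_card_enum cg.
  apply: (mem_ipaths_cycle e_sym cg) => //; [lia|exact: leq_trans (leq_subr _ _) kT|].
  move=> i i2 lti; rewrite in_setC in_setU1 in_nbh -gz ge; [|lia|lia].
  have -> : (g i == g 1) = false by apply/eqP=> /gi; lia.
  lia.
apply/setP=> w; rewrite inE -gz.
have -> : [:: g 0, g 1, g 2 & [seq g i | i <- iota 3 (k - 3)]] = [seq g i | i <- iota 0 k].
  by have {2}-> : k = (k - 3).+3 by lia.
apply/idP/mapP=> [/CE[i lti ->]|[i + ->]]; last by rewrite mem_iota => /andP[_ lti]; apply/CE; exists i.
by exists i; rewrite // mem_iota.
Qed.

Lemma card_cycles_sum :
  num_induced_cycles e <= \sum_z #|[set C | induced_cycle e C & z \in C]|.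
Proof.
pose A z := [set C | induced_cycle e C & z \in C].
have sub : [set C | induced_cycle e C] \subset \bigcup_z A z.
  apply/subsetP=> C; rewrite inE => Ccyc.
  have /card_gt0P[z zC] : 0 < #|C| by case/andP: Ccyc; lia.
  by apply/bigcupP; exists z => //; rewrite inE Ccyc.
apply: leq_trans (subset_leq_card sub) _.
elim/big_ind2: _ => // [|m1 S1 m2 S2 le1 le2]; first by rewrite cards0.
by apply: leq_trans (leq_card_setU _ _) _; apply: leq_add.
Qed.

(** The required adjacencies make the four vertices consecutive on the cycle, which is then closed
    by an induced path from [b4] back to [b1] avoiding the neighbours of the two middle vertices. *)
Lemma card_cycles_path4 (B1 B2 B3 B4 : {set T}) N :
  (forall b2 b3 b1 b4, b1 \in B1 -> b2 \in B2 -> b3 \in B3 -> b4 \in B4 ->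
     [/\ e b1 b2, e b2 b3, e b3 b4, ~~ e b1 b3 & (b1 != b3) && (b2 != b4)] /\
     size (ipaths b1 #|T| (~: (nbh b2 :|: nbh b3)) b4) <= N) ->
  #|[set C | induced_cycle e C &
      [&& C :&: B1 != set0, C :&: B2 != set0, C :&: B3 != set0 & C :&: B4 != set0]]|
  <= #|B1| * #|B2| * #|B3| * #|B4| * N.
Proof.
move=> HB.
pose P (q : T * T * T * T) := [&& q.1.1.1 \in B1, q.1.1.2 \in B2, q.1.2 \in B3 & q.2 \in B4].
pose L (q : T * T * T * T) := ipaths q.1.1.1 #|T| (~: (nbh q.1.1.2 :|: nbh q.1.2)) q.2.
have cP : \sum_(q | P q) N = #|B1| * #|B2| * #|B3| * #|B4| * N.
  rewrite sum_nat_const; congr (_ * _).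
  rewrite -!cardsX; rewrite -[LHS]cardsE; congr #|pred_of_set _|.
  apply/setP=> -[[[a b] c] d]; rewrite !inE /=. by rewrite -?andbA.
rewrite -cP; apply: leq_trans (_ : _ <= \sum_(q | P q) size (L q)) _; last first.
  by apply: leq_sum => -[[[a b] c] d] /and4P[/= h1 h2 h3 h4]; have [] := HB _ _ _ _ h1 h2 h3 h4.
apply: (card_le_cover_sum (f := fun (q : T * T * T * T) p =>
  [set x in [:: q.1.1.1, q.1.1.2, q.1.2, q.2 & p]])).
move=> C; rewrite inE => /andP[Ccyc].
case/and4P=> /set0Pn[b1 /setIP[c1 h1]] /set0Pn[b2 /setIP[c2 h2]].
move=> /set0Pn[b3 /setIP[c3 h3]] /set0Pn[b4 /setIP[c4 h4]].
have [[e12 e23 e34 n13 n24] _] := HB _ _ _ _ h1 h2 h3 h4.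
have [k [g [cg g0 g1]]] := cycle_enum_start e_sym e_irr Ccyc c1 c2 e12.
have [k3 CE gi ge] := cg.
have nbr i j : i < k -> j < k -> 0 < i -> e (g i) (g j) -> i.+1 = j \/ j.+1 = i \/ (j = 0 /\ i = k.-1).
  move=> lti ltj i0; have [ij|ji|->] := ltngtP i j; last by rewrite e_irr.
    by rewrite ge // => /orP[/eqP->|/andP[/eqP ei _]]; [left|rewrite ei in i0].
  rewrite e_sym ge // => /orP[/eqP->|/andP[/eqP ej /eqP ei]]; first by right; left.
  by right; right.
(* The cycle neighbours of [g 1] are [g 0] and [g 2]; the non-edge between [b1] and [b3] rules out a
   triangle. *)
have g2 : g 2 = b3 /\ 3 < k.
  have /CE[i lti b3E] := c3; move: e23; rewrite -g1 b3E => e23'.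
  have K := nbr 1 i (ltnW k3) lti isT e23'.
  have i0 : i <> 0 by move=> i0; move: n24; rewrite b3E i0 g0 eqxx.
  have ei : i = k.-1 -> False.
    by move=> ik; move: n13; rewrite b3E ik -g0 ge ?eqxx ?orbT //; clear -k3; lia.
  have i2 : i = 2.
    by clear -K k3 lti i0 ei; case: K; lia.
  by split; [rewrite i2|clear -k3 i2 ei lti; lia].
case: g2 => g2 k4.
have g3 : b4 = g 3.
  have /CE[i lti b4E] := c4; move: e34; rewrite -g2 b4E => e34'.
  have K := nbr 2 i k3 lti isT e34'.
  have i1 : i <> 1 by move=> i1; move: n24; rewrite b4E i1 g1 eqxx andbF.
  have -> : i = 3 by clear -K k4 lti i1; case: K; lia.
  by [].
exists (b1, b2, b3, b4); split; first exact/and4P.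
exists [seq g i | i <- iota 4 (k - 4)]; rewrite /L /=.
  rewrite -{1}g0 g3; have kT := cycle_card_enum cg.
  apply: (mem_ipaths_cycle e_sym cg) => //; [clear -k4; lia|exact: leq_trans (leq_subr _ _) kT|].
  move=> i i3 lti; rewrite in_setC in_setU !in_nbh -g1 -g2 !ge; clear -i3 lti; lia.
apply/setP=> w; rewrite inE -g0 -g1 -g2 g3.
have -> : [:: g 0, g 1, g 2, g 3 & [seq g i | i <- iota 4 (k - 4)]] = [seq g i | i <- iota 0 k].
  by have {2}-> : k = (k - 4).+4 by clear -k4; lia.
apply/idP/mapP=> [/CE[i lti ->]|[i + ->]]; last by rewrite mem_iota => /andP[_ lti]; apply/CE; exists i.
by exists i; rewrite // mem_iota.
Qed.

Lemma cycles_within W :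
  #|[set C | induced_cycle e C & C \subset W]| <= max_induced_cycles #|W|.
Proof.
pose e' (u v : {x | x \in W}) := e (val u) (val v).
have e'_sym : symmetric e' by move=> u v; rewrite /e' e_sym.
have e'_irr : irreflexive e' by move=> u; rewrite /e' e_irr.
have := num_induced_cycles_le_max e'_sym e'_irr; rewrite card_sig; apply: leq_trans.
pose F C := [set u : {x | x \in W} | val u \in C].
have Finj : {in [set C | induced_cycle e C & C \subset W] &, injective F}.
  move=> C D; rewrite !inE => /andP[_ CW] /andP[_ DW] FE.
  apply/setP=> x; have [xW|xW] := boolP (x \in W).
    by have /setP/(_ (Sub x xW)) := FE; rewrite !inE SubK.
  by rewrite (contraNF (subsetP CW x) xW) (contraNF (subsetP DW x) xW).
rewrite -(card_in_imset Finj); apply: subset_leq_card.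
apply/subsetP=> _ /imsetP[C + ->]; rewrite !inE => /andP[Ccyc CW].
have [k [g [k3 CE gi ge]]] := induced_cycle_enum Ccyc.
have gW i : i < k -> g i \in W by move=> lti; apply: (subsetP CW); apply/CE; exists i.
have k0 : 0 < k by lia.
pose g' i : {x | x \in W} := insubd (Sub (g 0) (gW 0 k0)) (g i).
have g'E i : i < k -> val (g' i) = g i by move=> /gW gi'; rewrite val_insubd gi'.
apply: (enum_induced_cycle e'_sym e'_irr (k := k) (g := g')); split=> //.
- move=> u; rewrite inE; split=> [/CE[i lti uE]|[i lti ->]].
    by exists i => //; apply: val_inj; rewrite g'E.
  by rewrite g'E //; apply/CE; exists i.
- by move=> i j lti ltj /(congr1 val); rewrite !g'E // => /gi; apply.
- by move=> i j ltij ltj; rewrite /e' !g'E // ?ge //; apply: ltn_trans ltij _.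
Qed.

End Cycles.

(** * Stability: almost optimal path counts come from layered graphs *)

Section Strips.
Variables (T : finType) (e : rel T) (t : T).
Hypotheses (e_sym : symmetric e) (e_irr : irreflexive e).
Implicit Types (U W X Y A : {set T}) (s x y z : T) (ls : seq {set T}).
Local Notation nbh := (nbh e).
Local Notation ipaths := (ipaths e t).

(* The layers ls split U so that s sees exactly the first layer, consecutive
   layers are completely joined, other pairs of layers are not joined at all,
   and t sees exactly the last layer. *)
Fixpoint strip U s ls : bool :=
  if ls is A :: ls' then
    [&& ~~ e s t, A == nbh s :&: U, A != set0 & [forall x in A, strip (U :\: A) x ls']]
  else (U == set0) && e s t.

Lemma strip_mem U s ls i x : strip U s ls -> i < size ls ->
  x \in nth set0 ls i -> x \in U.
Proof.
elim: ls U s i => // A ls IH U s i /and4P[_ /eqP AE /set0Pn[a aA] /forall_inP st].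
case: i => [_|i] /=; first by rewrite AE => /setIP[].
by move=> lti /(IH _ _ _ (st a aA) lti) /setDP[].
Qed.

Lemma strip_cover U s ls x : strip U s ls -> x \in U ->
  exists2 i, i < size ls & x \in nth set0 ls i.
Proof.
elim: ls U s => [|A ls IH] U s; first by case/andP=> /eqP ->; rewrite inE.
case/and4P=> _ _ /set0Pn[a aA] /forall_inP st xU.
have [xA|xA] := boolP (x \in A); first by exists 0.
have [i lti xi] := IH _ _ (st a aA) ltac:(by rewrite inE xA).
by exists i.+1.
Qed.

Lemma strip_start U s ls i x : strip U s ls -> i < size ls ->
  x \in nth set0 ls i -> e s x = (i == 0).
Proof.
case: ls => // A ls /and4P[_ /eqP AE /set0Pn[a aA] /forall_inP st].
case: i => [_|i lti] /=; first by rewrite AE => /setIP[]; rewrite in_nbh.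
move=> /(strip_mem (st a aA) lti) /setDP[xU]; rewrite AE inE xU andbT in_nbh.
by move/negbTE.
Qed.

Lemma strip_end U s ls i x : strip U s ls -> i < size ls ->
  x \in nth set0 ls i -> e x t = (i.+1 == size ls).
Proof.
elim: ls U s i => // A ls IH U s i /and4P[_ _ /set0Pn[a aA] /forall_inP st].
case: i => [_|i lti] /=; last exact: IH (st a aA) lti.
by move=> /st; case: (ls) => [/andP[_ ->]|B l /and4P[/negbTE ->]].
Qed.

Lemma strip_adj U s ls i j x y : strip U s ls -> i < j -> j < size ls ->
  x \in nth set0 ls i -> y \in nth set0 ls j -> e x y = (j == i.+1).
Proof.
elim: ls U s i j => // A ls IH U s i [//|j] /and4P[_ _ /set0Pn[a aA] /forall_inP st].
case: i => [_|i] /= lti ltj; last first.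
  by move=> xi yi; rewrite eqSS; apply: (IH _ _ i j (st a aA) lti ltj).
by move=> yi; rewrite (strip_start (st _ ltj) lti yi).
Qed.

Lemma strip_disjoint U s ls i j x : strip U s ls -> i < j -> j < size ls ->
  x \in nth set0 ls i -> x \in nth set0 ls j -> False.
Proof.
elim: ls U s i j => // A ls IH U s i [//|j] /and4P[_ _ /set0Pn[a aA] /forall_inP st].
case: i => [_|i] /= lti ltj; last exact: (IH _ _ i j (st a aA) lti ltj).
by move=> /(strip_mem (st a aA) lti) /setDP[_ /negP].
Qed.

Lemma strip_card U s ls : strip U s ls -> #|U| = \sum_(X <- ls) #|X|.
Proof.
elim: ls U s => [|A ls IH] U s; first by case/andP=> /eqP -> _; rewrite cards0 big_nil.
case/and4P=> _ /eqP AE /set0Pn[a aA] /forall_inP st.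
rewrite big_cons -(IH _ _ (st a aA)) -(cardsID A U); congr (#|pred_of_set _| + _).
by rewrite {1}AE setIC AE -setIA setIid.
Qed.

Lemma setD_nbh U s : U :\: (nbh s :&: U) = U :\: nbh s.
Proof. by rewrite setDIr setDv setU0. Qed.

Lemma prod_cardI_le W W' ls : W' \subset W ->
  \prod_(X <- ls) #|X :&: W'| <= \prod_(X <- ls) #|X :&: W|.
Proof.
move=> sub; elim: ls => [|X ls IH]; rewrite ?big_nil // !big_cons leq_mul //.
by apply: subset_leq_card; apply: setIS.
Qed.

(** A step from layer [i] that does not go to layer [i.+1] is fatal: layer [i.+1] consists of
    neighbours of [y] and has just been discarded, so the path can no longer get past it, and the
    corresponding product has a factor 0. *)
Lemma strip_ipaths_le U s ls n W y i : strip U s ls -> W \subset U -> i < size ls ->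
  y \in nth set0 ls i ->
  size (ipaths n W y) <= \prod_(X <- drop i.+1 ls) #|X :&: W|.
Proof.
move=> st; elim: n W y i => [|n IH] W y i sub lti yi.
  rewrite /=; case: ifP => //; rewrite (strip_end st lti yi) => /eqP ->.
  by rewrite drop_size big_nil.
case eyt : (e y t).
  by rewrite ipaths_end //; move: eyt; rewrite (strip_end st lti yi) => /eqP ->;
     rewrite drop_size big_nil.
have lti1 : i.+1 < size ls.
  by move: eyt; rewrite (strip_end st lti yi); lia.
rewrite size_ipathsS // (drop_nth set0 lti1) big_cons.
have subW : W :\: nbh y \subset W by rewrite subsetDl.
have -> : #|nth set0 ls i.+1 :&: W| = \sum_(z in nbh y :&: W) (z \in nth set0 ls i.+1).
  rewrite -sum1_card big_mkcond [RHS]big_mkcond /=; apply: eq_bigr => z _.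
  rewrite !inE; case zW : (z \in W); rewrite ?andbF // !andbT.
  case zi: (z \in nth set0 ls i.+1); last by rewrite if_same.
  by rewrite (strip_adj st _ lti1 yi zi) ?eqxx.
rewrite big_distrl /=; apply: leq_sum => z /setIP[]; rewrite in_nbh => eyz zW.
have [j ltj zj] := strip_cover st (subsetP sub _ zW).
have [ji|ne] := eqVneq j i.+1; first (rewrite ji in ltj zj; rewrite zj mul1n).
  apply: leq_trans (IH _ _ _ _ ltj zj) (prod_cardI_le _ subW).
  exact: subset_trans subW sub.
have leji : j <= i.
  have [lt_ij|//] := ltnP i j.
  by move: eyz; rewrite (strip_adj st lt_ij ltj yi zj) (negbTE ne).
apply: leq_trans (IH _ _ _ (subset_trans subW sub) ltj zj) _.
rewrite (big_rem (nth set0 ls i.+1)) /=; last first.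
  have -> : nth set0 ls i.+1 = nth set0 (drop j.+1 ls) (i - j).
    by rewrite nth_drop; congr nth; lia.
  by apply: mem_nth; rewrite size_drop ltn_subRL addSn subnKC.
suff -> : nth set0 ls i.+1 :&: (W :\: nbh y) = set0 by rewrite cards0.
apply/setP=> v; rewrite !inE; apply/negP=> /and3P[vi /negP[]].
by rewrite (strip_adj st _ lti1 yi vi) ?eqxx.
Qed.

Lemma strip_ipaths_total U s ls n : strip U s ls ->
  size (ipaths n U s) <= \prod_(X <- ls) #|X|.
Proof.
case: ls => [/andP[_ est]|A ls]; first by rewrite ipaths_end // big_nil.
move=> st; have [/negbTE est /eqP AE _ /forall_inP st'] := and4P st.
case: n => [|n]; first by rewrite /= est.
rewrite size_ipathsS // -AE big_cons -sum_nat_const; apply: leq_sum => x xA.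
have sub : U :\: nbh s \subset U by rewrite subsetDl.
apply: leq_trans (strip_ipaths_le (i := 0) n st sub _ xA) _ => //=.
rewrite drop0; elim: (ls) => [|X l IH]; rewrite ?big_nil // !big_cons leq_mul //.
by apply: subset_leq_card; apply: subsetIl.
Qed.

Section FirstHit.
Variable X : {set T}.

Let Q ls := \prod_(Y <- ls) #|Y :\: X|.
Let R ls := \prod_(Y <- ls) #|Y|.
(* The induced paths through the layers that start at an outside vertex with
   neighbourhood X: the first step lands in some layer i, after which X is
   forbidden. *)
Let F ls := \sum_(i < size ls) #|X :&: nth set0 ls i| * Q (drop i.+1 ls).

Let F_cons A ls : F (A :: ls) = #|X :&: A| * Q ls + F ls.
Proof.
rewrite /F /= big_ord_recl /= drop0; congr (_ + _).
Qed.

(** Sort the transversals of the layers by the last layer in which they hit [X]: those with last hit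
    in layer [i] number at least the [i]-th term of [F], as the earlier layers are nonempty, and [Q]
    counts those without a hit. *)
Lemma prod_diff_le ls : all (fun Y => 0 < #|Y|) ls -> Q ls + F ls <= R ls.
Proof.
rewrite /Q /R; elim: ls => [|A ls IH]; first by rewrite /F big_ord0 !big_nil.
case/andP=> A0 /IH; rewrite F_cons !big_cons -/(Q ls) -/(R ls) => IH'.
have := cardsID X A; rewrite setIC; nia.
Qed.

Lemma prod_diff_hit ls : all (fun Y => 0 < #|Y| <= 4) ls ->
  has (fun Y => X :&: Y != set0) ls -> 4 * Q ls <= 3 * R ls.
Proof.
rewrite /Q /R; elim: ls => //= A ls IH /andP[/andP[A0 A4] all4].
rewrite !big_cons -/(Q ls) -/(R ls).
have cA := cardsID X A; have QR : Q ls <= R ls.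
  have := @prod_diff_le ls; rewrite (sub_all _ all4) => [/(_ isT)|Y /andP[]//]; lia.
case/orP=> [|/(IH all4)].
  by rewrite -card_gt0 setIC => XA; nia.
rewrite -/(Q ls) -/(R ls); nia.
Qed.

(** If [X] misses a vertex of [A], the factor is at most 3/4. If [X] hits a later layer, then [Q]
    loses a quarter and the factor is at most [3 / 4 + 1 / (4 * #|A|)]; with [#|A| >= 2] this gives
    7/8. *)
Lemma sum_first_hit_le A ls : all (fun Y => 1 < #|Y| <= 4) (A :: ls) ->
  (X :&: A != A) || has (fun Y => X :&: Y != set0) ls ->
  8 * F (A :: ls) <= 7 * R (A :: ls).
Proof.
move=> /= /andP[/andP[A2 A4] all4]; rewrite F_cons /R big_cons -/(R ls).
have all4' : all (fun Y => 0 < #|Y| <= 4) ls.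
  by apply: sub_all all4 => Y /andP[Y1 ->]; rewrite (ltnW Y1).
have nA : Q ls + F ls <= R ls.
  by apply: prod_diff_le; apply: sub_all all4' => Y /andP[].
case/orP=> [neq|/(prod_diff_hit all4')].
  have : X :&: A \proper A by rewrite properEneq neq subsetIr.
  by move/proper_card; nia.
have := subset_leq_card (subsetIr X A); nia.
Qed.
End FirstHit.

(** Fixing the layers seen from [s], any other start [x] either sees exactly the first layer, and
    then the same strip, or its neighbourhood spoils the transversals by a definite factor. *)
Lemma strip_compare U s ls x n : strip U s ls ->
  all (fun Y : {set T} => 1 < #|Y| <= 4) ls ->
  strip U x ls \/ 8 * size (ipaths n U x) <= 7 * \prod_(Y <- ls) #|Y|.
Proof.
move=> st all4.
have R0 l : all (fun Y : {set T} => 1 < #|Y| <= 4) l -> 0 < \prod_(Y <- l) #|Y|.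
  elim: l => [|Y l IH]; rewrite ?big_nil //= => /andP[/andP[Y1 _] /IH].
  by rewrite big_cons muln_gt0 (ltnW Y1).
case ext : (e x t).
  case: ls st all4 => [/andP[U0 _]|A ls st /= /andP[/andP[A1 _] /R0 l0]].
    by left; rewrite /= U0 ext.
  by right; rewrite ipaths_end // big_cons /=; nia.
case: n => [|n]; first by right; rewrite /= ext.
case: ls st all4 => [/andP[/eqP U0 _] _|A ls st all4].
  by right; rewrite size_ipathsS // U0 setI0 big_set0.
have [AE|neA] := eqVneq (nbh x :&: U) A.
  by left; case/and4P: st => /= _ _ A0 ->; rewrite A0 ext AE eqxx.
right; set X := nbh x :&: U in neA.
have XA : (X :&: A != A) || has (fun Y => X :&: Y != set0) ls.
  have [AX|//] := eqVneq (X :&: A) A.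
  have AsX : A \subset X by rewrite -AX subsetIl.
  have : exists y, y \in X :\: A.
    apply/set0Pn; rewrite setD_eq0; apply/negP=> XsA; case/eqP: neA.
    by apply/eqP; rewrite eqEsubset XsA.
  case=> y /setDP[yX yA].
  have yU : y \in U by case/setIP: yX.
  have [[|i] lti yi] := strip_cover st yU; first by rewrite yi in yA.
  apply/hasP; exists (nth set0 ls i); first exact: mem_nth.
  by apply/set0Pn; exists y; rewrite inE yX.
apply: leq_trans (sum_first_hit_le all4 XA); rewrite leq_mul2l /=.
rewrite size_ipathsS //.
set L := A :: ls in st *.
(* The paths from [x] are sorted by the layer of their first vertex; from there on, each layer is
   available only outside [X]. *)
apply: leq_trans (_ : _ <= \sum_(i < size L) \sum_(y in X :&: nth set0 L i)
   size (ipaths n (U :\: nbh x) y)) _; last first.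
  apply: leq_sum => i _; rewrite -sum_nat_const; apply: leq_sum => y /setIP[yX yi].
  have sub : U :\: nbh x \subset U by rewrite subsetDl.
  apply: leq_trans (strip_ipaths_le n st sub (ltn_ord i) yi) _.
  apply: eq_leq; apply: eq_big_seq => Y YL; congr #|pred_of_set _|.
  have /nthP-/(_ set0)[j ltj YE] := mem_drop YL.
  apply/setP=> v; rewrite /X !inE; case vY : (v \in Y); rewrite ?andbF //= andbT.
  have -> : v \in U by apply: (strip_mem st ltj); rewrite YE.
  by rewrite !andbT.
rewrite (exchange_big_dep (fun y => y \in X)) /=; last by move=> i y _ /setIP[].
apply: leq_sum => y yX; have yU : y \in U by case/setIP: yX.
have [i lti yi] := strip_cover st yU.
rewrite (bigD1 (Ordinal lti)); first exact: leq_addr.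
by rewrite in_setI yX.
Qed.

(** The optimum is [32 * mm3 #|U|] on the right, so the loss is 1/32: one of at most four branches
    loses 1/8. If some branch is above the threshold, it is a strip by induction, and the other
    branches are compared with its layers. A non-optimal degree loses even 1/9. *)
Theorem ipaths_strip n U s :
  96 * size (ipaths n U s) <= 31 * mm3 #|U| \/
  exists ls, [/\ strip U s ls, all (fun Y : {set T} => 1 < #|Y| <= 4) ls
               & 3 * \prod_(Y <- ls) #|Y| = mm3 #|U|].
Proof.
elim: n U s => [|n IH] U s; case est : (e s t).
- have [->|/set0Pn[x xU]] := eqVneq U set0.
    by right; exists [::]; rewrite /= eqxx est big_nil cards0.
  left; rewrite ipaths_end //=; have /mm3_mono : 1 <= #|U| by apply/card_gt0P; exists x.
  by change (mm3 1) with 4; lia.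
- by left; rewrite /= est.
- have [->|/set0Pn[x xU]] := eqVneq U set0.
    by right; exists [::]; rewrite /= eqxx est big_nil cards0.
  left; rewrite ipaths_end //=; have /mm3_mono : 1 <= #|U| by apply/card_gt0P; exists x.
  by change (mm3 1) with 4; lia.
rewrite size_ipathsS //; set A := nbh s :&: U; set U' := U :\: nbh s.
have cU : #|U| = #|U'| + #|A| by rewrite -(cardsID (nbh s) U) addnC setIC.
have le3 x : 3 * size (ipaths n U' x) <= mm3 #|U'|.
  case: (IH U' x) => [|[ls [st _ <-]]]; first lia.
  by rewrite leq_mul2l strip_ipaths_total.
have := mm3_branch #|A| #|U'|; rewrite -cU; case: (boolP (mm_opt _ _)) => [opt mmE|_ mmE]; last first.
  left; have : \sum_(w in A) 3 * size (ipaths n U' w) <= #|A| * mm3 #|U'|.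
    by rewrite -sum_nat_const; apply: leq_sum => x _; exact: le3.
  by rewrite -big_distrr /=; lia.
case: (boolP [exists w in A, 96 * size (ipaths n U' w) > 31 * mm3 #|U'|]) => [|none]; last first.
  left; rewrite -mmE mulnCA -[X in _ <= X]sum_nat_const big_distrr /=.
  apply: leq_sum => w wA; move: none; rewrite negb_exists_in => /forall_inP/(_ w wA).
  by rewrite -leqNgt.
case/exists_inP=> w wA big.
have [|[ls [st all4 prodE]]] := IH U' w; first lia.
have A24 : 1 < #|A| <= 4 by move: opt; rewrite /mm_opt; lia.
have A0 : A != set0 by rewrite -card_gt0; lia.
case: (boolP [forall x in A, strip U' x ls]) => [/forall_inP stA|].
  right; exists (A :: ls); split.
  - by rewrite /= est eqxx A0 /= setD_nbh; apply/forall_inP.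
  - by rewrite /= A24.
  - by rewrite big_cons -mmE -prodE; lia.
rewrite negb_forall_in => /exists_inP[x xA nst].
left; rewrite (bigD1 x) //=.
case: (strip_compare x n st all4) => [st'|bad]; first by rewrite st' in nst.
have rest : \sum_(i in A | i != x) 3 * size (ipaths n U' i) <= (#|A|.-1) * mm3 #|U'|.
  rewrite (cardsD1 x A) xA add1n /= -sum_nat_const [leqRHS](eq_bigl (fun i => (i \in A) && (i != x))).
    by apply: leq_sum => i _; exact: le3.
  by move=> i; rewrite !inE andbC.
move: rest; rewrite -big_distrr /= -/U' => rest.
nia.
Qed.

Corollary ipaths_le n U s : 3 * size (ipaths n U s) <= mm3 #|U|.
Proof.
case: (ipaths_strip n U s) => [|[ls [st _ <-]]]; first lia.
by rewrite leq_mul2l strip_ipaths_total.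
Qed.

End Strips.

Import Order.TTheory GRing.Theory Num.Theory.

(** * Typical paths *)

Section Defect.
Variables (T : finType) (e : rel T) (t : T).
Implicit Types (U A F : {set T}) (s w x y d : T) (p : seq T) (Fs : seq {set T}).
Local Notation nbh := (nbh e).
Local Notation ipaths := (ipaths e t).

(* Some node within k steps of (U, s) in the search tree of ipaths is a leaf or
   does not branch into exactly three. *)
Fixpoint lossy k U s : bool :=
  [|| e s t, #|nbh s :&: U| != 3
    | if k is k'.+1 then [exists x in nbh s :&: U, lossy k' (U :\: nbh s) x] else false].

Definition bad := lossy 2.

Fixpoint defect U s p : nat :=
  bad U s + (if p is w :: p' then defect (U :\: nbh s) w p' else #|U|).

Lemma card_nbhD U s : #|U| = #|U :\: nbh s| + #|nbh s :&: U|.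
Proof. by rewrite -(cardsID (nbh s) U) addnC setIC. Qed.

Local Open Scope ring_scope.

Definition kappa : rat := locked (1001 / 1000).

Lemma kappaE : kappa = 1001 / 1000. Proof. by rewrite /kappa -lock. Qed.

Lemma kappa_ge0 : 0 <= kappa. Proof. rewrite kappaE; lra. Qed.

Lemma kappaX_le_pot u : kappa ^+ u.+1 <= 98 / 100 * (pot u)%:R.
Proof.
have p0 : pot 0 = 25%N by [].
elim: u => [|u IH]; first by rewrite kappaE p0; lra.
have : (4 * pot u)%N%:R <= (3 * pot u.+1)%N%:R :> rat by rewrite ler_nat potS.
rewrite exprS (natrM _ 4) (natrM _ 3); set a := kappa ^+ u.+1 in IH *.
have a0 : 0 <= a by rewrite exprn_ge0 // kappa_ge0.
rewrite kappaE; lra.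
Qed.

(** A loss at a node also makes its ancestors up to two levels above bad, so it must pay for their
    factors [kappa] while being averaged over three children. The constants satisfy
    [0.97 * kappa < 0.98], [(2 + 0.98) / 3 * kappa < 0.995] and [(2 + 0.995) / 3 * kappa < 1]. *)
Definition loss_coef U s : rat :=
  if lossy 0 U s then 98 / 100 else if lossy 1 U s then 995 / 1000 else 1.

Lemma loss_coef_le1 U s : loss_coef U s <= 1.
Proof. by rewrite /loss_coef; case: ifP => _; [|case: ifP => _]; lra. Qed.

Lemma sum_defect n U s :
  \sum_(p <- ipaths n U s) kappa ^+ defect U s p <= loss_coef U s * (pot #|U|)%:R.
Proof.
have pot0 m : 0 <= (pot m)%:R :> rat by rewrite ler0n.
have coef0 V x : 0 <= loss_coef V x.
  by rewrite /loss_coef; case: ifP => _; [|case: ifP => _]; lra.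
elim: n U s => [|n IH] U s; case est : (e s t).
- rewrite ipaths_end // big_seq1 /= /bad /= est /= add1n /loss_coef /= est /=.
  exact: kappaX_le_pot.
- by rewrite /= est big_nil mulr_ge0.
- rewrite ipaths_end // big_seq1 /= /bad /= est /= add1n /loss_coef /= est /=.
  exact: kappaX_le_pot.
rewrite big_ipathsS // big_enum /=.
set A := nbh s :&: U; set U' := U :\: nbh s.
have le w : w \in A ->
    \sum_(p <- ipaths n U' w) kappa ^+ (bad U s + defect U' w p)%N <=
    kappa ^+ bad U s * (loss_coef U' w * (pot #|U'|)%:R).
  move=> _; under eq_bigr do rewrite exprD.
  by rewrite -mulr_sumr ler_wpM2l ?IH ?exprn_ge0 ?kappa_ge0.
apply: le_trans (ler_sum _ le) _; rewrite -mulr_sumr -mulr_suml.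
have cU : #|U| = (#|U'| + #|A|)%N := card_nbhD U s.
have le1 : \sum_(w in A) loss_coef U' w <= #|A|%:R.
  by rewrite -sumr_const; apply: ler_sum => w _; exact: loss_coef_le1.
have kb : kappa ^+ bad U s <= kappa by case: (bad U s); rewrite ?expr1 // expr0 kappaE; lra.
have kb0 : 0 <= kappa ^+ bad U s by rewrite exprn_ge0 // kappa_ge0.
have S0 : 0 <= \sum_(w in A) loss_coef U' w by apply: sumr_ge0 => w _.
have [A3|A3] := eqVneq #|A| 3; last first.
  have -> : loss_coef U s = 98 / 100 by rewrite /loss_coef /= est A3.
  have : (100 * (#|A| * pot #|U'|))%N%:R <= (97 * pot #|U|)%N%:R :> rat.
    by rewrite ler_nat cU; apply: pot_branch.
  rewrite (natrM _ 100) (natrM _ 97) (natrM _ #|A|) => br; apply: le_trans (_ : _ <= kappa * (#|A|%:R * (pot #|U'|)%:R)) _.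
    by apply: ler_pM; [exact: kb0|exact: mulr_ge0|exact: kb|exact: ler_wpM2r].
  rewrite kappaE; have := pot0 #|U|; lra.
have -> : pot #|U| = (3 * pot #|U'|)%N by rewrite cU A3 potD3.
rewrite (natrM _ 3) /loss_coef /= est A3 /=; have p0 := pot0 #|U'|.
have A3' : #|A|%:R = 3 :> rat by rewrite A3.
have worst (c : rat) x : x \in A -> loss_coef U' x <= c ->
    \sum_(w in A) loss_coef U' w <= 2 + c.
  move=> xA xc; rewrite (bigD1 x) //= addrC lerD //.
  apply: le_trans (_ : _ <= \sum_(i in A | i != x) 1) _.
    by apply: ler_sum => w _; exact: loss_coef_le1.
  have := sumr_const (mem A) (1 : rat); rewrite (bigD1 x) //= A3'; lra.
case: (boolP [exists x in A, _]) => [/exists_inP[x xA lx]|no1].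
  have lx0 : lossy 0 U' x by [].
  have lc : loss_coef U' x <= 98 / 100 by rewrite /loss_coef lx0; exact: lexx.
  have le' := worst _ x xA lc.
  apply: le_trans (_ : _ <= kappa * ((2 + 98 / 100) * (pot #|U'|)%:R)) _.
    by apply: ler_pM; [exact: kb0|exact: mulr_ge0|exact: kb|exact: ler_wpM2r].
  rewrite kappaE; lra.
case lb : (bad U s) kb kb0 => kb kb0; last first.
  rewrite expr0 !mul1r ler_wpM2r //; lra.
move: lb; rewrite /bad /= est A3 /= => /exists_inP[x xA lx].
have lx1 : lossy 1 U' x by [].
have nl : lossy 0 U' x = false.
  by apply: contraNF no1 => H; apply/exists_inP; exists x.
have lc : loss_coef U' x <= 995 / 1000 by rewrite /loss_coef nl lx1; exact: lexx.
have le' := worst _ x xA lc.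
apply: le_trans (_ : _ <= kappa * ((2 + 995 / 1000) * (pot #|U'|)%:R)) _.
  by apply: ler_pM; [exact: kb0|exact: mulr_ge0|exact: kb|exact: ler_wpM2r].
rewrite kappaE; lra.
Qed.

End Defect.

Section Targets.
Variables (T : finType) (e : rel T) (t : T) (D : nat).
Hypotheses (e_sym : symmetric e) (deg : forall x, #|nbh e x| <= D).
Implicit Types (U A F : {set T}) (s w x y d : T) (p : seq T) (Fs : seq {set T}).
Local Notation nbh := (nbh e).
Local Notation ipaths := (ipaths e t).
Local Notation bad := (bad e t).
Local Notation defect := (defect e t).

(* If two candidates w and x at a node continue differently and the path takes w,
   the unused continuation F of x is kept as a target, whose vertices are
   discarded one after the other unless the path steps into F. A good node never
   has all of F among its candidates, since each d in F would then have a
   neighbour too many. So a target is eventually hit or survives in the final U,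
   and the supermartingale tweight shows that few paths activate many targets. *)
Definition survivors A w Fs := [seq F :\: A | F <- Fs & (w \notin F) && ~~ (F \subset A)].

Definition new_target U s w Fs : option {set T} :=
  if [pick x in nbh s :&: U | nbh x :&: (U :\: nbh s) != nbh w :&: (U :\: nbh s)] is Some x
  then if all (fun F : {set T} => [disjoint F & nbh x :&: (U :\: nbh s)]) Fs
       then Some (nbh x :&: (U :\: nbh s)) else None
  else None.

Definition wild U s : bool :=
  [exists x in nbh s :&: U, exists y in nbh s :&: U,
     nbh x :&: (U :\: nbh s) != nbh y :&: (U :\: nbh s)].

Definition next_targets U s w Fs : seq {set T} :=
  let Fs' := survivors (nbh s :&: U) w Fs in
  if bad U s then Fs' else
  if new_target U s w Fs' is Some F then F :: Fs' else Fs'.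

Definition activates U s w Fs : bool :=
  ~~ bad U s && (new_target U s w (survivors (nbh s :&: U) w Fs) != None).

Fixpoint acts Fs U s p : nat :=
  if p is w :: p' then
    activates U s w Fs + acts (next_targets U s w Fs) (U :\: nbh s) w p'
  else 0.

Fixpoint wilds U s p : nat :=
  if p is w :: p' then (~~ bad U s && wild U s) + wilds (U :\: nbh s) w p' else 0.

Definition target_ok U s F : Prop :=
  [/\ F \subset U, 0 < #|F| <= 3,
      {in F, forall d, #|nbh d :&: (U :\: F)| <= 3}
    & F \subset nbh s -> {in F, forall d, #|nbh d :&: (s |: (U :\: F))| <= 3}].

Definition disjoint_targets Fs := pairwise (fun F G : {set T} => [disjoint F & G]) Fs.

Definition targets_ok U s Fs : Prop :=
  [/\ s \notin U, disjoint_targets Fs & {in Fs, forall F, target_ok U s F}].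

(** The depth 2 in [bad] serves the last clause, which bounds the degrees of the vertices of a
    target created at this node. *)
Lemma good_nodeP U s : bad U s = false ->
  [/\ e s t = false, #|nbh s :&: U| = 3,
      {in nbh s :&: U, forall x, #|nbh x :&: (U :\: nbh s)| = 3}
    & {in nbh s :&: U, forall x, {in nbh x :&: (U :\: nbh s), forall y,
         #|nbh y :&: (U :\: nbh s :\: nbh x)| = 3}}].
Proof.
move/negbT; rewrite /bad /= !negb_or negbK => /and3P[/negbTE est /eqP A3].
rewrite negb_exists_in => /forall_inP H; split=> // x /H.
  by rewrite !negb_or negbK => /and3P[_ /eqP].
rewrite !negb_or negb_exists_in => /and3P[_ _ /forall_inP H'] y /H'.
by rewrite orbF negb_or negbK => /andP[_ /eqP].
Qed.

Lemma survivors_sub A w Fs F' : F' \in survivors A w Fs ->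
  exists F, [/\ F \in Fs, w \notin F, ~~ (F \subset A) & F' = F :\: A].
Proof.
by case/mapP=> F; rewrite mem_filter => /andP[/andP[wF FA] FFs] ->; exists F.
Qed.

(** A surviving target does not contain [w], so [w] was already among the vertices of [U :\: F] to
    which the degree bound applied; this yields the clause of [target_ok] about the new current
    vertex. *)
Lemma survivors_ok U s w Fs : targets_ok U s Fs -> w \in nbh s :&: U ->
  targets_ok (U :\: nbh s) w (survivors (nbh s :&: U) w Fs).
Proof.
case=> sU dis ok /setIP[ws wU]; split.
  by rewrite inE ws.
  rewrite /disjoint_targets /survivors pairwise_map.
  apply: sub_pairwise (_ : pairwise _ (filter _ Fs)); last exact: pairwise_filter dis.
  move=> F G /= dFG; apply: disjointWl (subsetDl _ _) _.
  by apply: disjointWr (subsetDl _ _) _.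
move=> F' /survivors_sub[F [FFs wF FA ->]].
have [FU /andP[F0 F3] FN _] := ok F FFs.
have FE : F :\: (nbh s :&: U) = F :\: nbh s.
  apply/setP=> x; rewrite !inE negb_and; case xF : (x \in F); rewrite ?andbF //.
  by rewrite (subsetP FU x xF) orbF.
have sub : w |: (U :\: nbh s) :\: (F :\: nbh s) \subset U :\: F.
  apply/subsetP=> x; rewrite in_setU1 => /orP[/eqP ->|]; first by rewrite inE wF.
  rewrite !inE negb_and negbK => /and3P[H xs ->]; rewrite andbT.
  by move: H; rewrite (negbTE xs).
have le3 d : d \in F :\: nbh s -> #|nbh d :&: (w |: (U :\: nbh s) :\: (F :\: nbh s))| <= 3.
  move=> /setDP[dF _]; apply: leq_trans (FN d dF).
  by apply: subset_leq_card; apply: setIS.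
rewrite FE; split.
- exact: setSD.
- rewrite -{1}FE card_gt0 setD_eq0 FA /=; apply: leq_trans F3.
  by apply: subset_leq_card; exact: subsetDl.
- move=> d dF; apply: leq_trans (le3 d dF).
  by apply: subset_leq_card; apply: setIS; exact: subsetUr.
- by move=> _ d dF; exact: le3.
Qed.

Lemma new_targetP U s w Fs F : new_target U s w Fs = Some F ->
  exists x, [/\ x \in nbh s :&: U, F = nbh x :&: (U :\: nbh s),
                F != nbh w :&: (U :\: nbh s) & all (fun G : {set T} => [disjoint G & F]) Fs].
Proof.
rewrite /new_target; case: pickP => // x /andP[xA neq].
by case: ifP => // al [<-]; exists x.
Qed.

Lemma next_targets_ok U s w Fs : targets_ok U s Fs -> w \in nbh s :&: U ->
  targets_ok (U :\: nbh s) w (next_targets U s w Fs).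
Proof.
move=> ok wA; have ok' := survivors_ok ok wA; rewrite /next_targets.
case bUs : (bad U s) => //; case nt : (new_target _ _ _ _) => [F|] //.
have [x [xA FE Fne al]] := new_targetP nt.
have [_ _ g1 g2] := good_nodeP bUs; case: ok' => sU dis ok'; split=> //.
  rewrite /disjoint_targets /= -/(disjoint_targets _) dis andbT.
  by apply/allP=> G /(allP al); rewrite disjoint_sym.
move=> G; rewrite inE => /orP[/eqP ->|/ok' //]; rewrite {}FE in Fne *; split.
- exact: subsetIr.
- by rewrite g1.
- move=> d dF; rewrite setDIr setDv setU0.
  by rewrite (g2 x xA d dF).
(* A new target inside [nbh w] would have the same three vertices as the continuation of [w], from
   which it was chosen to differ. *)
move=> sub; case/eqP: Fne; apply/eqP; rewrite eqEcard !g1 // leqnn andbT.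
by rewrite subsetI sub subsetIr.
Qed.

(** Otherwise a vertex [d] of [F] would be a candidate with three neighbours left in [U :\: nbh s]
    and with [s] as a fourth one, against the last clause of [target_ok]. *)
Lemma good_not_subset U s F : bad U s = false -> s \notin U -> target_ok U s F ->
  ~~ (F \subset nbh s :&: U).
Proof.
move=> bUs sU [FU /andP[/card_gt0P[d dF] _] _ FN]; have [_ _ g1 _] := good_nodeP bUs.
apply/negP; rewrite subsetI => /andP[Fs _].
have dA : d \in nbh s :&: U by rewrite inE (subsetP Fs d dF) (subsetP FU d dF).
have := FN Fs d dF; apply/negP; rewrite -ltnNge.
rewrite -(g1 d dA); apply: proper_card; apply/properP; split.
  apply: setIS; apply/subsetP=> v /setDP[vU vs]; rewrite !inE vU andbT.
  by apply/orP; right; apply: contra vs; apply: (subsetP Fs).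
have es : e d s by rewrite e_sym -in_nbh (subsetP Fs).
exists s; first by rewrite inE in_nbh es setU11.
by rewrite !inE (negbTE sU) !andbF.
Qed.

Local Open Scope ring_scope.

Definition weight Fs : rat := \prod_(F <- Fs) (#|F|%:R / 4).

(** An activation multiplies [weight] by 3/4, which the factor 4/3 makes up for in the sum over all
    paths while leaving a trace in the weight of each path. The factor of a bad node compensates the
    up to [D] targets that may be touched there without any control. *)
Fixpoint tweight Fs U s p : rat :=
  if p is w :: p' then
    (if bad U s then (1 / 4) ^+ D else if activates U s w Fs then 4 / 3 else 1) *
      tweight (next_targets U s w Fs) (U :\: nbh s) w p'
  else weight Fs.

Lemma weight_cons F Fs : weight (F :: Fs) = #|F|%:R / 4 * weight Fs.
Proof. by rewrite /weight big_cons. Qed.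

Lemma weight_ge0 Fs : 0 <= weight Fs.
Proof. by apply: prodr_ge0 => F _; rewrite divr_ge0 // ler0n. Qed.

Lemma survivors_cons A w F Fs : survivors A w (F :: Fs) =
  if (w \notin F) && ~~ (F \subset A) then F :\: A :: survivors A w Fs
  else survivors A w Fs.
Proof. by rewrite /survivors /=; case: ifP. Qed.

Lemma sum_cardI_disjoint A Fs : disjoint_targets Fs -> (\sum_(F <- Fs) #|F :&: A| <= #|A|)%N.
Proof.
rewrite /disjoint_targets; elim: Fs A => [|F Fs IH] A; first by rewrite big_nil.
case/andP=> /allP dF dFs; rewrite big_cons -(cardsID F A) setIC leq_add2l.
apply: leq_trans (IH (A :\: F) dFs); apply: eq_leq; apply: eq_big_seq => G GFs.
congr #|pred_of_set _|; apply/setP=> x; rewrite !inE.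
by case xG: (x \in G) => //=; rewrite (disjointFl (dF G GFs) xG).
Qed.

(** Untouched targets keep their weight. A touched one gains a factor of at most 4, its weight being
    at least 1/4, and by disjointness at most [#|A|] targets are touched. *)
Lemma weight_survivors_bad A w Fs : w \in A -> disjoint_targets Fs ->
  {in Fs, forall F : {set T}, 0 < #|F| <= 3}%N -> (#|A| <= D)%N ->
  weight (survivors A w Fs) <= 4 ^+ D * weight Fs.
Proof.
move=> wA dis sz AD.
suff : weight (survivors A w Fs) <= 4 ^+ (\sum_(F <- Fs) #|F :&: A|)%N * weight Fs.
  move/le_trans; apply; apply: ler_wpM2r; first exact: weight_ge0.
  by rewrite ler_eXn2l // (leq_trans (sum_cardI_disjoint A dis)).
move: dis => _; elim: Fs sz => [|F Fs IH] sz; first by rewrite /survivors /= big_nil mul1r.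
have {}IH := IH (fun G GFs => sz G (mem_behead (s := F :: Fs) GFs)).
have /andP[F0 F3] := sz F (mem_head _ _).
rewrite survivors_cons big_cons weight_cons exprD.
set a : rat := 4 ^+ _ in IH *; have a0 : 0 <= a by rewrite exprn_ge0.
set b : rat := 4 ^+ _; have W0 := weight_ge0 Fs; have W0' := weight_ge0 (survivors A w Fs).
have F1 : 1 <= #|F|%:R :> rat by rewrite (ler_nat _ 1).
have F4 : #|F|%:R <= 3 :> rat by rewrite (ler_nat _ _ 3).
have aW : 0 <= a * weight Fs by rewrite mulr_ge0.
have [FA0|FA] := eqVneq (F :&: A) set0.
  have -> : b = 1 by rewrite /b FA0 cards0.
  have -> : (w \notin F) && ~~ (F \subset A).
    apply/andP; split.
      by apply/negP=> wF; have : w \in F :&: A; [rewrite inE wF|rewrite FA0 inE].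
    by apply/negP=> /setIidPl FA; move: F0; rewrite -FA FA0 cards0.
  have FE : F :\: A = F.
    by apply/setP=> x; move/setP/(_ x): FA0; rewrite !inE; case: (x \in F); rewrite ?andbF //= => ->.
  rewrite weight_cons FE; nra.
have b4 : 4 <= b.
  by rewrite -[leLHS]expr1 ler_eXn2l // card_gt0.
have bW : 4 * (a * weight Fs) <= b * (a * weight Fs) by apply: ler_wpM2r.
have key : a * weight Fs <= b * a * (#|F|%:R / 4 * weight Fs).
  have -> : b * a * (#|F|%:R / 4 * weight Fs) = #|F|%:R / 4 * (b * (a * weight Fs)) by ring.
  nra.
apply: le_trans key; apply: le_trans _ IH; case: ifP => // _.
have : #|F :\: A|%:R <= 3 :> rat.
  by rewrite (ler_nat _ _ 3); apply: leq_trans F3; apply: subset_leq_card; exact: subsetDl.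
rewrite weight_cons; have : 0 <= #|F :\: A|%:R :> rat by rewrite ler0n.
nra.
Qed.

Lemma quarter_ge0 : 0 <= 1 / 4 :> rat. Proof. lra. Qed.

Lemma quarter_le1 : 1 / 4 <= 1 :> rat. Proof. lra. Qed.

(** The induction step on the list of targets: [N] and [M] are the sizes of the first target and of
    its part among the three candidates, [W] is the old weight of the other targets, [S] the sum of
    their new weights over the candidates, and [L] their new weight if none of them is hit. *)
Lemma hit_inequality (W L S N M : rat) : 0 <= M -> M + 1 <= N -> N <= 3 ->
  S <= 3 * W -> 3 * L <= S -> 0 <= L -> 0 <= W -> 0 <= S ->
  (N - M) / 4 * S + M * ((1 - (N - M) / 4) * L) <= 3 * (N / 4 * W).
Proof.
move=> M0 MN N3 SW LS L0 W0 S0.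
have h1 : 0 <= M * (4 - N + M) * (S - 3 * L).
  by apply: mulr_ge0; [apply: mulr_ge0|]; lra.
have h2 : 0 <= M * (N - 1 - M) * S by apply: mulr_ge0; [apply: mulr_ge0|]; lra.
have h3 : 0 <= N * (3 * W - S) by apply: mulr_ge0; lra.
lra.
Qed.

(* Hits of different targets are negatively correlated, so the target weight is
   a supermartingale as soon as it is one for each target: with s = #|F| and
   m = #|F :&: A| <= s - 1 this is m * 4 + (3 - m) * (s - m) <= 3 * s. *)
Lemma weight_survivors_good A Fs : #|A| = 3 -> disjoint_targets Fs ->
  {in Fs, forall F : {set T}, 0 < #|F| <= 3}%N -> {in Fs, forall F, ~~ (F \subset A)} ->
  \sum_(w in A) weight (survivors A w Fs) <= 3 * weight Fs.
Proof.
move=> A3 dis sz nsub; pose lo Fs : rat := \prod_(F <- Fs) (#|F :\: A|%:R / 4).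
suff : [/\ \sum_(w in A) weight (survivors A w Fs) <= 3 * weight Fs,
           forall w, lo Fs <= weight (survivors A w Fs) & 0 <= lo Fs] by case.
have lo_eq w Gs : {in Gs, forall F, ~~ (F \subset A)} ->
    {in Gs, forall F : {set T}, w \notin F} -> weight (survivors A w Gs) = lo Gs.
  rewrite /lo; elim: Gs => [|G Gs IH] ns wn; first by rewrite /survivors /weight !big_nil.
  rewrite survivors_cons wn ?mem_head // ns ?mem_head //= weight_cons big_cons IH //.
    by move=> H HGs; apply: ns; rewrite inE HGs orbT.
  by move=> H HGs; apply: wn; rewrite inE HGs orbT.
elim: Fs dis sz nsub => [|F Fs IH] dis sz nsub.
  rewrite /survivors /lo /= /weight !big_nil; split=> //.
  by rewrite sumr_const A3 mulr1.
case/andP: dis => /allP dF dFs.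
have nsub' : {in Fs, forall F, ~~ (F \subset A)} by move=> G GFs; apply: nsub; rewrite inE GFs orbT.
have [||IH1 IH2 IH3] := IH dFs; [|exact: nsub'|].
  by move=> G GFs; apply: sz; rewrite inE GFs orbT.
have /andP[F0 F3] := sz F (mem_head _ _).
have FA : ~~ (F \subset A) by apply: nsub; rewrite mem_head.
set a : rat := #|F :\: A|%:R / 4.
have a01 : 0 <= a <= 1.
  rewrite /a divr_ge0 ?ler0n //= ler_pdivrMr // mul1r (ler_nat _ _ 4).
  by apply: leq_trans (subset_leq_card (subsetDl _ _)) _; apply: leq_trans F3 _.
have loE : lo (F :: Fs) = a * lo Fs by rewrite /lo big_cons.
have wE w : weight (survivors A w (F :: Fs)) =
    (if w \in F then 1 else a) * weight (survivors A w Fs).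
  by rewrite survivors_cons FA andbT; case: (w \in F); rewrite /= ?mul1r ?weight_cons.
split; last by rewrite loE mulr_ge0; case/andP: a01.
  under eq_bigr do rewrite wE.
  have eqF w : w \in A -> (if w \in F then 1 else a) * weight (survivors A w Fs) =
     a * weight (survivors A w Fs) + (w \in F)%:R * ((1 - a) * lo Fs).
    move=> wA; case: ifP => wF; last by rewrite mul0r addr0.
    rewrite lo_eq //; first by rewrite /=; ring.
    by move=> G GFs; rewrite (disjointFr (dF G GFs) wF).
  rewrite (eq_bigr _ eqF) big_split /= -mulr_sumr -mulr_suml.
  set S := \sum_(w in A) weight _ in IH1 *.
  have -> : \sum_(w in A) (w \in F)%:R = #|A :&: F|%:R :> rat.
    rewrite -sum1_card natr_sum big_mkcond [RHS]big_mkcond /=; apply: eq_bigr => w _.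
    by rewrite inE; case: (w \in A); case: (w \in F).
  have S3 : 3 * lo Fs <= S.
    have := sumr_const (mem A) (lo Fs); rewrite A3 mulr_natl => <-.
    by apply: ler_sum => w _; exact: IH2.
  rewrite weight_cons; have := cardsID A F; rewrite setIC => cF.
  have ltm : (#|A :&: F| < #|F|)%N.
    by rewrite -cF -addn1 leq_add2l card_gt0 setD_eq0.
  have aE : a = (#|F|%:R - #|A :&: F|%:R) / 4 by rewrite /a -cF natrD addrAC subrr add0r.
  have [L0 [W0 S0]] : 0 <= lo Fs /\ 0 <= weight Fs /\ 0 <= S.
    split=> //; split; first exact: weight_ge0.
    by apply: sumr_ge0 => w _; exact: weight_ge0.
  rewrite aE; apply: hit_inequality => //; try exact: ler0n.
    by rewrite natr1 ler_nat.
  by rewrite (ler_nat _ _ 3).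
move=> w; rewrite loE wE; have [a0 a1] := andP a01; have := IH2 w; have := weight_ge0 (survivors A w Fs).
by case: ifP => _; nra.
Qed.

Lemma targets_sz U s Fs : targets_ok U s Fs -> {in Fs, forall F : {set T}, 0 < #|F| <= 3}%N.
Proof. by case=> _ _ ok F /ok[]. Qed.

Lemma sum_tweight n U s Fs : targets_ok U s Fs ->
  \sum_(p <- ipaths n U s) tweight Fs U s p <= (pot #|U|)%:R * weight Fs.
Proof.
have pot1 m : 1 <= (pot m)%:R :> rat by rewrite (ler_nat _ 1) pot_gt0.
have pot0 m : 0 <= (pot m)%:R :> rat by rewrite ler0n.
have end_case V (Gs : seq {set T}) : weight Gs <= (pot #|V|)%:R * weight Gs.
  by rewrite -[leLHS]mul1r ler_wpM2r ?weight_ge0.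
elim: n U s Fs => [|n IH] U s Fs ok; case est : (e s t).
- by rewrite ipaths_end // big_seq1 /=; exact: end_case.
- by rewrite /= est big_nil mulr_ge0 ?weight_ge0.
- by rewrite ipaths_end // big_seq1 /=; exact: end_case.
rewrite big_ipathsS // big_enum /=.
set A := nbh s :&: U; set U' := U :\: nbh s.
have cU : #|U| = (#|U'| + #|A|)%N := card_nbhD e U s.
have [_ dis _] := ok; have sz := targets_sz ok.
have AD : (#|A| <= D)%N by apply: leq_trans (deg s); exact: subset_leq_card (subsetIl _ _).
pose c w : rat := if bad U s then (1 / 4) ^+ D else if activates U s w Fs then 4 / 3 else 1.
have c0 w : 0 <= c w.
  by rewrite /c; case: ifP => _; [apply: exprn_ge0; exact: quarter_ge0|case: ifP => _; lra].
apply: le_trans (_ : _ <= \sum_(w in A) c w * ((pot #|U'|)%:R * weight (next_targets U s w Fs))) _.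
  apply: ler_sum => w wA; rewrite -mulr_sumr (ler_wpM2l (c0 w)) //.
  by apply: IH; exact: next_targets_ok.
case bUs : (bad U s).
  apply: le_trans (_ : _ <= \sum_(w in A) (pot #|U'|)%:R * weight Fs) _.
    apply: ler_sum => w wA; rewrite mulrCA ler_wpM2l // /c /next_targets bUs.
    have q0 : 0 <= (1 / 4 : rat) ^+ D by apply: exprn_ge0; exact: quarter_ge0.
    apply: le_trans (ler_wpM2l q0 (weight_survivors_bad wA dis sz AD)) _.
    by rewrite mulrA -exprMn div1r mulVf // expr1n mul1r.
  rewrite sumr_const -[leLHS]mulr_natl mulrA -natrM ler_wpM2r ?weight_ge0 // ler_nat cU.
  exact: pot_branch_le.
have [est' A3 g1 g2] := good_nodeP bUs; rewrite -/A in A3.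
have -> : pot #|U| = (3 * pot #|U'|)%N by rewrite cU A3 potD3.
apply: le_trans (_ : _ <= \sum_(w in A) (pot #|U'|)%:R * weight (survivors A w Fs)) _.
  apply: ler_sum => w wA; rewrite mulrCA ler_wpM2l // /c /next_targets bUs /activates bUs /=.
  rewrite -/A; case nt : (new_target _ _ _ _) => [F|] /=; last by rewrite mul1r.
  have [x [xA FE _ _]] := new_targetP nt.
  rewrite weight_cons FE g1 //.
  have := weight_ge0 (survivors A w Fs); lra.
rewrite -mulr_sumr (natrM _ 3) mulrAC [leRHS]mulrC ler_wpM2l //.
apply: weight_survivors_good => // F FFs; apply: good_not_subset => //; by case: ok => // ? _; apply.
Qed.

Lemma weight_lower U s Fs : targets_ok U s Fs -> (1 / 4) ^+ #|U| <= weight Fs.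
Proof.
case=> _ dis ok.
suff : (1 / 4) ^+ (\sum_(F <- Fs) #|F :&: U|)%N <= weight Fs.
  apply: le_trans; apply: ler_wiXn2l; [exact: quarter_ge0|exact: quarter_le1|].
  exact: sum_cardI_disjoint.
have {dis ok} : {in Fs, forall F : {set T}, F :&: U = F /\ 0 < #|F|}%N.
  by move=> F /ok[/setIidPl FU /andP[F0 _]].
elim: Fs => [|F Fs IH] H; first by rewrite /weight !big_nil.
rewrite big_cons weight_cons exprD; have [FU F0] := H F (mem_head _ _).
apply: ler_pM; try (apply: exprn_ge0; exact: quarter_ge0); last by apply: IH => G GFs; apply: H; rewrite inE GFs orbT.
rewrite FU -(prednK F0) exprS; have : (1 / 4 : rat) ^+ #|F|.-1 <= 1.
  by apply: exprn_ile1; [exact: quarter_ge0|exact: quarter_le1].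
have : 1 <= #|F|.-1.+1%:R :> rat by rewrite (ler_nat _ 1).
lra.
Qed.

Hypothesis D_gt0 : (0 < D)%N.

Lemma tweight_lower n U s Fs p : targets_ok U s Fs -> p \in ipaths n U s ->
  (4 / 3) ^+ acts Fs U s p * (1 / 4) ^+ (D * defect U s p) <= tweight Fs U s p.
Proof.
elim: p n U s Fs => [|w p IH] n U s Fs ok pin.
  rewrite /= expr0 mul1r; apply: le_trans (weight_lower ok).
  apply: ler_wiXn2l; [exact: quarter_ge0|exact: quarter_le1|].
  by rewrite mulnDr; exact: leq_trans (leq_pmull _ D_gt0) (leq_addl _ _).
have [m [_ _ wA pin']] := ipaths_consP pin.
have {}IH := IH _ _ _ _ (next_targets_ok ok wA) pin'.
rewrite [acts _ _ _ _]/= [defect _ _ _]/= [tweight _ _ _ _]/= mulnDr !exprD mulrACA.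
have q n' := exprn_ge0 n' quarter_ge0; have q' n' : 0 <= (4 / 3 : rat) ^+ n' by apply: exprn_ge0; lra.
apply: ler_pM IH; [exact: mulr_ge0|exact: mulr_ge0|].
rewrite /activates; case: (bad U s) => /=; first by rewrite expr0 muln1 !mul1r.
by rewrite muln0 (expr0 (1 / 4)) mulr1; case: (_ != None); rewrite ?expr1 ?expr0 lexx.
Qed.

Local Close Scope ring_scope.

(* At a wild node that activates no target, the alternative continuation meets an
   active target, so a candidate adjacent to that target is discarded: such nodes
   are paid for by the vertices of reach, at most 3 * D per activation. *)
Definition reach Fs : {set T} := \bigcup_(F <- Fs) \bigcup_(d in F) nbh d.

Lemma reachP Fs x : reflect (exists F d, [/\ F \in Fs, d \in F & e d x]) (x \in reach Fs).
Proof.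
rewrite /reach; elim: Fs => [|F Fs IH].
  by rewrite big_nil inE; constructor=> -[F [d []]].
rewrite big_cons inE; apply: (iffP orP) => [[/bigcupP[d dF]|/IH[G [d [GFs dG edx]]]]|].
- by rewrite in_nbh => edx; exists F, d; rewrite mem_head.
- by exists G, d; rewrite inE GFs orbT.
case=> G [d []]; rewrite inE => /orP[/eqP ->|GFs] dG edx.
  by left; apply/bigcupP; exists d; rewrite ?in_nbh.
by right; apply/IH; exists G, d.
Qed.

Lemma reach_survivors A w Fs : reach (survivors A w Fs) \subset reach Fs.
Proof.
apply/subsetP=> x /reachP[F' [d [/survivors_sub[F [FFs _ _ ->]] /setDP[dF _] edx]]].
by apply/reachP; exists F, d.
Qed.

Lemma wilds_acts n U s Fs p : targets_ok U s Fs -> p \in ipaths n U s ->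
  wilds U s p <= (1 + 3 * D) * acts Fs U s p + #|U :&: reach Fs|.
Proof.
elim: p n U s Fs => [|w p IH] n U s Fs ok pin //.
have [m [_ _ wA pin']] := ipaths_consP pin.
have {}IH := IH _ _ _ _ (next_targets_ok ok wA) pin'.
rewrite [acts _ _ _ _]/= [wilds _ _ _]/=.
set A := nbh s :&: U in wA *; set U' := U :\: nbh s in IH *.
have mono : #|U' :&: reach (survivors A w Fs)| <= #|U :&: reach Fs|.
  by apply: subset_leq_card; apply: setISS; [exact: subsetDl|exact: reach_survivors].
move: IH; rewrite /activates /next_targets -/A; case bUs: (bad U s) => /= IH.
  by apply: leq_trans IH _; rewrite add0n leq_add2l.
case nt : (new_target _ _ _ _) IH => [F|] /= IH.
  have [x [xA FE _ _]] := new_targetP nt.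
  have [_ _ g1 _] := good_nodeP bUs.
  have R3 : #|U' :&: reach (F :: survivors A w Fs)| <= #|U :&: reach Fs| + 3 * D.
    apply: leq_trans (_ : _ <= #|U' :&: reach (survivors A w Fs)| + #|\bigcup_(d in F) nbh d|) _.
      rewrite /reach big_cons setIUr addnC; apply: leq_trans (leq_card_setU _ _) _.
      by rewrite leq_add2r; apply: subset_leq_card; exact: subsetIr.
    apply: leq_add => //; have <- : #|F| = 3 by rewrite FE g1.
    rewrite -sum_nat_const; elim/big_rec2: _ => [|d m1 S _ le1]; first by rewrite cards0.
    by apply: leq_trans (leq_card_setU _ _) _; exact: leq_add.
  have : wild U s <= 1 by case: (wild U s).
  lia.
rewrite add0n; case ws: (wild U s); last by lia.
suff : #|U' :&: reach (survivors A w Fs)| < #|U :&: reach Fs| by lia.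
move: ws nt; rewrite /wild /new_target -/A -/U' => /exists_inP[x xA /exists_inP[y yA nxy]].
case: pickP => [z /andP[zA nz]|none].
  case: ifP => // /allPn[F FS ndis] _.
  move: ndis; rewrite disjoint_sym => /pred0Pn[d /=]; rewrite !inE => /andP[/andP[ezd /andP[ds dU]] dF].
  apply: proper_card; apply/properP; split.
    by apply: setISS; [exact: subsetDl|exact: reach_survivors].
  have [zs zU] := setIP zA.
  exists z; last by rewrite in_setI in_setD zs.
  rewrite inE zU; apply: (subsetP (reach_survivors A w Fs)).
  by apply/reachP; exists F, d; rewrite e_sym.
move: (none x) (none y); rewrite /= xA yA /= => /negbFE/eqP Ex /negbFE/eqP Ey.
by rewrite Ex Ey eqxx in nxy.
Qed.

End Targets.

(** Pigeonhole: of [M.+1] disjoint blocks of length [L], one carries no mark. *)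
Lemma clear_run (m : nat -> bool) (k L M : nat) :
  \sum_(i < k) m i <= M -> M.+1 * L <= k ->
  exists2 a, a + L <= k & forall i, i < L -> ~~ m (a + i).
Proof.
elim: M m k => [|M IH] m k sumM leL.
  have [?|] := boolP [exists i : 'I_k, m i]; last first.
    rewrite negb_exists => /forallP none; exists 0; first by lia.
    by move=> i ltiL; have ltik : i < k by [lia]; exact: (none (Ordinal ltik)).
  by have /existsP[i mi] : [exists i : 'I_k, m i] by []; move: sumM; rewrite (bigD1 i) //= mi.
have [/existsP[i mi]|] := boolP [exists i : 'I_L, m i]; last first.
  rewrite negb_exists => /forallP none; exists 0; first by lia.
  by move=> i ltiL; exact: (none (Ordinal ltiL)).
have leLk : L <= k by lia.
have [||a leak clr] := IH (fun j => m (L + j)) (k - L); [|lia|].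
  have E : \sum_(j < k) m j = \sum_(j < L) m j + \sum_(j < k - L) m (L + j).
    rewrite -(big_mkord xpredT (fun j => m j : nat)) (@big_cat_nat _ _ _ L) //=.
    have -> : \sum_(L <= j < k) m j = \sum_(j < k - L) m (j + L).
      by rewrite -{1}[L]add0n big_addn big_mkord.
    by rewrite big_mkord; congr (_ + _); apply: eq_bigr => j _; rewrite addnC.
  move: sumM; rewrite E (bigD1 i) //= mi; lia.
exists (L + a); first by lia.
by move=> j ltj; rewrite -addnA; exact: clr.
Qed.

(** * Segments *)

Section Segment.
Variables (T : finType) (e : rel T).
Implicit Types (U A Z : {set T}) (s x y : T) (p : seq T) (B : nat -> {set T}).
Local Notation nbh := (nbh e).

(* Consecutive completely joined triples; the vertices of the inner triples
   have no neighbours outside their own and the two adjacent triples. *)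
Definition segment L B : Prop :=
  [/\ forall j, j < L -> #|B j| = 3,
      forall i j, i < j -> j < L -> [disjoint B i & B j],
      forall j x y, j.+1 < L -> x \in B j -> y \in B j.+1 -> e x y
    & forall j x, 0 < j -> j.+1 < L -> x \in B j ->
        nbh x \subset B j.-1 :|: B j :|: B j.+1].
End Segment.

Section Run.
Variables (T : finType) (e : rel T) (t : T) (D : nat).
Hypotheses (e_sym : symmetric e) (deg : forall x, #|nbh e x| <= D).
Implicit Types (U A Z : {set T}) (s x y : T) (p : seq T).
Local Notation nbh := (nbh e).
Local Notation ipaths := (ipaths e t).
Local Notation bad := (bad e t).
Local Notation wild := (wild e).

Fixpoint state U s p (i : nat) {struct i} : {set T} * T :=
  if i is j.+1 then if p is w :: p' then state (U :\: nbh s) w p' j else (U, s)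
  else (U, s).

Lemma state_step n U s p i : p \in ipaths n U s -> i < size p ->
  let: (V, v) := state U s p i in let: (V', v') := state U s p i.+1 in
  V' = V :\: nbh v /\ v' \in nbh v :&: V.
Proof.
elim: p n U s i => // w p IH n U s i pin lti.
have [m [_ _ wA pin']] := ipaths_consP pin.
by case: i lti => [_|i lti] /=; [case: (p)|exact: IH pin' _].
Qed.

Lemma state_last n U s p : p \in ipaths n U s -> e (state U s p (size p)).2 t.
Proof.
elim: p n U s => [|w p IH] n U s pin /=; first exact: ipaths_nilP pin.
by have [m [_ _ wA pin']] := ipaths_consP pin; exact: IH pin'.
Qed.

Lemma state_defect U s p :
  \sum_(i < (size p).+1) bad (state U s p i).1 (state U s p i).2
    + #|(state U s p (size p)).1| = defect e t U s p.
Proof.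
elim: p U s => [|w p IH] U s /=; first by rewrite big_ord_recl big_ord0 addn0.
by rewrite big_ord_recl /= -IH addnA.
Qed.

Lemma state_wilds U s p :
  \sum_(i < size p) (~~ bad (state U s p i).1 (state U s p i).2
     && wild (state U s p i).1 (state U s p i).2) = wilds e t U s p.
Proof.
elim: p U s => [|w p IH] U s /=; first by rewrite big_ord0.
by rewrite big_ord_recl /= -IH.
Qed.

Lemma state_card U s p :
  #|U| <= D * size p + #|(state U s p (size p)).1|.
Proof.
elim: p U s => [|w p IH] U s /=; first by rewrite muln0.
rewrite mulnS -addnA (card_nbhD e U s) addnC; apply: leq_add; last exact: IH.
by apply: leq_trans (deg s); apply: subset_leq_card; exact: subsetIl.
Qed.

(* A step is marked if it is bad or wild, or if one of its candidates is adjacent to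
   a vertex outside U or to a candidate of a bad or wild step. L unmarked steps in a
   row form a segment. *)
Theorem path_segment n U s p L X M : p \in ipaths n U s ->
  defect e t U s p + wilds e t U s p <= X ->
  X + D * (#|~: U| + D * X) <= M -> M.+1 * L <= (size p).+1 ->
  exists B, segment e L B.
Proof.
move=> pin leX leM run; set k := (size p).+1.
pose V i := (state U s p i).1; pose v i := (state U s p i).2.
pose A i := nbh (v i) :&: V i.
have VS i : i < size p -> V i.+1 = V i :\: nbh (v i).
  by move=> /(state_step pin); rewrite /V /v; case: state => ? ?; case: state => ? ? [].
have vS i : i < size p -> v i.+1 \in A i.
  by move=> /(state_step pin); rewrite /A /V /v; case: state => ? ?; case: state => ? ? [].
pose dirty i := bad (V i) (v i) || wild (V i) (v i).
(* The last node is a leaf and hence bad, so a clean step always has a successor on the path. *)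
have badL : bad (V (size p)) (v (size p)).
  by rewrite /bad /= /v (state_last pin).
have sum_dirty : \sum_(i < k) dirty i <= X.
  apply: leq_trans leX; rewrite -state_defect -state_wilds.
  rewrite -/k addnAC; apply: leq_trans (leq_addr _ _).
  rewrite /k !big_ord_recr /= -/(V _) -/(v _) /dirty badL /=.
  rewrite addnAC leq_add2r -big_split /=; apply: leq_sum => i _.
  by rewrite -/(V i) -/(v i); case: (bad _ _); case: (wild _ _).
have Vmono i j : i <= j -> j < k -> V j \subset V i.
  move=> /subnKC <-; elim: (j - i) => [|d IH]; first by rewrite addn0.
  rewrite addnS => ltk; apply: subset_trans (IH _); last by apply: ltnW.
  by rewrite VS ?subsetDl //.
have Adisj i j x : i < j -> j < k -> x \in A i -> x \in V j -> False.
  move=> ltij ltj /setIP[xv _] /(subsetP (Vmono _ _ ltij ltj)).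
  have ltip : i < size p by apply: leq_trans ltij _.
  by rewrite VS // in_setD xv.
pose Z := ~: U :|: \bigcup_(i < k | dirty i) A i.
have cardZ : #|Z| <= #|~: U| + D * X.
  apply: leq_trans (leq_card_setU _ _) _; rewrite leq_add2l.
  apply: leq_trans (_ : _ <= \sum_(i < k | dirty i) D) _.
    elim/big_rec2: _ => [|i m1 S _ le1]; first by rewrite cards0.
    apply: leq_trans (leq_card_setU _ _) _; apply: leq_add => //.
    by apply: leq_trans (deg (v i)); apply: subset_leq_card; exact: subsetIl.
  rewrite sum_nat_const mulnC leq_mul2l; apply/orP; right; apply: leq_trans sum_dirty.
  by rewrite -sum1_card big_mkcond; apply: leq_sum => i _; case: ifP => // di; rewrite (di : dirty i = true).
pose S := \bigcup_(z in Z) nbh z.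
have cardS : #|S| <= D * (#|~: U| + D * X).
  apply: leq_trans (_ : _ <= #|Z| * D) _; last by rewrite mulnC leq_mul2l cardZ orbT.
  rewrite -sum_nat_const /S; elim/big_rec2: _ => [|i m1 Y _ le1]; first by rewrite cards0.
  by apply: leq_trans (leq_card_setU _ _) _; apply: leq_add.
pose marked i := dirty i || (A i :&: S != set0).
have sum_marked : \sum_(i < k) marked i <= M.
  apply: leq_trans leM.
  apply: leq_trans (_ : _ <= \sum_(i < k) dirty i + \sum_(i < k) #|A i :&: S|) _.
    rewrite -big_split; apply: leq_sum => i _ /=; rewrite /marked.
    by case: (dirty i) => //=; rewrite add0n -card_gt0; case: #|_|.
  apply: leq_add => //; apply: leq_trans cardS.
  apply: leq_trans (_ : _ <= \sum_(x in S) 1) _; last by rewrite sum1_card.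
  apply: leq_trans (_ : _ <= \sum_(x in S) \sum_(i < k) (x \in A i)) _.
    rewrite exchange_big; apply: leq_sum => i _ /=.
    rewrite -sum1_card big_mkcond [leqRHS]big_mkcond; apply: leq_sum => x _ /=.
    by rewrite inE; case: (x \in A i); case: (x \in S).
  apply: leq_sum => x _; have [/existsP[i xi]|] := boolP [exists i : 'I_k, x \in A i].
    rewrite (bigD1 i) //= xi big1 ?addn0 // => j ne; apply/eqP; rewrite eqb0.
    apply/negP=> xj; have xVi := subsetP (subsetIr _ _) _ xi; have xVj := subsetP (subsetIr _ _) _ xj.
    have [ltij|ltji|eqij] := ltngtP (val i) (val j).
    - exact: (Adisj _ _ _ ltij (ltn_ord j) xi xVj).
    - exact: (Adisj _ _ _ ltji (ltn_ord i) xj xVi).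
    - by case/eqP: ne; apply: val_inj.
  by rewrite negb_exists => /forallP none; rewrite big1 // => i _; rewrite (negbTE (none i)).
have [a leak clr] := clear_run sum_marked run.
have clean i : i < k -> ~~ dirty i -> i < size p /\
    {in A i, forall x, nbh x :&: V i.+1 = A i.+1}.
  move=> ltik nd; have ltip : i < size p.
    rewrite ltn_neqAle -ltnS ltik andbT; apply/eqP=> ip.
    by move: nd; rewrite /dirty ip badL.
  split=> // x xA; move: nd; rewrite /dirty negb_or => /andP[_].
  rewrite /wild negb_exists_in => /forall_inP/(_ x xA).
  rewrite negb_exists_in => /forall_inP/(_ _ (vS i ltip)); rewrite negbK -VS // => /eqP.
  by [].
have unm j : j < L -> ~~ dirty (a + j) /\ A (a + j) :&: S = set0.
  by move=> /clr; rewrite negb_or negbK => /andP[nd /eqP].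
have ltk j : j < L -> a + j < k by move=> ltj; apply: leq_trans leak; rewrite ltn_add2l.
exists (fun j => A (a + j)); split.
- move=> j ltj; have [nd _] := unm j ltj; move: nd; rewrite negb_or => /andP[/negbTE nb _].
  by have [_ ->] := good_nodeP nb.
- move=> i j ltij ltj; apply/pred0Pn => -[x /= /andP[xi xj]].
  apply: (Adisj (a + i) (a + j) x) => //; first by rewrite ltn_add2l.
    exact: ltk.
  exact: subsetP (subsetIr _ _) _ xj.
- move=> j x y ltj xj yj; have [nd _] := unm j (ltnW ltj).
  have [_ /(_ x xj) E] := clean _ (ltk _ (ltnW ltj)) nd.
  by move: yj; rewrite addnS -E inE in_nbh => /andP[].
move=> j x j0 ltj xj; apply/subsetP=> y yx.
have ltjL : j < L := ltnW ltj; have [nd dS] := unm j ltjL.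
have xVi : x \in V (a + j) := subsetP (subsetIr _ _) _ xj.
have xS : x \in S -> False.
  by move=> xS; move/setP/(_ x): dS; rewrite in_set0 in_setI xj xS.
have yxN z : z \in Z -> z = y -> False.
  move=> zZ zy; apply: xS; apply/bigcupP; exists z => //.
  by rewrite zy in_nbh e_sym -in_nbh.
have yU : y \in U.
  by apply/negPn/negP=> yU; apply: (yxN y) => //; rewrite in_setU in_setC yU.
have find i : i < k -> y \in V i \/ exists2 l, l < i & y \in A l.
  elim: i => [|i IH] lti; first by left.
  case: (IH (ltnW lti)) => [yV|[l ltl yl]]; last by right; exists l => //; apply: ltn_trans ltl _.
  have [yA|yA] := boolP (y \in A i); first by right; exists i.
  by left; rewrite VS // in_setD yV andbT; apply: contra yA => yv; rewrite in_setI yv yV.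
rewrite !in_setU; case: (find _ (ltk _ ltjL)) => [yV|[l ltl yl]]; last first.
  have ltlk : l < k := ltn_trans ltl (ltk _ ltjL).
  have [dl|ndl] := boolP (dirty l).
    case: (yxN y) => //; rewrite in_setU; apply/orP; right.
    by apply/bigcupP; exists (Ordinal ltlk).
  (* At a clean step all candidates continue in the same way, so [x], being a neighbour of [y], is a
     candidate of step [l.+1]; as candidate sets are disjoint, [l.+1] is the step of [x]. *)
  have [ltlp /(_ y yl) E] := clean l ltlk ndl.
  have xl : x \in A l.+1.
    have exy : e y x by rewrite e_sym -in_nbh.
    rewrite -E in_setI in_nbh exy /=.
    by apply: (subsetP (Vmono l.+1 (a + j) _ _)) => //; exact: ltk.
  have [ltlj|] := ltnP l.+1 (a + j); first by case: (Adisj _ _ _ ltlj (ltk _ ltjL) xl xVi).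
  move=> gelj; have -> : a + j.-1 = l by lia.
  by rewrite yl.
have [yA|yA] := boolP (y \in A (a + j)); first by rewrite orbT.
have [ltp /(_ x xj) E] := clean _ (ltk _ ltjL) nd.
rewrite addnS -E in_setI yx /= VS // in_setD yV andbT.
have -> : y \notin nbh (v (a + j)) by apply: contra yA => yv; rewrite in_setI yv yV.
by rewrite orbT.
Qed.

End Run.

(** * Growth estimates and the existence of a segment *)

Section Growth.
Local Open Scope ring_scope.

Lemma bernoulli (a : rat) m : 0 <= a -> 1 + m%:R * a <= (1 + a) ^+ m.
Proof.
move=> a0; elim: m => [|m IH]; first by rewrite mul0r addr0 expr0.
rewrite exprS -natr1; have : 0 <= m%:R * a by rewrite mulr_ge0.
set x := m%:R * a in IH *; set y := (1 + a) ^+ m in IH * => x0.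
have : 0 <= a * (y - 1) by apply: mulr_ge0 => //; lra.
have -> : (m%:R + 1) * a = x + a by rewrite mulrDl mul1r.
lra.
Qed.

(** With [m = n %/ (4 * K)], Bernoulli's inequality gives [(1 + a) ^ (4 * m) >= (m * a) ^ 4], a
    fourth power against a cube. *)
Lemma exp_beats_cube (a : rat) (c K : nat) : 0 < a -> (0 < K)%N ->
  exists n1, forall n, (n1 <= n)%N -> (c * n ^ 3)%N%:R <= (1 + a) ^+ (n %/ K).
Proof.
move=> a0 K0; pose b : rat := (c * (512 * K ^ 3))%N%:R / a ^+ 4.
have a40 : 0 < a ^+ 4 by rewrite exprn_gt0.
have b0 : 0 <= b by rewrite divr_ge0 ?ler0n // ltW.
exists ((Num.bound b).+1 * (4 * K))%N => n len.
pose m := (n %/ (4 * K))%N.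
have mb : (Num.bound b < m)%N by rewrite /m leq_divRL // muln_gt0.
have nm : (n <= 8 * K * m)%N.
  have := ltn_ceil n (_ : 0 < 4 * K)%N; rewrite muln_gt0 K0 => /(_ isT).
  rewrite -/m; have : (0 < m)%N by apply: leq_trans mb; [exact: leq0n]. 
  nia.
have m4 : (m * 4 <= n %/ K)%N.
  by rewrite leq_divRL // -mulnA /m leq_divM.
have a1 : 1 <= 1 + a by rewrite lerDl ltW.
apply: le_trans (ler_weXn2l a1 m4); rewrite exprM.
have ma : m%:R * a <= (1 + a) ^+ m.
  by have := bernoulli m (ltW a0); apply: le_trans; rewrite lerDr.
have ma0 : 0 <= m%:R * a by rewrite mulr_ge0 // ltW.
apply: le_trans (lerXn2r 4 _ _ ma); rewrite ?nnegrE //; last first.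
  by apply: exprn_ge0; apply: le_trans a1.
have le1 : (c * n ^ 3 <= c * (512 * K ^ 3) * m ^ 3)%N.
  rewrite -mulnA leq_mul2l; apply/orP; right.
  apply: leq_trans (_ : _ <= (8 * K * m) ^ 3)%N _; first by rewrite leq_exp2r.
  by rewrite !expnMn.
apply: le_trans (_ : _ <= (c * (512 * K ^ 3) * m ^ 3)%N%:R) _; first by rewrite ler_nat.
have bm : b <= m%:R.
  have := archi_boundP b0; move/ltW => /le_trans; apply.
  by rewrite ler_nat ltnW.
rewrite exprMn natrM natrX [m%:R ^+ 4]exprS mulrAC; apply: ler_wpM2r; first by rewrite exprn_ge0.
by rewrite -ler_pdivrMr.
Qed.
End Growth.

Lemma exists_large (I : finType) (P : pred I) (F : I -> nat) c m :
  0 < c -> c <= \sum_(i | P i) F i -> #|I| <= m -> exists2 i, P i & c <= m * F i.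
Proof.
move=> c0 le_c le_m; have [/existsP[i /andP[Pi ge]]|] := boolP [exists i, P i && (c <= m * F i)].
  by exists i.
rewrite negb_exists => /forallP none; exfalso.
have small i : P i -> m * F i <= c.-1.
  by move=> Pi; have := none i; rewrite Pi /= -ltnNge; lia.
have : m * c <= m * c.-1.
  apply: leq_trans (_ : _ <= m * \sum_(i | P i) F i) _; first by rewrite leq_mul2l le_c orbT.
  rewrite big_distrr /=; apply: leq_trans (_ : _ <= \sum_(i | P i) c.-1) _; first exact: leq_sum.
  rewrite sum_nat_const leq_mul2r; apply/orP; right.
  exact: leq_trans (max_card _) le_m.
have m0 : 0 < m.
  apply: leq_trans le_m; rewrite lt0n; apply/eqP=> I0; move: le_c.
  by rewrite big1 => [|i _]; [lia|have := fintype0 i I0].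
by rewrite leq_pmul2l //; lia.
Qed.

Section Typical.
Variables (T : finType) (e : rel T) (t : T) (D : nat).
Hypotheses (e_sym : symmetric e) (deg : forall x, #|nbh e x| <= D) (D_gt0 : 0 < D).
Implicit Types (U : {set T}) (s : T) (p : seq T).
Local Notation nbh := (nbh e).
Local Notation ipaths := (ipaths e t).
Local Open Scope ring_scope.

Lemma targets_ok_nil U s : s \notin U -> targets_ok e U s [::].
Proof. by move=> sU; split. Qed.

(** The sums of [kappa ^ defect] and of [tweight] over all paths are both at most [pot #|U|], so not
    every path can have one of the two above [kappa ^ b]. On a path where both are small, [(4 / 3) ^
    acts <= kappa ^ b * 4 ^ (D * b)], and [4 <= (4 / 3) ^ 5] gives the factor [1 + 5 * D]. *)
Lemma typical_path n U s b : s \notin U -> (0 < size (ipaths n U s))%N ->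
  3 * (pot #|U|)%:R <= (size (ipaths n U s))%:R * kappa ^+ b ->
  exists p, [/\ p \in ipaths n U s, (defect e t U s p <= b)%N
              & (wilds e t U s p <= (1 + 3 * D) * ((1 + 5 * D) * b))%N].
Proof.
move=> sU N0 leN; have ok := targets_ok_nil sU.
have kap1 : 1 <= kappa by rewrite kappaE; lra.
have kb0 m : 0 < kappa ^+ m by apply: exprn_gt0; apply: lt_le_trans kap1.
have pot0 : 0 < (pot #|U|)%:R :> rat by rewrite ltr0n pot_gt0.
case: (boolP (has (fun p => (defect e t U s p <= b)%N && (tweight e t D [::] U s p <= kappa ^+ b))
   (ipaths n U s))) => [/hasP[p pin /andP[pd pw]]|].
  exists p; split=> //; apply: leq_trans (wilds_acts e_sym deg D_gt0 ok pin) _.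
  have -> : #|U :&: reach e [::]| = 0%N.
    by apply: eq_card0 => x; rewrite inE /reach big_nil inE andbF.
  rewrite addn0 leq_mul2l; apply/orP; right.
  have low := le_trans (tweight_lower D_gt0 ok pin) pw.
  set k := acts _ _ _ _ _ _ in low *; set d := defect _ _ _ _ _ in pd low.
  have q4 : 4 <= (4 / 3 : rat) ^+ 5 by rewrite !exprS expr0; lra.
  have r1 : 1 <= 4 / 3 :> rat by lra.
  have r0 : 0 <= 4 / 3 :> rat by lra.
  suff : (4 / 3 : rat) ^+ k <= (4 / 3) ^+ ((1 + 5 * D) * b)%N by rewrite ler_eXn2l //; lra.
  have e4 : 4 ^+ (D * d) <= (4 / 3 : rat) ^+ (5 * (D * b)).
    rewrite [leRHS]exprM; apply: le_trans (_ : _ <= 4 ^+ (D * b)) _.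
      by apply: ler_weXn2l; [lra|rewrite leq_mul2l pd orbT].
    by apply: lerXn2r; rewrite ?nnegrE; [lra|apply: exprn_ge0|].
  have kl : kappa ^+ b <= (4 / 3 : rat) ^+ b.
    by apply: lerXn2r; rewrite ?nnegrE; rewrite ?kappaE; lra.
  have -> : ((1 + 5 * D) * b = b + 5 * (D * b))%N by rewrite mulnDl mul1n mulnA.
  rewrite exprD; apply: le_trans (_ : _ <= kappa ^+ b * 4 ^+ (D * d)) _; last first.
    by apply: ler_pM; [exact: ltW|apply: exprn_ge0; lra|exact: kl|exact: e4].
  have four0 : 0 < (4 : rat) ^+ (D * d) by apply: exprn_gt0; lra.
  have := ler_wpM2r (ltW four0) low; rewrite -mulrA -exprMn div1r mulVf; last lra.
  by rewrite expr1n mulr1.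
rewrite -all_predC => /allP none; exfalso.
have S1 := sum_defect e t n U s; have S2 := sum_tweight t e_sym deg n ok.
rewrite /weight big_nil mulr1 in S2.
have S1' := le_trans S1 (ler_wpM2r (ltW pot0) (loss_coef_le1 e t U s)).
have : (size (ipaths n U s))%:R * kappa ^+ b <=
   \sum_(p <- ipaths n U s) (kappa ^+ defect e t U s p + tweight e t D [::] U s p).
  rewrite mulr_natl -[X in _ *+ X]sum1_size -sumrMnr big_seq [leRHS]big_seq.
  apply: ler_sum => p pin; rewrite mulr1n.
  have w0 : 0 <= tweight e t D [::] U s p.
    apply: le_trans (tweight_lower D_gt0 ok pin).
    by apply: mulr_ge0; apply: exprn_ge0; lra.
  have := none p pin; rewrite /= negb_and -ltnNge -ltNge => /orP[lt|lt]; last by have := kb0 (defect e t U s p); lra.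
  by have := ler_weXn2l kap1 (ltnW lt); lra.
rewrite big_split /=; lra.
Qed.
End Typical.

Theorem segment_exists D : exists n1, forall (T : finType) (e : rel T),
  symmetric e -> irreflexive e -> (forall x, #|nbh e x| <= D) -> n1 <= #|T| ->
  mm3 #|T| <= 3 * num_induced_cycles e -> exists B, segment e 8 B.
Proof.
wlog D_gt0 : D / 0 < D.
  move=> W; case: (posnP D) => [->|/W //].
  have [n1 H] := W 1 isT; exists n1 => T e es ei deg; apply: H => // x.
  by apply: leq_trans (deg x) _.
(* [c1 * b] bounds the defect plus the wild steps and [c2 * b + D * D.+1] the marked steps. [K] is
   so large that with [b = n %/ K] the path, of about [n / D] steps, still has eight unmarked steps
   in a row. *)
pose c1 := 1 + (1 + 3 * D) * (1 + 5 * D).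
pose c2 := c1 + D * (D * c1); pose c3 := D * D.+1 + 1.
pose K := 2 * (8 * D * c2 + 1).
have K0 : 0 < K by rewrite /K muln_gt0 addn1.
have a0 : (0 < 1 / 1000 :> rat)%R by lra.
have [n1 Hn1] := exp_beats_cube 81 a0 K0.
exists (maxn n1 (2 * (8 * D * c3 + D.+1))) => T e es ei deg; rewrite geq_max => /andP[leT1 leT2] big.
have [cnt cntE] : exists c, num_induced_cycles e = c by exists (num_induced_cycles e).
rewrite cntE in big.
set n := #|T| in leT1 leT2 big *; pose b := n %/ K.
have kb : ((81 * n ^ 3)%N%:R <= kappa ^+ b)%R.
  by have := Hn1 n leT1; have -> : kappa = (1 + 1 / 1000)%R by rewrite kappaE; lra.
pose N z (q : T * T) := size (ipaths e q.1 n (~: (z |: nbh e z)) q.2).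
have [[z q] /= /andP[ez eq] big'] : exists2 zq : T * (T * T),
    e zq.1 zq.2.1 && e zq.1 zq.2.2 & cnt <= n ^ 3 * N zq.1 zq.2.
  apply: exists_large.
  - by have := mm3_gt0 n; clear -big; lia.
  - rewrite -cntE; apply: leq_trans (card_cycles_sum e) _.
    rewrite -(pair_big_dep xpredT (fun z q => e z q.1 && e z q.2) N) /=.
    by apply: leq_sum => z _; exact: card_cycles_through.
  - by rewrite !card_prod /n !expnS expn0 muln1.
pose U := ~: (z |: nbh e z); pose s := q.2; pose t := q.1.
have sU : s \notin U by rewrite in_setC negbK in_setU1 in_nbh eq orbT.
have Nz : N z q = size (ipaths e t n U s) by [].
have N0 : 0 < size (ipaths e t n U s).
  rewrite -Nz lt0n; apply/eqP=> NE; move: big'; rewrite /= NE muln0 => big'.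
  have := mm3_gt0 n; clear -big big'; lia.
have cU : #|~: U| <= D.+1.
  rewrite setCK cardsU1 -[D.+1]add1n; apply: leq_add (deg z).
  by case: (z \notin nbh e z).
(* [pot n <= 9 * mm3 n] and [mm3 n <= 3 * cnt] give the factor 81, and the choice of the best start
   the factor [n ^ 3]. *)
have potU : 3 * pot #|U| <= 81 * n ^ 3 * size (ipaths e t n U s).
  have := pot_mono (max_card (mem U)); have := pot_le_mm3 n; rewrite -Nz -/n.
  move: (pot _) (pot _) (mm3 n) big big' => p1 p2 m; nia.
have leN : (3 * (pot #|U|)%:R <= (size (ipaths e t n U s))%:R * kappa ^+ b)%R.
  have : ((3 * pot #|U|)%N%:R <= (81 * n ^ 3 * size (ipaths e t n U s))%N%:R :> rat)%R by rewrite ler_nat.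
  rewrite (natrM _ 3) => /le_trans; apply; rewrite (natrM _ (81 * n ^ 3)) mulrC.
  exact: ler_wpM2l.
have [p [pin pd pw]] := typical_path es deg D_gt0 sU N0 leN.
apply: (path_segment (X := c1 * b) (M := c2 * b + D * D.+1) es deg pin).
- rewrite /c1 mulnDl mul1n -mulnA; exact: leq_add.
- rewrite /c2 mulnDl -!mulnA -addnA leq_add2l addnC -mulnDr leq_mul2l.
  by rewrite leq_add2l cU orbT.
have := state_card deg U s p; have := state_defect e t U s p.
set l := #|_|; set Sb := \sum_(i < _) _ => dl cardU.
have lb : l <= b by apply: leq_trans pd; rewrite -dl leq_addl.
have nU : n <= #|U| + D.+1.
  by rewrite /n -(cardsC U) leq_add2l.
have bK : b * K <= n := leq_divM _ _.
have key : D * (8 * (c2 * b + c3)) <= D * size p.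
  have h1 : 2 * (8 * D * c3 + D.+1) <= n by clear -leT2.
  have h2 : 2 * (8 * D * c2 * b + b) <= n by move: bK; rewrite /K; clear; nia.
  have h3 : n <= D * size p + b + D.+1 by clear -nU cardU lb; lia.
  have -> : D * (8 * (c2 * b + c3)) = 8 * D * c2 * b + 8 * D * c3 by clear; ring.
  clear -h1 h2 h3; lia.
move: key; rewrite (leq_pmul2l D_gt0) /c3; move: (D * D.+1) (c2 * b) (size p); clear => x y k; lia.
Qed.

(** * Cycles in graphs with a segment *)

Section Modules.
Variables (T : finType) (e : rel T).
Hypotheses (e_sym : symmetric e) (e_irr : irreflexive e).
Implicit Types (U C W X Y : {set T}) (s t w x y z : T) (B : nat -> {set T}).
Local Notation nbh := (nbh e).

Lemma cycle_nbrs2 C x y z : induced_cycle e C -> x \in C -> y \in C -> z \in C ->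
  y != z -> e x y -> e x z -> forall w, w \in C -> e x w = (w == y) || (w == z).
Proof.
move=> Ccyc xC yC zC neq exy exz.
have [a [b [ab aC bC nb]]] := cycle_nbrs e_sym e_irr Ccyc xC.
move: exy exz; rewrite !nb //; case/orP=> /eqP yE; case/orP=> /eqP zE w wC;
  rewrite ?nb // yE zE; try by rewrite orbC.
  by move: neq; rewrite yE zE eqxx.
by move: neq; rewrite yE zE eqxx.
Qed.

(** A vertex [y] of the cycle in [Y] sees two cycle vertices of [X], hence these are all its cycle
    neighbours and the only cycle vertices in [X]. If they are adjacent, the cycle is a triangle;
    otherwise their second neighbours lie in [Y], are shared, and close a square. *)
Lemma module_cycle C X Y : induced_cycle e C ->
  {in X & Y, forall x y, e x y} -> {in X, forall x, nbh x \subset X :|: Y} ->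
  [disjoint X & Y] -> 1 < #|C :&: X| ->
  [\/ C \subset X,
      exists x x' y, [/\ x \in X, x' \in X & y \in Y] /\
        [/\ x != x', e x x' & C = [set x; x'; y]]
    | exists x x' y y', [/\ x \in X, x' \in X, y \in Y & y' \in Y] /\
        [/\ x != x', y != y', ~~ e x x', ~~ e y y' & C = [set x; x'] :|: [set y; y']]].
Proof.
move=> Ccyc XY Xnb dXY /card_gt1P[x0 [x1 [/setIP[x0C x0X] /setIP[x1C x1X] ne01]]].
have XnY x : x \in X -> x \notin Y by move=> xX; rewrite (disjointFr dXY xX).
have [CY0|/set0Pn[y /setIP[yC yY]]] := eqVneq (C :&: Y) set0.
  apply: Or31; apply: (cycle_connected e_sym Ccyc x0C x0X).
  move=> u v uC uX vC euv; have : v \in nbh u by rewrite in_nbh.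
  move/(subsetP (Xnb u uX)); rewrite inE => /orP[//|vY].
  by move/setP/(_ v): CY0; rewrite !inE vC vY.
have ey0 : e y x0 by rewrite e_sym XY.
have ey1 : e y x1 by rewrite e_sym XY.
have ynb := cycle_nbrs2 Ccyc yC x0C x1C ne01 ey0 ey1.
have inX w : w \in C -> w \in X -> (w == x0) || (w == x1).
  by move=> wC wX; rewrite -ynb // e_sym XY.
have e0y : e x0 y by rewrite e_sym.
have e1y : e x1 y by rewrite e_sym.
have nyx x : x \in X -> x == y = false.
  by move=> xX; apply/eqP=> xy; move: (XnY x xX); rewrite xy yY.
have sub (S : {set T}) : [set x0; x1; y] \subset S ->
  (forall u v, u \in C -> u \in S -> v \in C -> e u v -> v \in S) -> C \subset S.
  move=> sS cl; apply: (cycle_connected e_sym Ccyc x0C _ cl).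
  by apply: (subsetP sS); rewrite !inE eqxx.
case e01 : (e x0 x1).
  apply: Or32; exists x0, x1, y; split=> //; split=> //.
  have nb0 := cycle_nbrs2 Ccyc x0C x1C yC (negbT (nyx _ x1X)) e01 e0y.
  have e10 : e x1 x0 by rewrite e_sym.
  have nb1 := cycle_nbrs2 Ccyc x1C x0C yC (negbT (nyx _ x0X)) e10 e1y.
  apply/eqP; rewrite eqEsubset; apply/andP; split; last first.
    by apply/subsetP=> w; rewrite !inE => /orP[/orP[]|] /eqP ->.
  apply: sub => // u v uC; rewrite !inE => /orP[/orP[]|] /eqP -> vC.
  - by rewrite nb0 // => /orP[] ->; rewrite ?orbT.
  - by rewrite nb1 // => /orP[] ->; rewrite ?orbT.
  - by rewrite ynb // => /orP[] ->; rewrite ?orbT.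
have [a [b [ab aC bC nb0]]] := cycle_nbrs e_sym e_irr Ccyc x0C.
have [y' [y'C yy' e0y']] : exists y', [/\ y' \in C, y != y' & e x0 y'].
  have := nb0 y yC; rewrite e0y => /esym /orP[/eqP ->|/eqP ->].
    by exists b; rewrite nb0 // eqxx orbT.
  by exists a; rewrite nb0 // eqxx eq_sym.
have y'Y : y' \in Y.
  have : y' \in nbh x0 by rewrite in_nbh.
  move/(subsetP (Xnb x0 x0X)); rewrite inE => /orP[y'X|//].
  have := inX y' y'C y'X => /orP[] /eqP y'E; first by rewrite y'E e_irr in e0y'.
  by rewrite y'E e01 in e0y'.
have e1y' : e x1 y' by apply: XY.
have nb0' := cycle_nbrs2 Ccyc x0C yC y'C yy' e0y e0y'.
have nb1' := cycle_nbrs2 Ccyc x1C yC y'C yy' e1y e1y'.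
have ey0' : e y' x0 by rewrite e_sym.
have ey1' : e y' x1 by rewrite e_sym.
have y'nb := cycle_nbrs2 Ccyc y'C x0C x1C ne01 ey0' ey1'.
have nyx' x : x \in X -> y' == x = false.
  by move=> xX; apply/eqP=> xy; move: (XnY x xX); rewrite -xy y'Y.
apply: Or33; exists x0, x1, y, y'; split; first by split.
split=> //; first by rewrite e01.
  by rewrite ynb // !nyx'.
apply/eqP; rewrite eqEsubset; apply/andP; split; last first.
  by apply/subsetP=> w; rewrite !inE => /orP[/orP[]|/orP[]] /eqP ->.
apply: sub.
  by apply/subsetP=> w; rewrite !inE => /orP[/orP[]|] ->; rewrite ?orbT.
move=> u v uC; rewrite !inE => /orP[/orP[]|/orP[]] /eqP -> vC.
- by rewrite nb0' // => /orP[] ->; rewrite ?orbT.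
- by rewrite nb1' // => /orP[] ->; rewrite ?orbT.
- by rewrite ynb // => /orP[] ->; rewrite ?orbT.
- by rewrite y'nb // => /orP[] ->; rewrite ?orbT.
Qed.

Section SegmentCycles.
Variable B : nat -> {set T}.
Hypothesis seg : segment e 8 B.

Lemma seg_in j x y : 0 < j -> j < 7 -> x \in B j ->
  e x y -> [\/ y \in B j.-1, y \in B j | y \in B j.+1].
Proof.
case: seg => _ _ _ nb j0 j7 xj exy.
have : y \in nbh x by rewrite in_nbh.
move/(subsetP (nb j x j0 j7 xj)); rewrite !in_setU => /orP[/orP[]|] ?;
  [exact: Or31|exact: Or32|exact: Or33].
Qed.

Lemma seg_adj i j x y : i < 8 -> j < 8 -> (j == i.+1) || (i == j.+1) ->
  x \in B i -> y \in B j -> e x y.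
Proof.
case: seg => _ _ adj _ lti ltj /orP[] /eqP E xi yj; first by subst j; apply: adj xi yj.
by subst i; rewrite e_sym; apply: adj yj xi.
Qed.

Lemma seg_disj i j x : i < 8 -> j < 8 -> x \in B i -> x \in B j -> i = j.
Proof.
case: seg => _ dis _ _ lti ltj xi xj; case: (ltngtP i j) => // lt.
  by have := disjointFr (dis i j lt ltj) xi; rewrite xj.
by have := disjointFr (dis j i lt lti) xj; rewrite xi.
Qed.

Lemma seg_nonadj i j x y : i < 8 -> j < 8 -> 0 < i < 7 -> i != j -> j != i.+1 -> i != j.+1 ->
  x \in B i -> y \in B j -> e x y = false.
Proof.
move=> lti ltj /andP[i0 i7] nij nj ni xi yj; apply/negP=> exy.
by case: (seg_in i0 i7 xi exy) => y'; have := seg_disj _ _ yj y'; lia.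
Qed.

(** Two cycle vertices in one inner triple make the cycle local, by [module_cycle]. Otherwise a
    cycle vertex in an inner triple has its two cycle neighbours on different sides, so a cycle that
    meets one of [B 2] to [B 5] runs straight through. *)
Lemma segment_cycles C : induced_cycle e C ->
  [\/ [&& C :&: B 1 != set0, C :&: B 2 != set0, C :&: B 3 != set0 & C :&: B 4 != set0],
      exists2 j, 0 < j < 7 & C \subset B j.-1 :|: B j :|: B j.+1
    | C \subset ~: (B 2 :|: B 3 :|: B 4 :|: B 5)].
Proof.
move=> Ccyc; have [_ dis _ nb] := seg.
case: (boolP [exists j : 'I_8, (0 < j < 7) && (1 < #|C :&: B j|)]) => [|small].
  case/existsP=> j /andP[j07 big]; apply: Or32; exists (val j) => //.
  have := @module_cycle C (B j) (B j.-1 :|: B j.+1) Ccyc.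
  have XY : {in B j & B j.-1 :|: B j.+1, forall x y, e x y}.
    move=> x y xj; rewrite in_setU => /orP[] yj; apply: seg_adj xj yj; lia.
  have Xnb : {in B j, forall x, nbh x \subset B j :|: (B j.-1 :|: B j.+1)}.
    by move=> x xj; have /andP[j0 j7] := j07; rewrite setUA (setUC (B j)); apply: nb.
  have dXY : [disjoint B j & B j.-1 :|: B j.+1].
    apply/pred0P=> x /=; rewrite in_setU; apply/negP=> /andP[xj /orP[] xj'];
    by have := seg_disj _ _ xj xj'; lia.
  case/(_ XY Xnb dXY big) => [sub|[x [x' [y [[xj x'j yY] [_ _ ->]]]]]|].
  - by apply: subset_trans sub _; rewrite setUAC subsetUr.
  - rewrite in_setU in yY; apply/subsetP=> w; rewrite (setUAC (B _)) !in_setU !in_set1.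
    by case/orP=> [/orP[]|] /eqP ->; rewrite ?xj ?x'j ?yY ?orbT.
  case=> x [x' [y [y' [[xj x'j yY y'Y] [_ _ _ _ ->]]]]].
  rewrite in_setU in yY; rewrite in_setU in y'Y.
  apply/subsetP=> w; rewrite (setUAC (B _)) !in_setU !in_set1.
  by case/orP=> /orP[] /eqP ->; rewrite ?xj ?x'j ?yY ?y'Y ?orbT.
have one j x y : 0 < j < 7 -> x \in C -> y \in C -> x \in B j -> y \in B j -> x = y.
  move=> j07 xC yC xj yj; apply/eqP/negPn/negP=> nxy.
  move: small; rewrite negb_exists => /forallP.
  have ltj : j < 8 by lia.
  move/(_ (Ordinal ltj)); rewrite /= j07 /= => /negP[].
  by apply/card_gt1P; exists x, y; rewrite !inE xC yC.
have [sub|] := boolP (C \subset ~: (B 2 :|: B 3 :|: B 4 :|: B 5)); first exact: Or33.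
move=> nsub; apply: Or31.
have step j : 1 < j < 6 -> C :&: B j != set0 ->
    C :&: B j.-1 != set0 /\ C :&: B j.+1 != set0.
  move=> j16 /set0Pn[x /setIP[xC xj]].
  have j07 : 0 < j < 7 by clear -j16; lia.
  have jm : 0 < j.-1 < 7 by clear -j16; lia.
  have jp : 0 < j.+1 < 7 by clear -j16; lia.
  have [a [b [ab aC bC nbx]]] := cycle_nbrs e_sym e_irr Ccyc xC.
  have exa : e x a by rewrite nbx // eqxx.
  have exb : e x b by rewrite nbx // eqxx orbT.
  have side w : w \in C -> e x w -> w \in B j.-1 \/ w \in B j.+1.
    move=> wC exw; have [j0 j7] := andP j07.
    case: (seg_in j0 j7 xj exw) => wj; [by left| |by right].
    have xw := one j x w j07 xC wC xj wj.
    by rewrite xw e_irr in exw.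
  have ne i : 0 < i < 7 -> a \in B i -> b \in B i -> False.
    by move=> i07 ai bi; move: ab; rewrite (one i a b i07 aC bC ai bi) eqxx.
  have mk i w : w \in C -> w \in B i -> C :&: B i != set0.
    by move=> wC wi; apply/set0Pn; exists w; rewrite inE wC.
  case: (side a aC exa) => aj; case: (side b bC exb) => bj.
  - by case: (ne _ jm aj bj).
  - by split; [exact: mk aC aj|exact: mk bC bj].
  - by split; [exact: mk bC bj|exact: mk aC aj].
  - by case: (ne _ jp aj bj).
have : [|| C :&: B 2 != set0, C :&: B 3 != set0, C :&: B 4 != set0 | C :&: B 5 != set0].
  move/subsetPn: nsub => [x xC]; rewrite in_setC negbK !in_setU => xB.
  apply/or4P; case/orP: xB => [/orP[/orP[]|]|] xj;
    [apply: Or41|apply: Or42|apply: Or43|apply: Or44]; by apply/set0Pn; exists x; rewrite inE xC.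
have s2 := step 2 isT; have s3 := step 3 isT; have s4 := step 4 isT; have s5 := step 5 isT.
case/or4P=> H; apply/and4P.
- by have [h1 h3] := s2 H; have [_ h4] := s3 h3.
- by have [h2 h4] := s3 H; have [h1 _] := s2 h2.
- by have [h3 _] := s4 H; have [h2 _] := s3 h3; have [h1 _] := s2 h2.
- by have [h4 _] := s5 H; have [h3 _] := s4 h4; have [h2 _] := s3 h3; have [h1 _] := s2 h2.
Qed.

Definition seg_rest := ~: (B 1 :|: B 2 :|: B 3 :|: B 4).

Lemma seg_nbh23 b2 b3 : b2 \in B 2 -> b3 \in B 3 -> ~: (nbh b2 :|: nbh b3) = seg_rest.
Proof.
move=> h2 h3; congr (~: _); apply/setP=> x; rewrite !in_setU !in_nbh.
apply/idP/idP=> [/orP[ex|ex]|].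
- by case: (seg_in _ _ h2 ex) => //= ->; rewrite ?orbT.
- by case: (seg_in _ _ h3 ex) => //= ->; rewrite ?orbT.
case/orP=> [/orP[/orP[]|]|] xj.
- by rewrite (seg_adj (i := 2) (j := 1) _ _ _ h2 xj).
- by rewrite (seg_adj (i := 3) (j := 2) _ _ _ h3 xj) // orbT.
- by rewrite (seg_adj (i := 2) (j := 3) _ _ _ h2 xj).
- by rewrite (seg_adj (i := 3) (j := 4) _ _ _ h3 xj) // orbT.
Qed.

Lemma seg_card j : j < 8 -> #|B j| = 3. Proof. by case: seg => H _ _ _ /H. Qed.

Lemma seg_cardU2 (X : {set T}) j : j < 8 -> (forall x, x \in X -> x \in B j -> False) ->
  #|X :|: B j| = #|X| + 3.
Proof.
move=> ltj dis; rewrite cardsU (seg_card ltj).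
have -> : X :&: B j = set0 by apply/setP=> x; rewrite !inE; apply/negP=> /andP[]; exact: dis.
by rewrite cards0 subn0.
Qed.

Lemma seg_card4 i : i < 5 -> #|B i :|: B i.+1 :|: B i.+2 :|: B i.+3| = 12.
Proof.
move=> lti; rewrite !seg_cardU2 ?seg_card //; try lia;
  move=> x; rewrite ?in_setU => H xj; move: H; do ?case/orP; move=> xi;
  have := seg_disj _ _ xi xj; lia.
Qed.

Lemma card_seg_rest : #|seg_rest| = #|T| - 12.
Proof. by rewrite cardsCs /seg_rest setCK (@seg_card4 1). Qed.

(** There are [3 ^ 4 = 81] ways through [B 1] to [B 4] and [2 ^ 9] vertex sets in each of six
    windows of three triples; cycles that avoid [B 2] to [B 5] live on 12 vertices fewer. *)
Lemma segment_bound N :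
  (forall b1 b4, b1 \in B 1 -> b4 \in B 4 -> size (ipaths e b1 #|T| seg_rest b4) <= N) ->
  num_induced_cycles e <= 81 * N + 6 * 2 ^ 9 + max_induced_cycles (#|T| - 12).
Proof.
move=> HN.
pose X1 := [set C | induced_cycle e C & [&& C :&: B 1 != set0, C :&: B 2 != set0,
              C :&: B 3 != set0 & C :&: B 4 != set0]].
pose X2 := \bigcup_(j < 6) powerset (B j :|: B j.+1 :|: B j.+2).
pose X3 := [set C | induced_cycle e C & C \subset ~: (B 2 :|: B 3 :|: B 4 :|: B 5)].
have sub : [set C | induced_cycle e C] \subset X1 :|: X2 :|: X3.
  apply/subsetP=> C; rewrite inE => Ccyc; rewrite 2!in_setU.
  case: (segment_cycles Ccyc) => [H|[j j07 H]|H].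
  - by rewrite /X1 inE Ccyc H.
  - apply/orP; left; apply/orP; right; have ltj : j.-1 < 6 by lia.
    apply/bigcupP; exists (Ordinal ltj) => //; rewrite powersetE /=.
    by have -> : j.-1.+1 = j by lia.
  - by apply/orP; right; rewrite /X3 inE Ccyc H.
apply: leq_trans (subset_leq_card sub) _.
apply: leq_trans (leq_card_setU _ _) _; apply: leq_add; last first.
  have := cycles_within e_sym e_irr (~: (B 2 :|: B 3 :|: B 4 :|: B 5)).
  by rewrite (cardsCs (~: _)) setCK (@seg_card4 2).
apply: leq_trans (leq_card_setU _ _) _; apply: leq_add.
  have := @card_cycles_path4 T e e_sym e_irr (B 1) (B 2) (B 3) (B 4) N.
  rewrite !seg_card //; apply=> b2 b3 b1 b4 h1 h2 h3 h4; split; last by rewrite seg_nbh23 ?HN.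
  split.
  - exact: (seg_adj (i := 1) (j := 2) _ _ _ h1 h2).
  - exact: (seg_adj (i := 2) (j := 3) _ _ _ h2 h3).
  - exact: (seg_adj (i := 3) (j := 4) _ _ _ h3 h4).
  - by rewrite (seg_nonadj (i := 1) (j := 3) _ _ _ _ _ _ h1 h3).
  - apply/andP; split; apply/eqP=> E.
      by rewrite E in h1; have := seg_disj (i := 1) (j := 3) isT isT h1 h3.
    by rewrite E in h2; have := seg_disj (i := 2) (j := 4) isT isT h2 h4.
apply: leq_trans (_ : _ <= \sum_(j < 6) 2 ^ 9) _; last by rewrite sum_nat_const card_ord.
rewrite /X2; elim/big_rec2: _ => [|j m1 S _ le1]; first by rewrite cards0.
apply: leq_trans (leq_card_setU _ _) _; apply: leq_add => //.
rewrite card_powerset leq_exp2l //; have ltj : j < 6 by exact: ltn_ord.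
have c3 i : i < 8 -> #|B i| <= 3 by move=> lti; rewrite seg_card.
apply: leq_trans (leq_card_setU _ _) _; apply: (@leq_add _ _ 6 3); last by apply: c3; clear -ltj; lia.
by apply: leq_trans (leq_card_setU _ _) _; apply: (@leq_add _ _ 3 3); apply: c3; clear -ltj; lia.
Qed.

Lemma ipaths_congr t t' n U s s' : nbh s :&: U = nbh s' :&: U -> e s t = e s' t' ->
  {in U, forall x, e x t = e x t'} -> ipaths e t n U s = ipaths e t' n U s'.
Proof.
elim: n U s s' => [|n IH] U s s' EU Et Ux /=; rewrite Et //.
case: ifP => // _; rewrite EU; congr flatten; apply/eq_in_map => w.
rewrite mem_enum => /setIP[_ wU].
have -> : U :\: nbh s = U :\: nbh s' by rewrite -setD_nbh EU setD_nbh.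
congr map; apply: IH => //; first exact: Ux.
by move=> x /setDP[xU _]; exact: Ux.
Qed.

Lemma seg_nbh4 b4 : b4 \in B 4 -> nbh b4 :&: seg_rest = B 5.
Proof.
move=> h4; apply/setP=> x; rewrite in_setI in_nbh /seg_rest in_setC !in_setU.
apply/idP/idP=> [/andP[ex]|x5].
  by case: (seg_in _ _ h4 ex) => //= ->; rewrite !orbT.
rewrite (seg_adj (i := 4) (j := 5) _ _ _ h4 x5) //=.
by apply/negP=> H; move: H; do ?case/orP; move=> xi; have := seg_disj _ _ xi x5; lia.
Qed.

Lemma seg_nbh1 b1 x : b1 \in B 1 -> x \in seg_rest -> e x b1 = (x \in B 0).
Proof.
move=> h1; rewrite /seg_rest in_setC !in_setU => xR; rewrite e_sym.
apply/idP/idP=> [ex|x0]; last exact: (seg_adj (i := 1) (j := 0) _ _ _ h1 x0).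
by move: xR; case: (seg_in _ _ h1 ex) => //= ->; rewrite ?orbT.
Qed.

(** In [seg_rest] every vertex of [B 4] sees exactly [B 5] and every vertex of [B 1] exactly [B 0].
    Hence one search tree stands for all starts, and a loss in it is multiplied by 81. *)
Lemma seg_ipaths b1 b4 b1' b4' : b1 \in B 1 -> b4 \in B 4 -> b1' \in B 1 -> b4' \in B 4 ->
  ipaths e b1 #|T| seg_rest b4 = ipaths e b1' #|T| seg_rest b4'.
Proof.
move=> h1 h4 h1' h4'; apply: ipaths_congr; first by rewrite !seg_nbh4.
  by rewrite !(seg_nonadj (i := 4) (j := 1) _ _ _ _ _ _ _ _).
by move=> x xR; rewrite !seg_nbh1.
Qed.

End SegmentCycles.
End Modules.

(** * The maximum up to a constant factor *)

Lemma mm3_shift m k : 4 ^ k * mm3 m <= 3 ^ k * mm3 (m + k).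
Proof.
elim: k => [|k IH]; first by rewrite !mul1n addn0.
rewrite addnS !expnS; have [le _] := mm3S (m + k).
rewrite -mulnA; apply: leq_trans (_ : _ <= 4 * (3 ^ k * mm3 (m + k))) _.
  by rewrite leq_mul2l.
by rewrite mulnCA [leqRHS]mulnAC [leqRHS]mulnC leq_mul2l le orbT.
Qed.

(** Each removed vertex shrinks [mm3] by at least a factor 3/4, which beats the [d * d] pairs of
    neighbours of a vertex of large degree. *)
Lemma degree_threshold : exists D, forall d n, D <= d -> d < n ->
  100 * (d * d * mm3 (n - d.+1)) <= mm3 n.
Proof.
have a0 : (0 < 1 / 3 :> rat)%R by lra.
have [D HD] := exp_beats_cube 100 a0 (isT : 0 < 1).
exists D.+1 => d n ltDd ltdn.
have := HD d (ltnW ltDd); rewrite divn1 => big.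
have {}big : 100 * d ^ 3 * 3 ^ d <= 4 ^ d.
  rewrite -(ler_nat rat) natrM (natrX _ 3 d) (natrX _ 4 d).
  have -> : (4%:R ^+ d = (1 + 1 / 3) ^+ d * 3%:R ^+ d :> rat)%R.
    by rewrite -exprMn; congr (_ ^+ _)%R; lra.
  by apply: ler_wpM2r => //; rewrite exprn_ge0.
have := mm3_shift (n - d.+1) d; have -> : n - d.+1 + d = n.-1 by lia.
have := @mm3_mono n.-1 n (leq_pred n).
move: (mm3 _) (mm3 _) (mm3 _) => x y z yz sh.
have d0 : 0 < d by lia.
have p0 : 0 < 3 ^ d by rewrite expn_gt0.
have le : 100 * (d * d) * 3 ^ d <= 4 ^ d.
  apply: leq_trans big; rewrite leq_mul2r; apply/orP; right.
  by rewrite leq_mul2l /= !expnS expn0 muln1 leq_mul2l leq_pmulr ?orbT.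
rewrite -(leq_pmul2l p0); apply: leq_trans (_ : _ <= 4 ^ d * x) _; last first.
  by apply: leq_trans sh _; rewrite leq_mul2l yz orbT.
have -> : 3 ^ d * (100 * (d * d * x)) = 100 * (d * d) * 3 ^ d * x by clear; ring.
by rewrite leq_mul2r le orbT.
Qed.

Lemma high_degree_bound (T : finType) (e : rel T) z : symmetric e -> irreflexive e ->
  3 * num_induced_cycles e <=
  3 * max_induced_cycles #|T|.-1 + #|nbh e z| * #|nbh e z| * mm3 (#|T| - #|nbh e z|.+1).
Proof.
move=> es ei.
have sub : [set C | induced_cycle e C] \subset
    [set C | induced_cycle e C & C \subset ~: [set z]] :|: [set C | induced_cycle e C & z \in C].
  apply/subsetP=> C; rewrite inE => Ccyc; rewrite in_setU !inE Ccyc /=.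
  by rewrite subsetC sub1set inE orNb.
have le3 := leq_trans (subset_leq_card sub) (leq_card_setU _ _).
have le2 := cycles_within es ei (~: [set z]); rewrite cardsC1 in le2.
have key c m x y d : c <= y + x -> y <= m -> 3 * x <= d -> 3 * c <= 3 * m + d by lia.
apply: (key _ _ _ _ _ le3 le2).
apply: leq_trans (_ : _ <= 3 * _) _.
  by rewrite leq_mul2l; exact: card_cycles_through es ei z.
rewrite big_distrr /= -cardsX -sum_nat_const.
rewrite [leqRHS](eq_bigl (fun q => e z q.1 && e z q.2)); last first.
  by move=> [a b]; rewrite in_setX !in_nbh.
apply: leq_sum => q _; apply: leq_trans (ipaths_le e q.1 #|T| _ q.2) _.
by rewrite cardsCs setCK cardsU1 in_nbh ei add1n.
Qed.

Lemma trichotomy : exists n1, forall (T : finType) (e : rel T),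
  symmetric e -> irreflexive e -> n1 <= #|T| ->
  [\/ 3 * num_induced_cycles e < mm3 #|T|,
      300 * num_induced_cycles e <= 300 * max_induced_cycles #|T|.-1 + mm3 #|T|
    | exists B, segment e 8 B].
Proof.
have [D HD] := degree_threshold; have [n1 Hn1] := segment_exists D.
exists n1 => T e es ei leT.
have [lt|ge] := ltnP (3 * num_induced_cycles e) (mm3 #|T|); first exact: Or31.
have [/existsP[z gtD]|] := boolP [exists z, D < #|nbh e z|].
  apply: Or32.
  have ltT : #|nbh e z| < #|T|.
    rewrite -cardsT; apply: proper_card; apply/properP; split; first exact: subsetT.
    by exists z; rewrite ?in_setT ?in_nbh ?ei.
  have key c m x d : 3 * c <= 3 * m + d -> 100 * d <= x -> 300 * c <= 300 * m + x by lia.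
  exact: key (high_degree_bound z es ei) (HD _ _ (ltnW gtD) ltT).
rewrite negb_exists => /forallP small; apply: Or33.
by apply: Hn1 => // x; rewrite leqNgt.
Qed.

Lemma segment_bound3 (T : finType) (e : rel T) B : symmetric e -> irreflexive e ->
  segment e 8 B -> 12 <= #|T| ->
  3 * num_induced_cycles e <= mm3 #|T| + 18 * 2 ^ 9 + 3 * max_induced_cycles (#|T| - 12).
Proof.
move=> es ei seg le12.
have := segment_bound es ei seg (N := mm3 (#|T| - 12) %/ 3).
have mE : mm3 #|T| = 81 * mm3 (#|T| - 12).
  by rewrite -{1}(subnK le12) -[12]/(3 + 3 + 3 + 3) !addnA !mm3D3; lia.
have H b1 b4 : size (ipaths e b1 #|T| (seg_rest B) b4) <= mm3 (#|T| - 12) %/ 3.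
  by rewrite leq_divRL // mulnC -(card_seg_rest seg) ipaths_le.
move/(_ (fun b1 b4 _ _ => H b1 b4)); rewrite mE.
have := leq_divM (mm3 (#|T| - 12)) 3.
move: (num_induced_cycles e) (max_induced_cycles _) (mm3 _) (mm3 _ %/ 3) => c m x y.
clear; lia.
Qed.

Lemma mm3_ge n : n <= mm3 n.
Proof.
suff : n + 3 <= mm3 n by apply: leq_trans; exact: leq_addr.
by elim/ind3: n => // n IH; rewrite mm3D3; lia.
Qed.

Lemma max_cycles_le n N :
  (forall e : rel 'I_n, symmetric e -> irreflexive e -> num_induced_cycles e <= N) ->
  max_induced_cycles n <= N.
Proof.
move=> H; apply/bigmax_leqP => g /andP[/forallP girr /forallP gsym]; apply: H.
  by move=> x y; have /forallP/(_ y)/eqP := gsym x.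
by move=> x; apply/negbTE; exact: girr.
Qed.

(** Graphs with few cycles and graphs with a segment both fall under the second alternative; the
    constant number of local cycles is absorbed in one hundredth of [mm3 n]. *)
Lemma max_cycles_rec : exists n1, 12 <= n1 /\ forall n, n1 <= n ->
  300 * max_induced_cycles n <= 300 * max_induced_cycles n.-1 + mm3 n \/
  300 * max_induced_cycles n <= 101 * mm3 n + 300 * max_induced_cycles (n - 12).
Proof.
have [n1 Hn1] := trichotomy.
exists (maxn (n1 + 12) (100 * (18 * 2 ^ 9))); split; first by rewrite leq_max leq_addl.
move=> n; rewrite geq_max => /andP[le1 le2].
pose a := (300 * max_induced_cycles n.-1 + mm3 n).
pose b := (101 * mm3 n + 300 * max_induced_cycles (n - 12)).
suff : max_induced_cycles n <= maxn (a %/ 300) (b %/ 300).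
  by rewrite leq_max => /orP[]; rewrite leq_divRL // mulnC => H; [left|right].
apply: max_cycles_le => e es ei; rewrite leq_max !leq_divRL // ![_ * 300]mulnC.
have leT : n1 <= #|'I_n| by rewrite card_ord; clear -le1; lia.
have leb : 100 * (18 * 2 ^ 9) <= mm3 n := leq_trans le2 (mm3_ge n).
apply/orP; rewrite /a /b; case: (Hn1 _ e es ei leT) => [lt|le|[B seg]].
- right; rewrite card_ord in lt; move: lt; clear.
  by move: (num_induced_cycles e) (max_induced_cycles _) (mm3 _) => c m x; lia.
- by left; rewrite card_ord in le.
right; have le12 : 12 <= #|'I_n| by rewrite card_ord; clear -le1; lia.
have := segment_bound3 es ei seg le12; rewrite card_ord; move: leb.
move: (num_induced_cycles e) (max_induced_cycles _) (mm3 _) (2 ^ 9) => c m x y; clear; lia.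
Qed.

Lemma max_cycles_bounded : exists E, forall n, 15 * max_induced_cycles n <= (6 + E) * mm3 n.
Proof.
have [n1 [n12 Hn1]] := max_cycles_rec.
exists (15 * 2 ^ 2 ^ n1 + 100); elim/ltn_ind => n IH.
set E := 15 * _ + _ in IH *.
have [ltn1|len1] := ltnP n n1.
  have : max_induced_cycles n <= 2 ^ 2 ^ n1.
    apply: max_cycles_le => e _ _; apply: leq_trans (max_card _) _.
    rewrite -cardsT -powersetT card_powerset cardsT card_ord leq_exp2l //; apply: leq_trans (ltnW ltn1) _.
    by apply: ltnW; exact: ltn_expl.
  have := mm3_gt0 n; rewrite /E; move: (max_induced_cycles _) (mm3 _) (2 ^ 2 ^ n1) => c m x; clear; nia.
have n0 : 12 <= n := leq_trans n12 len1.
have [H|H] := Hn1 n len1.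
  have := IH n.-1 ltac:(lia); have := mm3S n.-1; rewrite prednK; last by lia.
  have e100 : 100 <= E by rewrite /E leq_addl.
  case=> + _; move: H e100; clear.
  move: (max_induced_cycles _) (max_induced_cycles _) (mm3 _) (mm3 _) E => c m x y E; nia.
have := IH (n - 12) ltac:(lia).
have : mm3 n = 81 * mm3 (n - 12).
  by rewrite -{1}(subnK n0) -[12]/(3 + 3 + 3 + 3) !addnA !mm3D3; lia.
have e100 : 100 <= E by rewrite /E leq_addl.
move: H e100; clear.
move: (max_induced_cycles _) (max_induced_cycles _) (mm3 _) (mm3 _) E => c m x y E; nia.
Qed.

(** Both alternatives of the recursion contract the ratio to [mm3], by 3/4 and by 1/81, with fixed
    points below 6/15. So [E] drops by one at the price of a larger threshold, until it is 0. *)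
Lemma max_cycles_asymptotic : exists n2, forall n, n2 <= n ->
  15 * max_induced_cycles n <= 6 * mm3 n.
Proof.
have [n1 [n12 Hn1]] := max_cycles_rec.
have [E] := max_cycles_bounded.
move=> HE; have : exists n0, forall n, n0 <= n -> 15 * max_induced_cycles n <= (6 + E) * mm3 n.
  by exists 0 => n _; exact: HE.
elim: E {HE} => [|E IH] [n0 Hn0]; first by exists n0 => n /Hn0; rewrite addn0.
apply: IH; exists (n1 + n0 + 12) => n len.
have n0n : 12 <= n by clear -len; lia.
have [H|H] := Hn1 n ltac:(clear -len; lia).
  have := Hn0 n.-1 ltac:(clear -len; lia); have := mm3S n.-1; rewrite prednK; last by lia.
  case=> + _; move: H; clear.
  move: (max_induced_cycles _) (max_induced_cycles _) (mm3 _) (mm3 _) => c m x y; nia.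
have := Hn0 (n - 12) ltac:(clear -len; lia).
have : mm3 n = 81 * mm3 (n - 12).
  by rewrite -{1}(subnK n0n) -[12]/(3 + 3 + 3 + 3) !addnA !mm3D3; lia.
move: H; clear.
move: (max_induced_cycles _) (max_induced_cycles _) (mm3 _) (mm3 _) => c m x y; nia.
Qed.

(** The competitors stay below the required 1/3 of [mm3 #|T|]: a vertex of high degree gives at most
    [3 / 4 * 6 / 15 + 1 / 300], and a segment whose search tree is not a strip at most
    [31 / 96 + 6 / (15 * 81)] plus a constant. *)
Theorem extremal_strip : exists n3, forall (T : finType) (e : rel T),
  symmetric e -> irreflexive e -> n3 <= #|T| -> mm3 #|T| <= 3 * num_induced_cycles e ->
  exists B b1 b4 ls, [/\ segment e 8 B, b1 \in B 1, b4 \in B 4,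
    strip e b1 (seg_rest B) b4 ls &
    all (fun Y : {set T} => 1 < #|Y| <= 4) ls /\ 3 * \prod_(Y <- ls) #|Y| = mm3 (#|T| - 12)].
Proof.
have [n1 Hn1] := trichotomy; have [n2 Hn2] := max_cycles_asymptotic.
exists (n1 + n2 + 12 + 2000 * (18 * 2 ^ 9)) => T e es ei leT big.
have le12 : 12 <= #|T| by clear -leT; lia.
have le1 : n1 <= #|T| by clear -leT; lia.
have le2 : 2000 * (18 * 2 ^ 9) <= mm3 #|T|.
  by apply: leq_trans (mm3_ge _); clear -leT; lia.
have mE : mm3 #|T| = 81 * mm3 (#|T| - 12).
  by rewrite -{1}(subnK le12) -[12]/(3 + 3 + 3 + 3) !addnA !mm3D3; lia.
case: (Hn1 T e es ei le1) => [lt|le|[B seg]].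
- by move: big; rewrite leqNgt lt.
- exfalso; have := Hn2 #|T|.-1 ltac:(clear -leT; lia).
  have := mm3S #|T|.-1; rewrite prednK; last by clear -le12; lia.
  have := mm3_gt0 #|T|; move: le big; clear.
  move: (num_induced_cycles e) (max_induced_cycles _) (mm3 _) (mm3 _) => c m x y; lia.
have [b1 h1] : exists b1, b1 \in B 1.
  by apply/set0Pn; rewrite -card_gt0 (seg_card seg).
have [b4 h4] : exists b4, b4 \in B 4.
  by apply/set0Pn; rewrite -card_gt0 (seg_card seg).
case: (ipaths_strip e b1 #|T| (seg_rest B) b4) => [small|[ls [st all4]]]; last first.
  by rewrite (card_seg_rest seg) => prodE; exists B, b1, b4, ls.
exfalso; rewrite (card_seg_rest seg) in small.
have := segment_bound es ei seg (N := size (ipaths e b1 #|T| (seg_rest B) b4)).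
have H b1' b4' : b1' \in B 1 -> b4' \in B 4 ->
    size (ipaths e b1' #|T| (seg_rest B) b4') <= size (ipaths e b1 #|T| (seg_rest B) b4).
  by move=> h1' h4'; rewrite (seg_ipaths es seg h1' h4' h1 h4).
move/(_ H); have := Hn2 (#|T| - 12) ltac:(clear -leT; lia).
have := mm3_gt0 (#|T| - 12); move: small mE le2 big; clear.
move: (num_induced_cycles e) (max_induced_cycles _) (mm3 _) (mm3 _) (size _) (2 ^ 9) => c m x y s p; lia.
Qed.

(** * Cyclic braids *)

Section CyclicOrdinals.
Variable k : nat.
Implicit Types i j : 'I_k.

Lemma val_iter_ordS m i : val (iter m (@ordS k) i) = (i + m) %% k.
Proof.
elim: m => [|m IH]; first by rewrite addn0 modn_small.
by rewrite iterS /= IH -[_.+1]addn1 modnDml -addnA addn1.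
Qed.

Lemma ordS_cycle (P : pred 'I_k) : (forall i, P i -> P (ordS i)) ->
  forall i j, P i -> P j.
Proof.
move=> PS i j Pi; have -> : j = iter (j + k - i) (@ordS k) i.
  apply: val_inj; rewrite val_iter_ordS.
  have -> : i + (j + k - i) = j + k by have := ltn_ord i; lia.
  by rewrite modnDr modn_small.
by elim: (_ - _) => //= m; exact: PS.
Qed.

Lemma iter_ordS_neq m i : 0 < m < k -> iter m (@ordS k) i == i = false.
Proof.
have key x : x < k -> 0 < m < k -> (x + m) %% k = x -> False.
  move=> ltx mk; have [lt|le] := ltnP (x + m) k; first by rewrite modn_small //; lia.
  by rewrite -(subnK le) modnDr modn_small; lia.
by move=> mk; apply/eqP=> /(congr1 val); rewrite val_iter_ordS; exact: key.
Qed.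

Lemma cycle_adjE i j : 2 < k -> i < j ->
  cycle_adj i j = (j == i.+1 :> nat) || ((i == 0 :> nat) && (j == k.-1 :> nat)).
Proof.
move=> k2 ij; rewrite /cycle_adj -!val_eqE /=.
move: ij (ltn_ord j); move: (nat_of_ord i) (nat_of_ord j) => x y xy lty.
rewrite (modn_small (m := x.+1)); last by lia.
have [->|ne] := eqVneq y k.-1; last by rewrite modn_small; lia.
by rewrite prednK ?modnn; lia.
Qed.

Lemma cycle_adjC : symmetric (@cycle_adj k).
Proof. by move=> i j; rewrite /cycle_adj orbC. Qed.

Lemma cycle_adj_ordS i : cycle_adj i (ordS i). Proof. by rewrite /cycle_adj eqxx. Qed.

Lemma cycle_adj_irr i : 1 < k -> cycle_adj i i = false.
Proof. by move=> k1; rewrite /cycle_adj orbb eq_sym (@iter_ordS_neq 1). Qed.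

End CyclicOrdinals.

Lemma card_family_prod (I T : finType) (F : I -> {set T}) :
  #|family (fun i => mem (F i))| = \prod_i #|F i|.
Proof. by rewrite card_family foldrE big_image. Qed.

Section Braids.
Variables (T : finType) (e : rel T) (k : nat) (lay : T -> 'I_k).
Hypotheses (e_sym : symmetric e) (e_irr : irreflexive e) (k4 : 4 < k).
Hypothesis layE : forall x y, lay x != lay y -> e x y = cycle_adj (lay x) (lay y).
Implicit Types (C P Q : {set T}) (x y : T) (i j : 'I_k).

Definition layer i := [set x | lay x == i].
Local Notation a i := #|layer i|.

Lemma in_layer i x : (x \in layer i) = (lay x == i). Proof. by rewrite inE. Qed.

Lemma layer_adj x y : cycle_adj (lay x) (lay y) -> e x y.
Proof.
move=> adj; rewrite layE //; apply: contraTneq adj => ->.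
by rewrite cycle_adj_irr //; lia.
Qed.

Lemma adj_layer x y : e x y -> lay y = lay x \/ cycle_adj (lay x) (lay y).
Proof.
move=> exy; have [->|ne] := eqVneq (lay y) (lay x); first by left.
by right; rewrite -layE // eq_sym.
Qed.

Definition sides j := layer (ord_pred j) :|: layer (ordS j).

Lemma in_sides j x : (x \in sides j) = cycle_adj j (lay x).
Proof.
rewrite !inE /cycle_adj orbC; congr (_ || _).
by apply/eqP/eqP=> ->; rewrite ?ordSK ?ord_predK.
Qed.

Lemma layer_module C j : induced_cycle e C -> 1 < #|C :&: layer j| ->
  [\/ C \subset layer j,
      exists x x' y, [/\ x \in layer j, x' \in layer j & y \in sides j] /\
        [/\ x != x', e x x' & C = [set x; x'; y]]
    | exists x x' y y', [/\ x \in layer j, x' \in layer j, y \in sides j & y' \in sides j] /\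
        [/\ x != x', y != y', ~~ e x x', ~~ e y y' & C = [set x; x'] :|: [set y; y']]].
Proof.
move=> Ccyc; apply: (module_cycle e_sym e_irr Ccyc).
- move=> x y; rewrite in_layer in_sides => /eqP <-; exact: layer_adj.
- move=> x; rewrite in_layer => /eqP xj; apply/subsetP=> y; rewrite in_nbh => /adj_layer.
  by rewrite in_setU in_layer in_sides xj => -[->|->]; rewrite ?eqxx ?orbT.
apply/pred0P=> x /=; rewrite in_layer in_sides; apply/negP=> /andP[/eqP ->].
by rewrite cycle_adj_irr //; lia.
Qed.

(** Of the two cycle neighbours of a vertex at most one lies in the preceding layer and none in its
    own, so the cycle always reaches the next layer and goes all the way round. *)
Lemma cycle_transversal C : induced_cycle e C -> (forall j, #|C :&: layer j| <= 1) ->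
  forall j, exists x, C :&: layer j = [set x].
Proof.
move=> Ccyc le1 j; apply/cards1P; rewrite eqn_leq le1 card_gt0 /=.
have [x0 x0C] : exists x, x \in C.
  by apply/set0Pn; rewrite -card_gt0; case/andP: Ccyc; lia.
apply: (@ordS_cycle _ (fun j => C :&: layer j != set0) _ (lay x0)) => [i|]; last first.
  by apply/set0Pn; exists x0; rewrite inE x0C in_layer eqxx.
case/set0Pn=> x /setIP[xC]; rewrite in_layer => /eqP xi.
have one u v : u \in C -> v \in C -> lay u = lay v -> u = v.
  move=> uC vC uv; apply/eqP/negPn/negP=> ne; have := le1 (lay u); rewrite leqNgt => /negP[].
  by apply/card_gt1P; exists u, v; rewrite !in_setI !in_layer uv uC vC eqxx.
have [y [z [yz yC zC nb]]] := cycle_nbrs e_sym e_irr Ccyc xC.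
have side w : w \in C -> e x w -> lay w = ordS i \/ lay w = ord_pred i.
  move=> wC exw; have [wx|] := adj_layer exw.
    by rewrite (one _ _ wC xC wx) e_irr in exw.
  by rewrite xi => /orP[/eqP|/eqP ->]; [left|right; rewrite ordSK].
have mk w : w \in C -> lay w = ordS i -> C :&: layer (ordS i) != set0.
  by move=> wC wi; apply/set0Pn; exists w; rewrite inE wC in_layer wi eqxx.
have [|yi] := side y yC ltac:(by rewrite nb // eqxx); first exact: mk.
have [|zi] := side z zC ltac:(by rewrite nb // eqxx orbT); first exact: mk.
by move: yz; rewrite (one _ _ yC zC) ?eqxx // yi zi.
Qed.

Lemma card_transversals :
  #|[set C | induced_cycle e C & [forall j, #|C :&: layer j| <= 1]]| <= \prod_j a j.
Proof.
rewrite -card_family_prod.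
apply: leq_trans (leq_imset_card (fun f : {ffun 'I_k -> T} => [set f i | i : 'I_k]) _).
apply/subset_leq_card/subsetP=> C; rewrite inE => /andP[Ccyc /forallP le1].
have ex j : {x | C :&: layer j == [set x]}.
  by apply: sigW; have [x ->] := cycle_transversal Ccyc le1 j; exists x.
have exE j : sval (ex j) \in C :&: layer j by case: (ex j) => x /= /eqP ->; rewrite set11.
apply/imsetP; exists [ffun j => sval (ex j)].
  by apply/familyP=> j; rewrite ffunE; have /setIP[] := exE j.
apply/setP=> x; apply/idP/imsetP=> [xC|[j _ ->]]; last by rewrite ffunE; have /setIP[] := exE j.
exists (lay x) => //; rewrite ffunE; case: (ex (lay x)) => y /= /eqP yE.
by apply/set1P; rewrite -yE inE xC in_layer eqxx.
Qed.

Definition has_edge P := [exists x in P, exists y in P, e x y].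

Definition edge_cycles j P :=
  [set P :|: D | D in [set [set y] | y in sides j] :|: (powerset (layer j :\: P) :\ set0)].
Definition nonedge_cycles j P :=
  [set P :|: [set p.1; p.2] | p in setX (layer (ord_pred j)) (layer (ordS j))].
Definition pairs j := [set P : {set T} | P \subset layer j & #|P| == 2].
(** A superset of the cycles charged to the pair [P]. A square made of two pairs in consecutive
    layers is charged to the first one only, so just [ordS j] appears. *)
Definition pair_cycles j P := (if has_edge P then edge_cycles j P else nonedge_cycles j P)
  :|: [set P :|: Q | Q in pairs (ordS j)].

(* The first term of the maximum counts the cycles P :|: [set u; v] for a
   non-edge P of a layer of size y and u, v in its two neighbouring layers; the
   second one the triangles over an edge P and the cycles inside the layer that
   contain P. *)
Definition local_count (x y z : nat) := 'C(y, 2) * (maxn (x * z) (x + z + 2 ^ (y - 2) - 1) + 'C(z, 2)).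

Lemma card_pair_cycles j P : P \in pairs j ->
  #|pair_cycles j P| <= maxn (a (ord_pred j) * a (ordS j))
    (a (ord_pred j) + a (ordS j) + 2 ^ (a j - 2) - 1) + 'C(a (ordS j), 2).
Proof.
rewrite inE => /andP[PV /eqP P2].
apply: leq_trans (leq_card_setU _ _) _; apply: leq_add; last first.
  by apply: leq_trans (leq_imset_card _ _) _; rewrite cards_draws.
case: ifP => _; rewrite leq_max; apply/orP; [right|left].
  apply: leq_trans (leq_imset_card _ _) _; apply: leq_trans (leq_card_setU _ _) _.
  rewrite -addnBA ?expn_gt0 //; apply: leq_add.
    by apply: leq_trans (leq_imset_card _ _) _; exact: leq_card_setU.
  have := cardsD1 set0 (powerset (layer j :\: P)).
  rewrite powersetE sub0set card_powerset cardsD (setIidPr PV) P2 => ->.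
  by rewrite add1n subn1.
by apply: leq_trans (leq_imset_card _ _) _; rewrite cardsX.
Qed.

Lemma pair_cycles_cover C j : induced_cycle e C -> 1 < #|C :&: layer j| ->
  exists i P, P \in pairs i /\ C \in pair_cycles i P.
Proof.
have pairP i u v : u \in layer i -> v \in layer i -> u != v -> [set u; v] \in pairs i.
  move=> ui vi uv; rewrite inE cards2 uv andbT.
  by apply/subsetP=> w; rewrite in_set2 => /orP[] /eqP ->.
move=> Ccyc /(layer_module Ccyc); case=> [CV|[x [x' [y [[xV x'V yS] [ne exx ->]]]]]|].
- have [x xC] : exists x, x \in C.
    by apply/set0Pn; rewrite -card_gt0; case/andP: Ccyc; lia.
  have [y [z [yz yC zC nb]]] := cycle_nbrs e_sym e_irr Ccyc xC.
  have exy : e x y by rewrite nb // eqxx.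
  have ne : x != y by apply: contraTneq exy => ->; rewrite e_irr.
  have sub : [set x; y] \subset C by apply/subsetP=> w; rewrite !inE => /orP[] /eqP ->.
  exists j, [set x; y]; split; first by rewrite inE (subset_trans sub CV) cards2 ne.
  rewrite inE; apply/orP; left; rewrite ifT; last first.
    apply/exists_inP; exists x; first by rewrite !inE eqxx.
    by apply/exists_inP; exists y; rewrite // !inE eqxx orbT.
  apply/imsetP; exists (C :\: [set x; y]); last first.
    by rewrite -{1}(setID C [set x; y]) (setIidPr sub).
  rewrite in_setU in_setD1 powersetE setSD // andbT; apply/orP; right.
  apply/set0Pn; exists z; rewrite !inE zC andbT negb_or (eq_sym z y) yz andbT.
  have exz : e x z by rewrite nb // eqxx orbT.
  by apply: contraTneq exz => ->; rewrite e_irr.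
- exists j, [set x; x']; split; first exact: pairP.
  rewrite inE; apply/orP; left; rewrite ifT; last first.
    apply/exists_inP; exists x; first by rewrite !inE eqxx.
    by apply/exists_inP; exists x'; rewrite // !inE eqxx orbT.
  apply/imsetP; exists [set y] => //; rewrite inE; apply/orP; left.
  by apply/imsetP; exists y.
case=> x [x' [y [y' [[xV x'V yS y'S] [xx' yy' nexx neyy ->]]]]].
have cover i u v w z : u \in layer i -> v \in layer i -> u != v ->
    w \in layer (ordS i) -> z \in layer (ordS i) -> w != z ->
    exists i P, P \in pairs i /\ [set u; v] :|: [set w; z] \in pair_cycles i P.
  move=> ui vi uv wi zi wz; exists i, [set u; v]; split; first exact: pairP.
  by rewrite inE; apply/orP; right; apply/imsetP; exists [set w; z] => //; exact: pairP.
have cross w w' : w \in layer (ord_pred j) -> w' \in layer (ordS j) ->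
    exists i P, P \in pairs i /\ [set x; x'] :|: [set w; w'] \in pair_cycles i P.
  move=> wi w'i; exists j, [set x; x']; split; first exact: pairP.
  rewrite inE; apply/orP; left; rewrite ifF; last first.
    apply/exists_inP=> -[u]; rewrite in_set2 => uP /exists_inP[v]; rewrite in_set2 => vP.
    by case/orP: uP => /eqP ->; case/orP: vP => /eqP ->; rewrite ?e_irr // ?(negbTE nexx) // e_sym (negbTE nexx).
  by apply/imsetP; exists (w, w') => //; rewrite in_setX wi.
move: yS y'S; rewrite in_setU => /orP[] yS; rewrite in_setU => /orP[] y'S.
- rewrite setUC; apply: (cover (ord_pred j)) => //; by rewrite ord_predK.
- exact: cross.
- by rewrite (setUC [set y]); exact: cross.
- exact: (cover j).
Qed.

Lemma braid_bound : num_induced_cycles e <=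
  \prod_j a j + \sum_j local_count (a (ord_pred j)) (a j) (a (ordS j)).
Proof.
pose X1 := [set C | induced_cycle e C & [forall j, #|C :&: layer j| <= 1]].
pose X2 := [set C | induced_cycle e C & [exists j, 1 < #|C :&: layer j|]].
have sub : [set C | induced_cycle e C] \subset X1 :|: X2.
  apply/subsetP=> C; rewrite 3!inE => Ccyc; rewrite Ccyc inE Ccyc /=.
  by case: (boolP [forall j, _]) => //; rewrite negb_forall => /existsP[j jC]; apply/existsP; exists j; rewrite ltnNge.
apply: leq_trans (subset_leq_card sub) _; apply: leq_trans (leq_card_setU _ _) _.
apply: leq_add; first exact: card_transversals.
have le := @card_le_cover_sum {set T} ('I_k * {set T})%type {set T} (fun p => p.2 \in pairs p.1)
   (fun p => enum (pair_cycles p.1 p.2)) (fun _ C => C) X2.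
apply: leq_trans (le _) _.
  move=> C; rewrite inE => /andP[Ccyc /existsP[j jC]].
  have [i [P [PP PC]]] := pair_cycles_cover Ccyc jC.
  by exists (i, P); split=> //; exists C; rewrite ?mem_enum.
rewrite -(pair_big_dep xpredT (fun j P => P \in pairs j)
  (fun j P => size (enum (pair_cycles j P)))) /=.
apply: leq_sum => j _; rewrite /local_count.
rewrite -(cards_draws (layer j)) -sum_nat_const; apply: leq_sum => P PP.
by rewrite -cardE card_pair_cycles.
Qed.

End Braids.

(** * Closing a strip to a cyclic braid *)

Section ClosedStrip.
Variables (T : finType) (e : rel T).
Hypothesis e_sym : symmetric e.
Variables (B : nat -> {set T}) (b1 b4 : T) (ls : seq {set T}).
Hypotheses (seg : segment e 8 B) (h1 : b1 \in B 1) (h4 : b4 \in B 4).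
Hypothesis ls0 : 0 < size ls.
Hypothesis st : strip e b1 (seg_rest B) b4 ls.
Implicit Types (x y : T) (i j : nat).

Local Notation LL := [:: B 1, B 2, B 3, B 4 & ls].
Local Notation V := (nth set0 LL).

Lemma closed_strip_rest j x : j < size ls -> x \in nth set0 ls j ->
  forall i, 0 < i < 5 -> x \notin B i.
Proof.
move=> ltj /(strip_mem st ltj); rewrite /seg_rest in_setC !in_setU !negb_or.
by case/andP=> [/andP[/andP[? ?] ?] ?] [|[|[|[|[|i]]]]].
Qed.

Lemma closed_strip_head j : j < 4 -> V j = B j.+1.
Proof. by case: j => [|[|[|[|]]]]. Qed.

(** The strip is only known from [b4] to [b1], but the other vertices of [B 4] and of [B 1] have the
    same neighbours in [seg_rest]. *)
Lemma closed_strip_adj i j x y : i < j -> j < (size ls).+4 -> x \in V i -> y \in V j ->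
  e x y = (j == i.+1) || ((i == 0) && (j == (size ls).+3)).
Proof.
move=> ij ltj; have [j4|j4] := ltnP j 4.
  have i4 := ltn_trans ij j4; rewrite !closed_strip_head // => xi yj.
  have [jE|ne] := eqVneq j i.+1; first by rewrite (seg_adj e_sym seg _ _ _ xi yj) //; lia.
  by rewrite (seg_nonadj seg _ _ _ _ _ _ xi yj) //; lia.
have -> : V j = nth set0 ls (j - 4) by rewrite -{1}(subnK j4) addnC.
have ltj' : j - 4 < size ls by lia.
have [i4|i4] := ltnP i 4; last first.
  have -> : V i = nth set0 ls (i - 4) by rewrite -{1}(subnK i4) addnC.
  move=> xi yj; rewrite (strip_adj st _ ltj' xi yj); lia.
rewrite closed_strip_head // => xi yj; have yR := strip_mem st ltj' yj.
have yB := closed_strip_rest ltj' yj.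
case: i ij i4 xi => [|[|[|[|i]]]] // ij _ xi.
- rewrite e_sym (seg_nbh1 e_sym seg xi yR) -(seg_nbh1 e_sym seg h1 yR).
  rewrite (strip_end st ltj' yj); lia.
- rewrite (_ : _ || _ = false); last by lia.
  by apply/negP=> exy; case: (seg_in seg _ _ xi exy) => //; exact/negP/yB.
- rewrite (_ : _ || _ = false); last by lia.
  by apply/negP=> exy; case: (seg_in seg _ _ xi exy) => //; exact/negP/yB.
have E b : b \in B 4 -> e b y = (y \in B 5).
  by move=> hb; rewrite -(seg_nbh4 e_sym seg hb) in_setI in_nbh yR andbT.
rewrite E // -(E b4) // (strip_start st ltj' yj); lia.
Qed.

Lemma closed_strip_disj i j x : i < j -> j < (size ls).+4 -> x \in V i -> x \in V j -> False.
Proof.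
move=> ij ltj; have [j4|j4] := ltnP j 4.
  have i4 := ltn_trans ij j4; rewrite !closed_strip_head // => xi yj.
  by have := seg_disj seg _ _ xi yj; lia.
have -> : V j = nth set0 ls (j - 4) by rewrite -{1}(subnK j4) addnC.
have ltj' : j - 4 < size ls by lia.
have [i4|i4] := ltnP i 4.
  by rewrite closed_strip_head // => xi xj; have /negP[] := closed_strip_rest ltj' xj (i := i.+1) i4.
have -> : V i = nth set0 ls (i - 4) by rewrite -{1}(subnK i4) addnC.
by apply: (strip_disjoint st); lia.
Qed.

Lemma closed_strip_cover x : has (fun X : {set T} => x \in X) LL.
Proof.
apply/(has_nthP set0); have [xR|] := boolP (x \in seg_rest B).
  have [i lti xi] := strip_cover st xR.
  by exists i.+4.
rewrite /seg_rest in_setC negbK !in_setU => /orP[/orP[/orP[]|]|] xi.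
- by exists 0.
- by exists 1.
- by exists 2.
by exists 3.
Qed.

Lemma closed_strip_layers : exists lay : T -> 'I_(size ls).+4,
  (forall x y, lay x != lay y -> e x y = cycle_adj (lay x) (lay y)) /\
  (forall j : 'I_(size ls).+4, layer lay j = V j).
Proof.
pose lay x : 'I_(size ls).+4 := inord (find (fun X : {set T} => x \in X) LL).
have layV x : x \in V (lay x).
  have := nth_find set0 (closed_strip_cover x); rewrite /lay inordK //.
  by move: (closed_strip_cover x); rewrite has_find.
exists lay; split=> [x y ne|j].
  wlog lt : x y ne / lay x < lay y => [H|].
    have [lt|lt|/val_inj E] := ltngtP (lay x) (lay y); first exact: H.
      by rewrite e_sym cycle_adjC; apply: H; rewrite // eq_sym.
    by rewrite E eqxx in ne.
  by rewrite cycle_adjE // (closed_strip_adj lt (ltn_ord _) (layV x) (layV y)).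
apply/setP=> x; rewrite in_layer; apply/eqP/idP=> [<- //|xj]; apply: val_inj => /=.
have [lt|lt|//] := ltngtP (lay x) j.
  by case: (closed_strip_disj lt (ltn_ord _) (layV x) xj).
by case: (closed_strip_disj lt (ltn_ord _) xj (layV x)).
Qed.

End ClosedStrip.

Lemma sum_layers (T : finType) k (lay : T -> 'I_k) : \sum_j #|layer lay j| = #|T|.
Proof.
rewrite -sum1_card (partition_big lay xpredT) //=; apply: eq_bigr => j _.
by rewrite -sum1_card; apply: eq_bigl => x; rewrite in_layer.
Qed.

Theorem extremal_braid : exists n3, forall (T : finType) (e : rel T),
  symmetric e -> irreflexive e -> n3 <= #|T| -> mm3 #|T| <= 3 * num_induced_cycles e ->
  exists k (lay : T -> 'I_k), [/\ 4 < k,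
    forall x y, lay x != lay y -> e x y = cycle_adj (lay x) (lay y),
    forall j, 1 < #|layer lay j| <= 4 & 3 * \prod_j #|layer lay j| = mm3 #|T|].
Proof.
have [n3 H] := extremal_strip; exists (n3 + 13) => T e es ei le big.
have [|B [b1 [b4 [ls [seg h1 h4 st [/allP ls4 prodE]]]]]] := H T e es ei _ big.
  by clear -le; lia.
have ls0 : 0 < size ls.
  rewrite lt0n; apply/negP=> /nilP lsE; have := strip_card st.
  by rewrite lsE big_nil (card_seg_rest seg); clear -le; lia.
have [lay [layE VE]] := closed_strip_layers es seg h1 h4 ls0 st.
have nE : #|T| - 12 + 12 = #|T| by rewrite subnK //; clear -le; lia.
exists (size ls).+4, lay; split=> // [j|].
  rewrite VE; case: j => -[|[|[|[|j]]]] ltj; rewrite ?(seg_card seg) //=.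
  by apply/ls4/mem_nth.
under eq_bigr do rewrite VE.
rewrite -(big_mkord xpredT (fun j => #|nth set0 [:: B 1, B 2, B 3, B 4 & ls] j|)).
rewrite -(big_nth set0 (r := [:: B 1, B 2, B 3, B 4 & ls]) xpredT (fun X : {set T} => #|X|)).
rewrite !big_cons !(seg_card seg) // -nE -[12]/(3 + 3 + 3 + 3) !addnA !mm3D3 -prodE; lia.
Qed.

(** * Optimal layer sizes *)

Section LayerSizes.
Variables (k : nat) (a : 'I_k -> nat).
Implicit Types (i j p q : 'I_k) (F : nat -> nat -> nat -> nat).

(** Only the three windows containing [p] differ from [F 3 3 3]; the summand on the left avoids a
    subtraction. *)
Lemma sum_windows F p s : 4 < k -> a p = s -> (forall j, j != p -> a j = 3) ->
  \sum_j F (a (ord_pred j)) (a j) (a (ordS j)) + 3 * F 3 3 3 =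
  k * F 3 3 3 + F 3 3 s + F 3 s 3 + F s 3 3.
Proof.
move=> k4 ap a3; set c := F 3 3 3.
have pS j : ord_pred (ordS j) = j := ordSK j.
have Sp j : ordS (ord_pred j) = j := ord_predK j.
have S1 j : ordS j == j = false by apply: (@iter_ordS_neq k 1); clear -k4; lia.
have S2 j : ordS (ordS j) == j = false by apply: (@iter_ordS_neq k 2); clear -k4; lia.
have P1 j : ord_pred j == j = false by rewrite -{2}[j]Sp eq_sym.
have n1 : ordS p != p by rewrite S1.
have n2 : (ord_pred p != p) && (ord_pred p != ordS p).
  by rewrite P1 -{2}[p]Sp eq_sym S2.
have E (G : 'I_k -> nat) : \sum_j G j = G p + (G (ordS p) + (G (ord_pred p) +
    \sum_(j | (j != p) && (j != ordS p) && (j != ord_pred p)) G j)).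
  rewrite (bigD1 p) //; congr (_ + _); rewrite (bigD1 (ordS p)) //; congr (_ + _).
  by rewrite (bigD1 (ord_pred p)).
have -> : k * c = \sum_(j : 'I_k) c by rewrite sum_nat_const card_ord.
rewrite !E pS Sp ap (a3 _ n1) (a3 (ord_pred p)); last by case/andP: n2.
rewrite (a3 (ord_pred (ord_pred p))); last first.
  by apply/eqP=> H; have := S2 (ord_pred (ord_pred p)); rewrite !Sp H eqxx.
rewrite (a3 (ordS (ordS p))); last by rewrite S2.
rewrite (eq_bigr (fun=> c)); first by move: (\sum_(j | _) c) => z; rewrite -/c; lia.
move=> j /andP[/andP[jp jS] jP]; rewrite !a3 //.
- by apply: contra_neq jP => <-; rewrite ordSK.
- by apply: contra_neq jS => <-; rewrite ord_predK.
Qed.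

Lemma prod_le_mm3 (P : pred 'I_k) : 3 * \prod_(j | P j) a j <= mm3 (\sum_(j | P j) a j).
Proof.
elim/big_rec2: _ => [|j x y _ le]; first by rewrite /mm3 div0n mod0n.
rewrite addnC; apply: leq_trans (mm3_branch_le (a j) x).
by rewrite mulnCA leq_mul.
Qed.

Lemma sum_one_special p s : a p = s -> (forall j, j != p -> a j = 3) ->
  \sum_j a j + 3 = 3 * k + s.
Proof.
move=> ap a3; rewrite (bigD1 p) //= ap (eq_bigr (fun=> 3)) => [|j /a3//].
have := sum_nat_const 'I_k 3; rewrite card_ord (bigD1 p) //=; lia.
Qed.

Hypothesis a_range : forall j, 1 < a j <= 4.
Hypothesis a_opt : 3 * \prod_j a j = mm3 (\sum_j a j).

Lemma prod_sizes_gt0 (P : pred 'I_k) : 0 < \prod_(j | P j) a j.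
Proof. by apply: prodn_cond_gt0 => j _; have := a_range j; lia. Qed.

(** Exchange argument: replacing 4 + 4 by 3 + 3 + 2 raises the product from 16 to 18. In the next
    two lemmas 4 + 2 and 2 + 2 + 2 give way to 3 + 3, with 8 < 9. *)
Lemma no_four_pair p q : p != q -> a p = 4 -> a q = 4 -> False.
Proof.
move=> pq ap aq; move: a_opt; rewrite !(bigD1 p (P := xpredT)) //=.
rewrite !(bigD1 q (P := fun i => i != p)) 1?eq_sym //= ap aq.
have := prod_le_mm3 (fun i => (i != p) && (i != q)).
have := prod_sizes_gt0 (fun i => (i != p) && (i != q)).
move: (\prod_(_ | _) _) (\sum_(_ | _) _) => R S R0 le.
rewrite addnA addnC -[4 + 4]/(2 + 3 + 3) !addnA !mm3D3; have := mm3_branch_le 2 S.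
move: (mm3 _) (mm3 _) le => x y; lia.
Qed.

Lemma no_four_two p q : p != q -> a p = 4 -> a q = 2 -> False.
Proof.
move=> pq ap aq; move: a_opt; rewrite !(bigD1 p (P := xpredT)) //=.
rewrite !(bigD1 q (P := fun i => i != p)) 1?eq_sym //= ap aq.
have := prod_le_mm3 (fun i => (i != p) && (i != q)).
have := prod_sizes_gt0 (fun i => (i != p) && (i != q)).
move: (\prod_(_ | _) _) (\sum_(_ | _) _) => R S R0 le.
by rewrite addnA addnC -[4 + 2]/(3 + 3) !addnA !mm3D3; move: (mm3 _) le => x; lia.
Qed.

Lemma no_two_triple p q r : p != q -> p != r -> q != r ->
  a p = 2 -> a q = 2 -> a r = 2 -> False.
Proof.
move=> pq pr qr ap aq ar; move: a_opt; rewrite !(bigD1 p (P := xpredT)) //=.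
rewrite !(bigD1 q (P := fun i => i != p)) 1?eq_sym //= ap aq.
rewrite !(bigD1 r (P := fun i => (i != p) && (i != q))) /=; last 2 first.
- by rewrite eq_sym pr eq_sym qr.
- by rewrite eq_sym pr eq_sym qr.
rewrite ar.
have := prod_le_mm3 (fun i => (i != p) && (i != q) && (i != r)).
have := prod_sizes_gt0 (fun i => (i != p) && (i != q) && (i != r)).
move: (\prod_(_ | _) _) (\sum_(_ | _) _) => R S R0 le.
rewrite !addnA addnC -[2 + 2 + 2]/(3 + 3) !addnA !mm3D3; move: (mm3 _) le => x; lia.
Qed.

Lemma local_count_values : [/\ local_count 3 3 3 = 36, local_count 3 3 4 = 54,
  local_count 3 4 3 = 72, local_count 4 3 3 = 45 &
  [/\ local_count 3 3 2 = 21, local_count 3 2 3 = 12 & local_count 2 3 3 = 27]].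
Proof. by []. Qed.

(* n %% 3 = 1 also arises with two layers of size 2 instead of one of size 4, and
   then the local count is smaller. *)
Definition correction n := nth 0 [:: 12 * n; 12 * n + 51; 12 * n - 36] (n %% 3).

(** One layer of size 4 means [n = 3 * k + 1] and the sum [36 * (k - 3) + 54 + 72 + 45 = 12 * n +
    51]; one of size 2 means [n = 3 * k - 1] and [36 * (k - 3) + 21 + 12 + 27 = 12 * n - 36]. *)
Lemma sum_local_count_le : 4 < k ->
  \sum_j local_count (a (ord_pred j)) (a j) (a (ordS j)) <= correction (\sum_j a j).
Proof.
move=> k4; have small x y z : 1 < x < 4 -> 1 < y < 4 -> 1 < z < 4 -> local_count x y z <= 36.
  by case: x y z => [|[|[|[|x]]]] [|[|[|[|y]]]] [|[|[|[|z]]]].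
have case_other p : (exists q, q != p /\ a q != 3) \/ forall j, j != p -> a j = 3.
  have [/existsP[q /andP[qp aq]]|none] := boolP [exists q, (q != p) && (a q != 3)].
    by left; exists q.
  right=> j jp; apply/eqP/negPn/negP=> aj; case/negP: none; apply/existsP; exists j.
  by rewrite jp.
have a24 j : a j != 3 -> a j = 2 \/ a j = 4.
  by have := a_range j; move: (a j) => x; lia.
have p0 : 'I_k by exists 0; apply: leq_trans k4.
have [/existsP[p /eqP ap]|no4] := boolP [exists p, a p == 4].
  case: (case_other p) => [[q [qp /a24 [aq|aq]]]|a3].
  - by case: (@no_four_two p q) => //; rewrite eq_sym.
  - by case: (@no_four_pair p q) => //; rewrite eq_sym.
  have := sum_windows local_count k4 ap a3.
  have [-> -> -> -> _] := local_count_values.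
  move: (sum_one_special ap a3); move: (\sum_j local_count _ _ _) => S.
move: (\sum_j a j) => n nE; rewrite /correction.
  have -> /= : n %% 3 = 1 by lia.
  by clear -nE; lia.
have a23 j : 1 < a j < 4.
  have := a_range j; case: (eqVneq (a j) 4) => [aj|].
    by case/negP: no4; apply/existsP; exists j; rewrite aj.
  by move: (a j) => x; clear; lia.
have le36 : \sum_j local_count (a (ord_pred j)) (a j) (a (ordS j)) <= k * 36.
  have -> : k * 36 = \sum_(j : 'I_k) 36 by rewrite sum_nat_const card_ord.
  by apply: leq_sum => j _; apply: small.
have [/existsP[p /eqP ap]|no2] := boolP [exists p, a p == 2]; last first.
  have a3 j : a j = 3.
    case: (eqVneq (a j) 3) => // /a24 [aj|aj].
      by case/negP: no2; apply/existsP; exists j; rewrite aj.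
    by have := a23 j; rewrite aj.
  apply: leq_trans le36 _; rewrite (eq_bigr (fun=> 3)) // sum_nat_const card_ord.
  by rewrite /correction modnMl /=; lia.
case: (case_other p) => [[q [qp aq]]|a3].
  have {}aq : a q = 2 by case: (a24 q aq) => // aq4; have := a23 q; rewrite aq4.
  (* With two layers of size 2 the crude bound [36 * k = 12 * n + 24] is enough. *)
  have nE : \sum_j a j + 2 = 3 * k.
    have c2 : \sum_(j : 'I_k) 3 = k * 3 by rewrite sum_nat_const card_ord.
    move: c2; rewrite !(bigD1 p (P := xpredT)) //=.
    rewrite !(bigD1 q (P := fun i => i != p)) //= ap aq.
    rewrite [in X in _ -> X](eq_bigr (fun=> 3)); first by move: (\sum_(_ | _) _) => z; lia.
    move=> j /andP[jp jq]; case: (eqVneq (a j) 3) => // /a24 [aj|aj].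
      by case: (@no_two_triple p q j) => //; rewrite eq_sym.
    by have := a23 j; rewrite aj.
  apply: leq_trans le36 _; rewrite /correction; move: (\sum_j a j) nE => n nE.
  have -> /= : n %% 3 = 1 by lia.
  by clear -nE; lia.
have := sum_windows local_count k4 ap a3.
have [-> _ _ _ [-> -> ->]] := local_count_values.
move: (sum_one_special ap a3); move: (\sum_j local_count _ _ _) => S.
move: (\sum_j a j) => n nE; rewrite /correction.
have -> /= : n %% 3 = 2 by lia.
by clear -nE k4; lia.
Qed.

End LayerSizes.

Theorem max_cycles_upper : exists n4, forall n, n4 <= n ->
  3 * max_induced_cycles n <= mm3 n + 3 * correction n.
Proof.
have [n3 H] := extremal_braid; exists n3 => n len.
have key c : c <= (mm3 n + 3 * correction n) %/ 3 -> 3 * c <= mm3 n + 3 * correction n.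
  by rewrite leq_divRL // mulnC.
apply: key; apply: max_cycles_le => e es ei; rewrite leq_divRL // mulnC.
case: (leqP (mm3 n) (3 * num_induced_cycles e)) => [big|lt]; last first.
  by apply: leq_trans (ltnW lt) (leq_addr _ _).
have cn : #|'I_n| = n := card_ord n.
have [||k [lay [k4 layE sz prodE]]] := H _ e es ei; rewrite ?cn //.
have := braid_bound es ei k4 layE.
have := @sum_local_count_le k (fun j => #|layer lay j|) sz.
rewrite sum_layers cn => /(_ _ k4); rewrite cn in prodE; move/(_ prodE).
move: prodE; move: (num_induced_cycles e) (\prod_j _) (\sum_j _) (mm3 n) (correction n).
move=> c p s m r; clear; lia.
Qed.

(** * The lower bound *)

Lemma square_induced_cycle (T : finType) (e : rel T) (x x' y y' : T) :
  symmetric e -> irreflexive e -> x != x' -> y != y' -> ~~ e x x' -> ~~ e y y' ->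
  [&& e x y, e x y', e x' y & e x' y'] -> induced_cycle e ([set x; x'] :|: [set y; y']).
Proof.
move=> es ei xx' yy' nx ny /and4P[exy exy' ex'y ex'y'].
pose g := nth x [:: x; y; x'; y'].
apply: (enum_induced_cycle es ei (k := 4) (g := g)); split=> //.
- move=> z; rewrite in_setU !in_set2; split.
    by case/orP=> /orP[] /eqP ->; [exists 0|exists 2|exists 1|exists 3].
  by case=> [[|[|[|[|i]]]]] //= _ ->; rewrite /g /= eqxx ?orbT.
- have ne u v : e u v -> u != v by apply: contraTneq => ->; rewrite ei.
  have u : uniq [:: x; y; x'; y'].
    rewrite /= !inE !negb_or xx' yy' (ne x y) // (ne x y') // (ne x' y') //.
    by rewrite (ne y x') // es.
  by move=> i j lti ltj /eqP; rewrite /g nth_uniq // => /eqP.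
by case=> [|[|[|[|i]]]] [|[|[|[|j]]]] //= _ _; rewrite /g /= ?(negbTE nx) ?(negbTE ny) // es.
Qed.

Section IndependentLayers.
Variables (T : finType) (e : rel T) (k : nat) (lay : T -> 'I_k).
Hypotheses (k4 : 4 < k) (layE : forall x y, e x y = cycle_adj (lay x) (lay y)).
Implicit Types (C P Q : {set T}) (x y : T) (i j : 'I_k) (m : 'I_k -> nat).
Local Notation V := (layer lay).

Definition with_profile m := [set C : {set T} | [forall i, #|C :&: V i| == m i]].

Lemma with_profileP C m : reflect (forall i, #|C :&: V i| = m i) (C \in with_profile m).
Proof. by rewrite inE; exact: eqfunP. Qed.

(** The intersections with the layers are chosen independently, and the union determines them. *)
Lemma card_with_profile m : \prod_i 'C(#|V i|, m i) <= #|with_profile m|.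
Proof.
pose F i := [set P : {set T} | P \subset V i & #|P| == m i].
under eq_bigr do rewrite -cards_draws.
rewrite -(card_family_prod F).
have fV (f : {ffun 'I_k -> {set T}}) j : f \in family (fun i => mem (F i)) ->
    (\bigcup_i f i) :&: V j = f j.
  move=> /familyP fF; apply/setP=> x; rewrite in_setI in_layer; apply/andP/idP.
    case=> /bigcupP[i _ xi] /eqP <-; have := fF i; rewrite inE => /andP[/subsetP/(_ x xi)].
    by rewrite in_layer => /eqP ->.
  move=> xj; have := fF j; rewrite inE => /andP[/subsetP/(_ x xj)]; rewrite in_layer => -> _.
  by split=> //; apply/bigcupP; exists j.
have inj : {in family (fun i => mem (F i)) &, injective (fun f : {ffun 'I_k -> {set T}} => \bigcup_i f i)}.
  by move=> f g fF gF E; apply/ffunP=> j; rewrite -(fV f j fF) E fV.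
rewrite -(card_in_imset inj); apply/subset_leq_card/subsetP=> _ /imsetP[f fF ->].
apply/with_profileP=> i; rewrite fV //; have /familyP/(_ i) := fF.
by rewrite inE => /andP[_ /eqP].
Qed.

Lemma layers_sym : symmetric e. Proof. by move=> x y; rewrite !layE cycle_adjC. Qed.

Lemma layers_irr : irreflexive e.
Proof. by move=> x; rewrite layE cycle_adj_irr // ltnW // ltnW // ltnW. Qed.

Lemma transversal_cycle C : C \in with_profile (fun=> 1) -> induced_cycle e C.
Proof.
move/with_profileP=> C1.
have ex i : {x | C :&: V i == [set x]}.
  by apply: sigW; have /eqP/cards1P[x ->] := C1 i; exists x.
pose o : nat -> 'I_k := insubd (Ordinal (ltnW k4) : 'I_k).
have vE i : (sval (ex i) \in C) && (lay (sval (ex i)) == i).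
  by case: (ex i) => x /= /eqP xE; rewrite -in_layer -in_setI xE set11.
have oE n : n < k -> val (o n) = n by move=> lt; rewrite /o val_insubd lt.
pose g n := sval (ex (o n)).
have lg n : lay (g n) = o n by rewrite /g; have /andP[_ /eqP] := vE (o n).
apply: (enum_induced_cycle layers_sym layers_irr (k := k) (g := g)); split.
- by clear -k4; lia.
- move=> x; split=> [xC|[n ltn ->]]; last by rewrite /g; have /andP[] := vE (o n).
  exists (lay x : nat) => //; rewrite /g.
  have -> : o (lay x : nat) = lay x by apply: val_inj; exact: oE _ (ltn_ord _).
  by case: (ex (lay x)) => y /= /eqP yE; apply/set1P; rewrite -yE in_setI xC in_layer eqxx.
- by move=> i j lti ltj /(congr1 lay); rewrite !lg => /(congr1 val); rewrite !oE.
move=> i j ij ltj; have lti := ltn_trans ij ltj.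
rewrite layE !lg cycle_adjE -?[nat_of_ord (o _)]/(val (o _)) ?oE //.
by clear -k4; lia.
Qed.

Definition square_profile j i := if (i == j) || (i == ordS j) then 2 else 0.
Definition bridge_profile j i :=
  if i == j then 2 else if (i == ord_pred j) || (i == ordS j) then 1 else 0.

Lemma profile0_cover C m x : C \in with_profile m -> m (lay x) = 0 -> x \notin C.
Proof.
move=> /with_profileP/(_ (lay x)) + m0; rewrite m0 => /eqP; rewrite cards_eq0 => /eqP CE.
by apply/negP=> xC; move/setP/(_ x): CE; rewrite in_setI xC in_layer eqxx inE.
Qed.

Lemma ordS_neq j : (ordS j == j) = false.
Proof. by apply: (@iter_ordS_neq k 1); clear -k4; lia. Qed.
Lemma ordSS_neq j : (ordS (ordS j) == j) = false.
Proof. by apply: (@iter_ordS_neq k 2); clear -k4; lia. Qed.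
Lemma ordSSS_neq j : (ordS (ordS (ordS j)) == j) = false.
Proof. by apply: (@iter_ordS_neq k 3); clear -k4; lia. Qed.
Lemma ord_pred_neq j : (ord_pred j == j) = false.
Proof. by rewrite -{2}[j]ord_predK eq_sym ordS_neq. Qed.
Lemma ord_pred_neqS j : (ord_pred j == ordS j) = false.
Proof. by rewrite -{2}[j]ord_predK eq_sym ordSS_neq. Qed.

Lemma square_profile_cycle j C : C \in with_profile (square_profile j) -> induced_cycle e C.
Proof.
move=> CP; have /with_profileP Cm := CP.
have /eqP/cards2P[x [x' [xx' CE]]] : #|C :&: V j| = 2 by rewrite Cm /square_profile eqxx.
have /eqP/cards2P[y [y' [yy' CE']]] : #|C :&: V (ordS j)| = 2.
  by rewrite Cm /square_profile eqxx orbT.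
have -> : C = [set x; x'] :|: [set y; y'].
  rewrite -CE -CE' -setIUr; apply/esym/setIidPl/subsetP=> w; apply: contraTT => nw.
  apply: (profile0_cover CP); rewrite /square_profile -!in_layer ifF //.
  by rewrite !in_layer; apply/negbTE; move: nw; rewrite in_setU !in_layer.
have xj w : w \in [set x; x'] -> lay w = j.
  by rewrite -CE in_setI in_layer => /andP[_ /eqP].
have yj w : w \in [set y; y'] -> lay w = ordS j.
  by rewrite -CE' in_setI in_layer => /andP[_ /eqP].
apply: square_induced_cycle; rewrite ?layE ?(xj x) ?(xj x') ?(yj y) ?(yj y') ?inE ?eqxx ?orbT //;
  rewrite ?cycle_adj_ordS ?cycle_adj_irr //; try (by clear -k4; lia).
- exact: layers_sym.
- exact: layers_irr.
Qed.

Lemma bridge_profile_cycle j C : C \in with_profile (bridge_profile j) -> induced_cycle e C.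
Proof.
move=> CP; have /with_profileP Cm := CP.
have /eqP/cards2P[x [x' [xx' CE]]] : #|C :&: V j| = 2 by rewrite Cm /bridge_profile eqxx.
have /eqP/cards1P[y CEp] : #|C :&: V (ord_pred j)| = 1.
  by rewrite Cm /bridge_profile ord_pred_neq eqxx.
have /eqP/cards1P[y' CEs] : #|C :&: V (ordS j)| = 1.
  by rewrite Cm /bridge_profile ordS_neq eqxx orbT.
have -> : C = [set x; x'] :|: [set y; y'].
  rewrite -CE -CEp -CEs -!setIUr; apply/esym/setIidPl/subsetP=> w; apply: contraTT => nw.
  move: nw; rewrite !in_setU !in_layer !negb_or => /and3P[n1 n2 n3].
  by apply: (profile0_cover CP); rewrite /bridge_profile (negbTE n1) (negbTE n2) (negbTE n3).
have xj w : w \in [set x; x'] -> lay w = j.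
  by rewrite -CE in_setI in_layer => /andP[_ /eqP].
have yj : lay y = ord_pred j.
  by have := set11 y; rewrite -CEp in_setI in_layer => /andP[_ /eqP].
have yj' : lay y' = ordS j.
  by have := set11 y'; rewrite -CEs in_setI in_layer => /andP[_ /eqP].
have jp : cycle_adj j (ord_pred j) by rewrite /cycle_adj ord_predK eqxx orbT.
apply: square_induced_cycle;
  rewrite ?layE ?(xj x) ?(xj x') ?yj ?yj' ?inE ?eqxx ?orbT //;
  rewrite ?cycle_adj_ordS ?jp ?cycle_adj_irr //; try (by clear -k4; lia).
- exact: layers_sym.
- exact: layers_irr.
- by apply: contraFneq (ord_pred_neqS j) => E; rewrite -yj -yj' E.
by rewrite /cycle_adj ord_predK ordS_neq; have := ordSSS_neq (ord_pred j); rewrite ord_predK eq_sym => ->.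
Qed.

Definition profile (o : unit + ('I_k + 'I_k)) : 'I_k -> nat :=
  match o with
  | inl _ => fun=> 1 | inr (inl j) => square_profile j | inr (inr j) => bridge_profile j
  end.

(** This keeps the families of cycles disjoint. Two square profiles could agree only if [i] and [j]
    were successors of each other, impossible on a cycle of more than two layers. *)
Lemma profile_inj o o' : profile o =1 profile o' -> o = o'.
Proof.
have two i j : bridge_profile j i = 2 -> i = j.
  by rewrite /bridge_profile; case: eqP => //; case: ifP.
have twos j : square_profile j (ordS j) = 2 by rewrite /square_profile eqxx orbT.
have twoj j : square_profile j j = 2 by rewrite /square_profile eqxx.
have twob j : bridge_profile j j = 2 by rewrite /bridge_profile eqxx.
have tsb i j : square_profile i =1 bridge_profile j -> False.
  move=> H; have := twoj i; rewrite H => /two ij; have := twos i; rewrite H => /two.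
  by rewrite -ij => /eqP; rewrite ordS_neq.
case: o => [[]|[i|i]]; case: o' => [[]|[j|j]] //= H.
- by have := twoj j; rewrite -H.
- by have := twob j; rewrite -H.
- by have := twoj i; rewrite H.
- congr (inr (inl _)); have := twoj i; have := twoj j; rewrite H -(H j) /square_profile.
  case: (eqVneq i j) => [//|ij] /=; case: eqP => // jE; case: eqP => // iE _ _.
  by have := ordSS_neq j; rewrite -iE -jE eqxx.
- by case: (tsb i j).
- by have := twob i; rewrite H.
- by case: (tsb j i) => x; rewrite H.
by congr (inr (inr _)); apply: two; rewrite -H.
Qed.

Lemma prod_square_profile j :
  \prod_i 'C(#|V i|, square_profile j i) = 'C(#|V j|, 2) * 'C(#|V (ordS j)|, 2).
Proof.
rewrite (bigD1 j) //= (bigD1 (ordS j)) ?ordS_neq //= big1 => [|i /andP[ij iS]].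
  by rewrite /square_profile !eqxx orbT muln1.
by rewrite /square_profile (negbTE ij) (negbTE iS) bin0.
Qed.

Lemma prod_bridge_profile j : \prod_i 'C(#|V i|, bridge_profile j i) =
  'C(#|V j|, 2) * (#|V (ord_pred j)| * #|V (ordS j)|).
Proof.
rewrite (bigD1 j) //= (bigD1 (ord_pred j)) ?ord_pred_neq //=.
rewrite (bigD1 (ordS j)) /=; last by rewrite ordS_neq eq_sym ord_pred_neqS.
rewrite big1 => [|i /andP[/andP[ij iP] iS]].
  by rewrite /bridge_profile !eqxx orbT ord_pred_neq ordS_neq muln1 !bin1.
by rewrite /bridge_profile (negbTE ij) (negbTE iS) (negbTE iP) bin0.
Qed.

Definition braid_count (x y z : nat) := 'C(y, 2) * (x * z + 'C(z, 2)).

Theorem braid_cycles_ge :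
  \prod_j #|V j| + \sum_j braid_count #|V (ord_pred j)| #|V j| #|V (ordS j)|
    <= num_induced_cycles e.
Proof.
have sub : \bigcup_o with_profile (profile o) \subset [set C | induced_cycle e C].
  apply/subsetP=> C /bigcupP[o _]; rewrite inE; case: o => [[]|[j|j]] /=.
  - exact: transversal_cycle.
  - exact: square_profile_cycle.
  exact: bridge_profile_cycle.
apply: leq_trans (subset_leq_card sub).
rewrite -sum1_card partition_disjoint_bigcup => [|o o' ne]; last first.
  apply/pred0P=> C /=; apply: contraNF ne => /andP[/with_profileP H /with_profileP H'].
  by apply/eqP/profile_inj => i; rewrite -H -H'.
have le o : \prod_i 'C(#|V i|, profile o i) <= \sum_(C in with_profile (profile o)) 1.
  by rewrite sum1_card card_with_profile.
apply: leq_trans (leq_sum _ (fun o _ => le o)).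
rewrite !big_sumType (big_pred1 tt) /=; last by case.
under [X in _ <= _ + (X + _)]eq_bigr do rewrite prod_square_profile.
under [X in _ <= _ + (_ + X)]eq_bigr do rewrite prod_bridge_profile.
under [X in _ <= X + _]eq_bigr do rewrite bin1.
by rewrite leq_add2l -big_split /=; apply: leq_sum => j _; rewrite /braid_count mulnDr addnC.
Qed.

End IndependentLayers.

(** The graph lives on the tagged sum of the layers and reads adjacency off the tags, so each layer
    is independent. *)
Lemma max_cycles_layers k (a : 'I_k -> nat) : 4 < k ->
  \prod_j a j + \sum_j braid_count (a (ord_pred j)) (a j) (a (ordS j))
    <= max_induced_cycles (\sum_j a j).
Proof.
move=> k4; pose T : finType := {i : 'I_k & 'I_(a i)}.
pose lay (x : T) := tag x; pose e (x y : T) := cycle_adj (lay x) (lay y).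
have layE x y : e x y = cycle_adj (lay x) (lay y) by [].
have cV j : #|layer lay j| = a j.
  have inj : injective (Tagged (fun i => 'I_(a i)) : 'I_(a j) -> T).
    by move=> x y /eqP; rewrite eq_Tagged => /eqP.
  rewrite -[RHS]card_ord -cardsT -(card_imset _ inj); apply: eq_card => x.
  rewrite in_layer; apply/eqP/imsetP=> [<-|[y _ ->] //].
  by exists (tagged x) => //; case: x.
have := num_induced_cycles_le_max (layers_sym layE) (layers_irr k4 layE).
rewrite -(sum_layers lay) (eq_bigr _ (fun j _ => cV j)); apply: leq_trans.
have := braid_cycles_ge k4 layE; rewrite (eq_bigr _ (fun j _ => cV j)).
by under [X in _ + X <= _]eq_bigr do rewrite !cV.
Qed.

Lemma max_cycles_one_special k s : 4 < k ->
  s * 3 ^ k.-1 + 36 * (k - 3) + braid_count 3 3 s + braid_count 3 s 3 + braid_count s 3 3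
    <= max_induced_cycles (3 * k.-1 + s).
Proof.
move=> k4; pose p : 'I_k := Ordinal (ltn_trans (isT : 0 < 4) k4).
pose a j := if j == p then s else 3.
have ap : a p = s by rewrite /a eqxx.
have a3 j : j != p -> a j = 3 by rewrite /a => /negbTE ->.
have := max_cycles_layers a k4; have := sum_windows braid_count k4 ap a3.
have -> : \sum_j a j = 3 * k.-1 + s.
  by have := sum_one_special ap a3; move: (\sum_j _) => S; lia.
have -> : \prod_j a j = s * 3 ^ k.-1.
  rewrite (bigD1 p) //= ap (eq_bigr (fun=> 3)) => [|j /a3 //].
  rewrite prod_nat_const; congr (_ * _ ^ _).
  have := cardC1 p; rewrite card_ord => <-; exact: eq_card.
have -> : braid_count 3 3 3 = 36 by [].
move: (\sum_j _) (braid_count 3 3 s) (braid_count 3 s 3) (braid_count s 3 3) => S x y z.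
move: (max_induced_cycles _) (s * 3 ^ k.-1) => c m; clear -k4; lia.
Qed.

Lemma braid_count_values : [/\ braid_count 3 3 3 = 36, braid_count 3 3 4 = 54,
  braid_count 3 4 3 = 72, braid_count 4 3 3 = 45 &
  [/\ braid_count 3 3 2 = 21, braid_count 3 2 3 = 12 & braid_count 2 3 3 = 27]].
Proof. by []. Qed.

Theorem corollary1p3 :
  exists n0 : nat, forall n : nat, n0 <= n ->
    [/\ n = 0 %[mod 3] ->
          max_induced_cycles n = 3 ^ (n %/ 3) + 12 * n,
        n = 1 %[mod 3] ->
          max_induced_cycles n = 4 * 3 ^ ((n - 4) %/ 3) + 12 * n + 51
      & n = 2 %[mod 3] ->
          max_induced_cycles n = 2 * 3 ^ ((n - 2) %/ 3) + 12 * n - 36].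
Proof.
have [n4 H] := max_cycles_upper; exists (n4 + 15) => n len.
have len4 : n4 <= n by clear -len; lia.
have len15 : 15 <= n by clear -len; lia.
have := H n len4; rewrite /mm3 /correction => le {H len}.
(* This [m] fits all residues: [m] triples with one layer of size 3 or 4, or [m.+1] triples with one
   of size 2. *)
have [m nE] : exists m, n = m.+1 * 3 + n %% 3.
  by exists (n %/ 3).-1; rewrite prednK ?divn_gt0 -?divn_eq //; clear -len15; lia.
have m4 : 4 <= m by have := ltn_pmod n (isT : 0 < 3); clear -nE len15; lia.
have dE : n %/ 3 = m.+1 by rewrite {1}nE divnMDl // divn_small ?addn0 // ltn_mod.
have := max_cycles_one_special 2 (k := m.+2) (ltnW m4).
have := max_cycles_one_special 3 (k := m.+1) m4.
have := max_cycles_one_special 4 (k := m.+1) m4.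
have [-> -> -> -> [-> -> ->]] := braid_count_values.
rewrite /= => low4 low3 low2; rewrite dE in le *.
split=> nm; apply/eqP; rewrite eqn_leq.
- have {}nm : n %% 3 = 0 := nm.
  rewrite nm addn0 in nE; rewrite nm /= in le.
  have E : 3 * m + 3 = n by clear -nE; lia.
  rewrite E in low3; move: le; rewrite !expnS.
  move: (max_induced_cycles n) (3 ^ m) low3 => c z; clear -E m4; lia.
- have {}nm : n %% 3 = 1 := nm.
  rewrite nm in nE; rewrite nm /= in le.
  have E : 3 * m + 4 = n by clear -nE; lia.
  have -> : (n - 4) %/ 3 = m by clear -nE; lia.
  rewrite E in low4; move: le; rewrite !expnS.
  move: (max_induced_cycles n) (3 ^ m) low4 => c z; clear -E m4; lia.
have {}nm : n %% 3 = 2 := nm.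
rewrite nm in nE; rewrite nm /= in le.
have E : 3 * m.+1 + 2 = n by clear -nE; lia.
have -> : (n - 2) %/ 3 = m.+1 by clear -nE; lia.
rewrite E in low2; move: le low2; rewrite !expnS.
move: (max_induced_cycles n) (3 ^ m) => c z; clear -E m4; lia.
Qed.
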